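(* Let $U$ be a separable real Banach space and let $W=(W(t):t\ge 0)$ be a strongly cylindrical Wiener process in $U$ with covariance operator $Q=i_Qi_Q^\ast:U^\ast\to U$, where $i_Q:H_Q\to U$ is the inclusion mapping of the reproducing kernel Hilbert space $H_Q$ associated with $Q$. The following are equivalent: (a) $W$ is induced by a $U$-valued Wiener process; (b) $i_Q$ is $\gamma$-radonifying; (c) the cylindrical distribution of $W(1)$ is tight; (d) the cylindrical distribution of $W(1)$ extends to a measure on $\mathcal{B}(U)$.
   Context: $U^\ast$ is the dual of $U$, $\langle u,u^\ast\rangle$ the dual pairing, $\mathcal{B}(U)$ the Borel $\sigma$-algebra. $(\Omega,\mathcal{A},P)$ is a probability space with a filtration $(\mathcal{F}_t)_{t\ge0}$, and $L^0(\Omega)$ is the space of (equivalence classes of) real random variables. Cylindrical measures. A cylindrical set is a set $\{u\in U:(\langle u,u_1^\ast\rangle,\dots,\langle u,u_n^\ast\rangle)\in B\}$ with $u_i^\ast\in U^\ast$, $B\in\mathcal{B}(\mathbb{R}^n)$. These sets form an algebra, which generates $\mathcal{B}(U)$ because $U$ is separable. A cylindrical measure is a $[0,\infty]$-valued set function on this algebra whose restriction, for each finite $\Gamma\subseteq U^\ast$, to the $\sigma$-algebra generated by the cylindrical sets based on $\Gamma$ is a measure. Its characteristic function is $\varphi_\mu(u^\ast)=\int_U e^{i\langle u,u^\ast\rangle}\mu(du)$. A cylindrical (probability) measure $\mu$ is tight if for each $\varepsilon>0$ there is a compact $K\subseteq U$ such that $\mu(Z)\ge1-\varepsilon$ for every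 cylindrical set $Z\supseteq K$. A cylindrical random variable in $U$ is a linear map $X:U^\ast\to L^0(\Omega)$; its cylindrical distribution is the cylindrical measure $\mu$ with $\varphi_\mu(u^\ast)=E[e^{iXu^\ast}]$ for all $u^\ast\in U^\ast$. A cylindrical process is a family $(X(t):t\ge0)$ of cylindrical random variables; it is adapted if each $X(t)u^\ast$ is $\mathcal{F}_t$-measurable. An $\mathbb{R}^n$-valued Wiener process is an adapted process $B$ with $B(0)=0$ a.s. and independent, stationary increments such that $B(t)-B(s)$ is normal with mean $0$ and covariance matrix $|t-s|C$ for a fixed symmetric non-negative definite matrix $C$. A weakly cylindrical Wiener process in $U$ is an adapted cylindrical process $W$ such that for all $n$ and $u_1^\ast,\dots,u_n^\ast\in U^\ast$ the process $((W(t)u_1^\ast,\dots,W(t)u_n^\ast):t\ge0)$ is an $\mathbb{R}^n$-valued Wiener process. It is a strongly cylindrical Wiener process if in addition the covariance operator $Q$ of $W(1)$, $(Qu^\ast)v^\ast=E[(W(1)u^\ast)(W(1)v^\ast)]$, which a priori takes values in the algebraic dual of $U^\ast$, takes values in $U$. Then $Q:U^\ast\to U$ is bounded, positive and symmetric and is called the covariance operator of $W$. Reproducing kernel Hilbert space: $H_Q$ is the completion of the range of $Q$ under the inner product $[Qu^\ast,Qv^\ast]_{H_Q}:=\langle Qu^\ast,v^\ast\rangle$; the inclusion of the range of $Q$ into $U$ extends to an (injective) bounded operator $i_Q:H_Q\to U$, and $Q=i_Qi_Q^\ast$. A measure on $\mathcal{B}(U)$ is Gaussian if its image under each $u^\ast\in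 U^\ast$ is Gaussian on $\mathbb{R}$ (point masses allowed). The standard Gaussian cylindrical measure $\gamma$ on a separable Hilbert space $H$ has characteristic function $\exp(-\frac12\|u\|_H^2)$; a bounded linear operator $F:H\to U$ is $\gamma$-radonifying if the cylindrical measure $\gamma\circ F^{-1}$ extends to a Gaussian measure on $\mathcal{B}(U)$. A $U$-valued Wiener process is an adapted $U$-valued process $(Y(t):t\ge0)$ with $Y(0)=0$ a.s., with independent, stationary increments, and such that $Y(t)-Y(s)$ has distribution $N(0,(t-s)R)$ for all $0\le s\le t$, where $R:U^\ast\to U$ is the covariance operator of some Gaussian measure on $\mathcal{B}(U)$. A cylindrical process $W$ is induced by a $U$-valued process $Y$ if $W(t)u^\ast=\langle Y(t),u^\ast\rangle$ $P$-a.s. for all $t\ge0$ and $u^\ast\in U^\ast$. *)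

(* Defs.v *)
From HB Require Import structures.
From mathcomp Require Import all_boot all_order all_algebra.
From mathcomp Require Import complex.
From mathcomp Require Import all_classical all_reals all_analysis.

Set Implicit Arguments.
Unset Strict Implicit.
Unset Printing Implicit Defensive.

Import Order.TTheory GRing.Theory Num.Theory.
Import numFieldNormedType.Exports.

Local Open Scope classical_set_scope.
Local Open Scope ring_scope.

Notation borel T := (g_sigma_algebraType (@open T)).

Definition separable (T : topologicalType) : Prop :=
  exists2 A : set T, countable A & dense A.

Section Dual.
Context {R : realType} (U : normedModType R).

Definition dual_pred : {pred U -> R^o} :=
  fun f => `[< linear f /\ continuous f >].

Record dual := Dual { dual_fun :> U -> R^o ; _ : dual_fun \in dual_pred }.

HB.instance Definition _ := [isSub for dual_fun].
HB.instance Definition _ := [Choice of dual by <:].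

Lemma dual_submod_closed : submod_closed dual_pred.
Proof.
split=> [|a f g].
  apply/asboolP; split=> [a x y|]; last exact: cst_continuous.
  by rewrite /= scaler0 addr0.
move=> /asboolP[lf cf] /asboolP[lg cg]; apply/asboolP; split=> [b x y|x].
  have Ez z : (a *: f + g) z = a *: f z + g z by [].
  rewrite !Ez lf lg !scalerDr !scalerA (mulrC a b) -!addrA; congr (_ + _).
  by rewrite addrCA.
by apply: cvgD; [apply: cvgZl_tmp; exact: cf|exact: cg].
Qed.

HB.instance Definition _ :=
  GRing.isSubmodClosed.Build R (U -> R^o) dual_pred dual_submod_closed.
HB.instance Definition _ := [SubChoice_isSubLmodule of dual by <:].

Lemma dual_linear (f : dual) : linear f.
Proof. by case: f => f /= /asboolP[]. Qed.

Lemma dual_continuous (f : dual) : continuous f.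
Proof. by case: f => f /= /asboolP[]. Qed.

End Dual.

Section Cylindrical.
Context {R : realType} {U : normedModType R}.
Implicit Types (mu : set U -> \bar R) (Z : set U).

Definition cylinder n (u : 'I_n -> dual U) (B : set 'rV[R]_n) : set U :=
  [set x | B (\row_i u i x)].

Definition cylinders_over n (u : 'I_n -> dual U) : set (set U) :=
  [set cylinder u B | B in (measurable : set (set (borel 'rV[R]_n)))].

Definition cylindrical_set Z : Prop :=
  exists n (u : 'I_n -> dual U), cylinders_over u Z.

(* [mu] is a total function on [set U]; only its values on cylindrical sets
   are meaningful. *)
Definition cylindrical_measure mu : Prop :=
  forall n (u : 'I_n -> dual U),
    exists m : {measure set (g_sigma_algebraType (cylinders_over u)) -> \bar R},
      forall Z, <<s cylinders_over u >> Z -> mu Z = m Z.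

(* The integrand depends on the single functional [u], so the integral is taken
   on the sigma-algebra generated by the cylinders based on [u], where [mu] is
   a measure. *)
Definition char_fun mu (u : dual U) : R[i] :=
  let m : set (g_sigma_algebraType (cylinders_over (fun _ : 'I_1 => u))) ->
          \bar R := mu in
  Complex (fine (\int[m]_x (cos (u x))%:E)) (fine (\int[m]_x (sin (u x))%:E)).

Definition tight mu : Prop :=
  forall eps : R, 0 < eps -> exists2 K : set U, compact K &
    forall Z, cylindrical_set Z -> K `<=` Z -> ((1 - eps)%:E <= mu Z)%E.

Definition extends_to mu (nu : {measure set (borel U) -> \bar R}) : Prop :=
  forall Z, cylindrical_set Z -> nu Z = mu Z.

End Cylindrical.

Section Gaussian.
Context {R : realType}.

(* [normal_prob m 0] is not a point mass, so the degenerate case is separate. *)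
Definition gauss (m v : R) : set R -> \bar R :=
  if v == 0 then \d_m else normal_prob m (Num.sqrt v).

Definition normal_law (mu : set R -> \bar R) (m v : R) : Prop :=
  0 <= v /\ forall B : set R, measurable B -> mu B = gauss m v B.

Definition gaussian_measure (U : normedModType R)
    (nu : probability (borel U) R) : Prop :=
  forall u : dual U, exists m v, normal_law (fun B => nu (u @^-1` B)) m v.

Definition covariance_operator_of (U : normedModType R)
    (nu : probability (borel U) R) (S : dual U -> U) : Prop :=
  forall u v : dual U, (v (S u))%:E = covariance nu u v.

End Gaussian.

Section Hilbert.
Context {R : realType}.

(* A Hilbert space is a complete normed module with such an [ip]. *)
Definition is_inner_product (H : normedModType R) (ip : H -> H -> R) : Prop :=
  [/\ forall x y, ip x y = ip y x,
      forall a x y z, ip (a *: x + y) z = a * ip x z + ip y z &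
      forall x, ip x x = `|x| ^+ 2].

(* [h] is identified with the functional [ip ^~ h] of the dual. *)
Definition standard_gaussian (H : completeNormedModType R) (ip : H -> H -> R)
    (gamma : set H -> \bar R) : Prop :=
  cylindrical_measure gamma /\
  forall (h : H) (f : dual H), (forall x, f x = ip x h) ->
    char_fun gamma f = Complex (expR (- (`|h| ^+ 2 / 2))) 0.

Definition gamma_radonifying (H : completeNormedModType R) (ip : H -> H -> R)
    (U : normedModType R) (F : {linear H -> U}) : Prop :=
  exists2 gamma : set H -> \bar R, standard_gaussian ip gamma &
    exists2 nu : probability (borel U) R, gaussian_measure nu &
      extends_to (fun Z => gamma (F @^-1` Z)) nu.

(* [H], with inner product [ip] and embedding [j], is the completion of
   [range Q] under [Q u, Q v] := <Q u, v>, and [iQ] is the continuous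
   extension to [H] of the inclusion of [range Q] into [U]. *)
Definition is_rkhs (U : normedModType R) (Q : dual U -> U)
    (H : completeNormedModType R) (ip : H -> H -> R)
    (iQ : {linear H -> U}) : Prop :=
  [/\ is_inner_product ip, continuous iQ &
   exists j : U -> H,
   [/\ forall (a : R) u v,
         j (a *: Q u + Q v) = a *: j (Q u) + j (Q v),
       forall u v, ip (j (Q u)) (j (Q v)) = v (Q u),
       dense (j @` range Q) &
       forall u, iQ (j (Q u)) = Q u]].

End Hilbert.

Section Processes.
Context {d : measure_display} {Omega : measurableType d} {R : realType}.
Variable P : probability Omega R.

(* Time is indexed by [R]; only the values at [t >= 0] are meaningful. *)
Definition is_filtration (F : R -> set (set Omega)) : Prop :=
  (forall t : R, 0 <= t -> sigma_algebra setT (F t) /\ F t `<=` measurable) /\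
  (forall s t : R, 0 <= s -> s <= t -> F s `<=` F t).

Variable F : R -> set (set Omega).

Definition adapted d' (T : measurableType d') (Y : R -> Omega -> T) : Prop :=
  forall t : R, 0 <= t -> forall B, measurable B -> F t (Y t @^-1` B).

Section Increments.
Context {E : normedModType R}.
Variable Y : R -> Omega -> E.

Definition increment_in s t (A : set E) : set Omega :=
  [set w | A (Y t w - Y s w)].

Definition independent_increments : Prop :=
  forall (n : nat) (t : nat -> R) (A : nat -> set (borel E)),
    0 <= t 0%N -> (forall i, t i <= t i.+1) ->
    (forall i, measurable (A i)) ->
    P (\bigcap_(i < n) increment_in (t i) (t i.+1) (A i)) =
    (\prod_(i < n) P (increment_in (t i) (t i.+1) (A i)))%E.

Definition stationary_increments : Prop :=
  forall (s h : R) (A : set (borel E)), 0 <= s -> 0 <= h -> measurable A ->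
    P (increment_in s (s + h) A) = P (increment_in 0 h A).

Definition starts_at_zero : Prop := \forall w \ae P, Y 0 w = 0.

End Increments.

(* N(0, v C) is described by its one-dimensional images: a . X ~ N(0, v a C a^T)
   for all row vectors a. *)
Definition wiener_process_rV n (B : R -> Omega -> 'rV[R]_n) : Prop :=
  [/\ @adapted _ (borel 'rV[R]_n) B, starts_at_zero B,
      independent_increments B, stationary_increments B &
   exists C : 'M[R]_n,
   [/\ C^T = C, forall a : 'rV[R]_n, 0 <= (a *m C *m a^T) 0 0 &
       forall (s t : R) (a : 'rV[R]_n), 0 <= s -> s <= t ->
         normal_law
           (fun D => P [set w | D (((B t w - B s w) *m a^T) 0 0)])
           0 ((t - s) * (a *m C *m a^T) 0 0)]].

Section Cylindrical_processes.
Context {U : normedModType R}.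

(* Elements of L^0 are handled through representatives: linearity holds almost
   surely, and a class is F_t-measurable when its representative can be (and
   is) chosen F_t-measurable. *)
Definition cylindrical_rv (X : dual U -> {RV P >-> R}) : Prop :=
  forall (a : R) (u v : dual U),
    \forall w \ae P, X (a *: u + v) w = a * X u w + X v w.

Definition cylindrical_distribution (X : dual U -> {RV P >-> R})
    (mu : set U -> \bar R) : Prop :=
  cylindrical_measure mu /\
  forall u : dual U, char_fun mu u =
    Complex (fine ('E_P[fun w => cos (X u w)])%E)
            (fine ('E_P[fun w => sin (X u w)])%E).

Definition weakly_cylindrical_wiener (W : R -> dual U -> {RV P >-> R}) : Prop :=
  [/\ forall t : R, 0 <= t -> cylindrical_rv (W t),
      forall u, adapted (fun t => W t u) &
      forall n (u : 'I_n -> dual U),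
        wiener_process_rV (fun t w => \row_i W t (u i) w)].

Definition strongly_cylindrical_wiener (W : R -> dual U -> {RV P >-> R})
    (Q : dual U -> U) : Prop :=
  weakly_cylindrical_wiener W /\
  forall u v : dual U,
    (v (Q u))%:E = ('E_P[fun w => (W 1 u w * W 1 v w)%R])%E.

(* Y t - Y s ~ N(0, (t - s) S), again described by its images under the dual. *)
Definition wiener_process (Y : R -> Omega -> U) : Prop :=
  [/\ @adapted _ (borel U) Y, starts_at_zero Y,
      independent_increments Y, stationary_increments Y &
   exists S : dual U -> U,
     (exists2 nu : probability (borel U) R,
        gaussian_measure nu & covariance_operator_of nu S) /\
     forall (s t : R) (u : dual U), 0 <= s -> s <= t ->
       normal_law (fun D => P [set w | D (u (Y t w - Y s w))])
         0 ((t - s) * u (S u))].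

Definition induced_by (W : R -> dual U -> {RV P >-> R})
    (Y : R -> Omega -> U) : Prop :=
  forall (t : R) (u : dual U), 0 <= t -> \forall w \ae P, W t u w = u (Y t w).

End Cylindrical_processes.

End Processes.

(* Main.v *)
Require Import Defs.
From HB Require Import structures.
From mathcomp Require Import all_boot all_order all_algebra.
From mathcomp Require Import complex.
From mathcomp Require Import ring lra.
From mathcomp Require Import all_classical all_reals all_analysis.
From mathcomp Require Import measurable_realfun.

(* (a) => (b): since E (W 1 u)^2 = <Q u, u> = |Q u|^2 in H_Q, the map
   Q u |-> W 1 u is a Gaussian isometry on a dense subspace of H_Q; its extension
   to H_Q is a cylindrical random variable whose distribution is the standard
   Gaussian cylindrical measure, and its image under i_Q is the cylindrical
   distribution of W 1, that is, the law of Y 1.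
   (b) => (c): the radonified measure has the characteristic function of W 1, and
   a finite Borel measure on a separable Banach space is tight (Ulam).
   (c) => (d): if the distribution of a cylindrical random variable X is tight,
   then almost surely the values X u_n on a norming sequence (u_n) are the values
   <Y, u_n> of a point Y of a sigma-compact set. This defines a random element Y,
   and adding one more functional u to the sequence shows X u = <Y, u> a.s.
   (d) => (a): by Ulam the distribution of W 1 is tight, hence so is that of W t,
   which has the law of sqrt t W 1; as above W t = Y t with Y t measurable for F t.
   The laws and the independence of the increments of Y are determined by their
   values on the cylinders over a norming sequence, a pi-system generating the
   Borel sets. *)

Set Implicit Arguments.
Unset Strict Implicit.
Unset Printing Implicit Defensive.
Import Order.TTheory GRing.Theory Num.Theory.
Import numFieldNormedType.Exports.
Local Open Scope classical_set_scope.
Local Open Scope ring_scope.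

(** * Borel sets and finite-dimensional laws *)

(** Relations between the variables [W t u] hold only almost surely, off a null set that depends on
    the functionals, so every pathwise argument handles finitely or countably many functionals at a
    time; this is what a norming sequence is for. The filtration need not contain the null sets, so
    [Y t] cannot be repaired on a null set afterwards: it is built inside an arbitrary sigma-algebra
    [G], which is the full one for (c) => (d) and [F t] for (d) => (a). A cylindrical distribution
    is known only through its characteristic function, whence the uniqueness theorem below:
    indicators of half-spaces are obtained from cosines by products, sums and bounded pointwise
    limits. All of this stays real: integrals of cos (X + b) with an arbitrary phase b replace
    complex exponentials, b = 0 giving the real part and b = - pi / 2 the imaginary part. *)

Lemma separable_dense_seq (R : realType) (E : normedModType R) :
  separable E -> exists a : nat -> E, forall x (e : R), 0 < e ->
    exists n, `|x - a n| < e.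
Proof.
move=> [A cA dA].
have AE x (e : R) : 0 < e -> exists2 y, A y & `|x - y| < e.
  move=> e0; have [||y [By Ay]] := dA (ball x e).
  - by exists x; exact: ballxx.
  - exact: ball_open.
  by exists y => //; move: By; rewrite -ball_normE.
have [y0 Ay0 _] := AE 0 1 ltr01.
have /countable_injP[f fi] := cA.
exists (fun n => if pselect (exists y, A y /\ f y = n) is left h
  then projT1 (cid h) else y0) => x e e0.
have [y Ay xy] := AE x e e0; exists (f y).
case: pselect => [h|]; last by case; exists y.
case: cid => z /= [Az /fi zy].
by rewrite zy ?inE.
Qed.

Lemma rV_separable (R : realType) n : separable 'rV[R]_n.
Proof.
exists (range (fun q : 'rV[rat]_n => (map_mx ratr q : 'rV[R]_n))).
  by apply: sub_countable (card_image_le _ _) _; exact: countableP.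
move=> O [x Ox] oO.
have : nbhs x O by exact: open_nbhs_nbhs.
move=> /nbhs_ballP[e /= e0 xO].
have h i : exists q : rat, `|x 0 i - ratr q| < e.
  have /rat_in_itvoo[q] : x 0 i - e < x 0 i + e by rewrite ltrD2l gtrN.
  rewrite in_itv/= => /andP[q1 q2]; exists q.
  by rewrite ltr_distlC; apply/andP; split; lra.
have /choice[q Hq] := h.
exists (map_mx ratr (\row_i q i)); split; last by exists (\row_i q i).
apply: xO; split => // i j; rewrite !mxE/= ord1.
by rewrite /ball/= Hq.
Qed.

(** A closed ball is a countable intersection of half-spaces of the norming family, and an open set
    is a countable union of closed balls with centres in a dense sequence and rational radii. [G] is
    any sigma-algebra, so that a property of sets can be proved for Borel sets by taking it as [G];
    [J] covers both norming sequences and signed coordinates. *)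
Lemma borel_generated (R : realType) (E : normedModType R) (J : countType)
    (u : J -> E -> R) (G : set (set E)) :
  separable E ->
  (forall i x y, u i (x - y) = u i x - u i y) ->
  (forall i x, u i x <= `|x|) ->
  (forall x r, 0 <= r -> (forall i, u i x <= r) -> `|x| <= r) ->
  sigma_algebra setT G ->
  (forall i c, G [set x | u i x <= c]) ->
  forall B : set (borel E), measurable B -> G B.
Proof.
move=> /separable_dense_seq[a Ha] uB ux xu sG Gu B mB.
have GE : @measurable _ (g_sigma_algebraType G) = G.
  by rewrite measurable_g_measurableTypeE.
suff oG : @open E `<=` G by exact: (smallest_sub sG oG mB).
move=> O oO.
(* The absolute value makes every rational a legitimate radius, since [xu] asks for a nonnegative
   bound. *)
pose b (n : nat) (q : rat) : set E := [set x | `|x - a n| <= `|ratr q| :> R].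
have Gb n q : G (b n q).
  have -> : b n q = \bigcap_(k : nat) (if unpickle k is Some i then
      [set x | u i x <= `|ratr q| + u i (a n)] else setT).
    apply/seteqP; split=> [x bx k _|x H].
      case: unpickle => [i|//] /=.
      by rewrite -lerBlDr -uB (le_trans (ux _ _)).
    apply: xu => // i; have := H (pickle i) I.
    by rewrite pickleK /= uB lerBlDr.
  rewrite -GE; apply: bigcapT_measurable => k; rewrite GE.
  case: unpickle => [i|]; first exact: Gu.
  by rewrite -GE; exact: measurableT.
have -> : O = \bigcup_(p : nat * rat) (if `[< b p.1 p.2 `<=` O >]
   then b p.1 p.2 else set0).
  apply/seteqP; split=> [x Ox|x [p _]]; last first.
    by case: ifP => // /asboolP; exact.
  have : nbhs x O by exact: open_nbhs_nbhs.
  move=> /nbhs_ballP[e /= e0 xO].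
  have e4 : 0 < e / 4 by lra.
  have [n xn] := Ha x _ e4.
  have /rat_in_itvoo[q] : e / 4 < e / 2 by lra.
  rewrite in_itv/= => /andP[q1 q2].
  exists (n, q) => //=.
  have bO : b n q `<=` O.
    move=> y; rewrite /b/= ger0_norm ?(le_trans (ltW e4) (ltW q1))// => yn.
    apply: xO; rewrite -ball_normE/=.
    have -> : x - y = (x - a n) - (y - a n) by rewrite opprB addrA subrK.
    by rewrite (le_lt_trans (ler_normB _ _))//; lra.
  rewrite ifT; last exact/asboolP.
  rewrite /b/= (le_trans (ltW xn))// ger0_norm ?(ltW q1)//.
  by rewrite (le_trans (ltW e4) (ltW q1)).
rewrite -GE; apply: countable_bigcupT_measurable => [|p]; first exact: countableP.
rewrite GE; case: ifP => _; first exact: Gb.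
by rewrite -GE; exact: measurable0.
Qed.

(** The norm of a row is the maximum of its coordinates and their opposites, so these signed
    coordinates are a finite norming family. *)
Lemma rV_borel_generated (R : realType) n (G : set (set 'rV[R]_n)) :
  sigma_algebra setT G ->
  (forall i c, G [set x | x 0 i <= c]) ->
  (forall i c, G [set x | - x 0 i <= c]) ->
  forall B : set (borel 'rV[R]_n), measurable B -> G B.
Proof.
move=> sG G1 G2.
apply: (@borel_generated R 'rV[R]_n ('I_n * bool)%type
  (fun p x => if p.2 then x 0 p.1 else - x 0 p.1)) => //.
- exact: rV_separable.
- by move=> [i []] x y /=; rewrite !mxE//; lra.
- move=> [i b] x /=; apply: (@le_trans _ _ `|x 0 i|).
    by case: b; rewrite ?ler_norm// -normrN ler_norm.
  rewrite [leRHS]mx_normrE.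
  exact: (le_bigmax _ (fun p => `|x p.1 p.2|) (ord0, i)).
- move=> x r r0 H; rewrite [leLHS]mx_normrE; apply: bigmax_le => // -[k i] _ /=.
  rewrite ord1 ler_norml.
  by have /= := H (i, true); have /= := H (i, false); lra.
- by move=> [i []] c /=; [exact: G1|exact: G2].
Qed.

Lemma bounded_integrable d (T : measurableType d) (R : realType)
    (m : {measure set T -> \bar R}) (f : T -> R) (M : R) :
  (m setT < +oo)%E -> measurable_fun setT f -> (forall x, `|f x| <= M) ->
  m.-integrable setT (EFin \o f).
Proof.
move=> moo mf fM; apply: measurable_bounded_integrable => //.
exists M; split; first exact: num_real.
by move=> r Mr x _; apply: le_trans (fM x) _; exact: ltW.
Qed.

Lemma Rintegral_bounded_cvg d (T : measurableType d) (R : realType)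
    (m : {measure set T -> \bar R}) (f_ : nat -> T -> R) (f : T -> R) (M : R) :
  (m setT < +oo)%E ->
  (forall n, measurable_fun setT (f_ n)) ->
  (forall n x, `|f_ n x| <= M) ->
  (forall x, f_ n x @[n --> \oo] --> f x) ->
  measurable_fun setT f /\
  Rintegral m setT (f_ n) @[n --> \oo] --> Rintegral m setT f.
Proof.
move=> moo mf fM ff.
have mf' : measurable_fun setT (EFin \o f : T -> \bar R).
  apply: (@emeasurable_fun_cvg _ _ _ _ (fun n => EFin \o f_ n)).
    by move=> n; apply/measurable_EFinP; exact: mf.
  by move=> x _; apply: cvg_EFin; [exact: nearW|exact: ff].
split; first exact/measurable_EFinP.
have iM : m.-integrable setT (EFin \o cst M).
  by apply: (@bounded_integrable _ _ _ _ _ `|M|).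
have [|||If _ C] := @dominated_convergence _ T R m setT measurableT
  (fun n => EFin \o f_ n) (EFin \o f) (EFin \o cst M) _ mf' _ iM _.
- by move=> n; apply/measurable_EFinP; exact: mf.
- by apply: aeW => x _ /=; apply: cvg_EFin; [exact: nearW|exact: ff].
- by apply: aeW => x n _ /=; rewrite lee_fin.
- rewrite /Rintegral; apply: fine_cvg; rewrite fineK//.
  exact: (integrable_fin_num measurableT If).
Qed.

(** Polynomials of this kind occur in elementary proofs of the Stone-Weierstrass theorem. Below 1/2
    Bernoulli's inequality bounds the power from below by 1 - n (2y)^n; from 1/2 on it is at most
    exp (- n (2y)^n) <= 1 / (n + 1). The factor n in the exponent is what forces the limit 0 at y =
    1/2 itself. *)
Lemma cvg_step_polynomial (R : realType) (y : R) : 0 <= y <= 1 ->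
  (1 - y ^+ n) ^+ (n * 2 ^ n) @[n --> \oo] --> ((y < 2^-1)%R%:R : R).
Proof.
move=> /andP[y0 y1].
have yn n : 0 <= y ^+ n <= 1 by rewrite exprn_ge0//= exprn_ile1.
have pn n : 0 <= 1 - y ^+ n <= 1 by have := yn n; lra.
have [yh|yh] := ltP.
(* With w = sqrt (2y) < 1 one has n (2y)^n = (n w^n) w^n, and n w^n is bounded by the geometric sum
   1 / (1 - w). *)
- pose z := 2 * y; pose w := Num.sqrt z.
  have z0 : 0 <= z by rewrite /z; lra.
  have z1 : z < 1 by rewrite /z; lra.
  have w0 : 0 <= w by exact: sqrtr_ge0.
  have w1 : w < 1 by rewrite -[ltRHS]sqrtr1 ltr_sqrt.
  have wz : w ^+ 2 = z by rewrite sqr_sqrtr.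
  have nw n : n%:R * w ^+ n <= (1 - w)^-1.
    have -> : n%:R * w ^+ n = \sum_(i < n) w ^+ n.
      by rewrite sumr_const card_ord mulr_natl.
    apply: (@le_trans _ _ (\sum_(i < n) w ^+ i)).
      apply: ler_sum => i _; apply: ler_wiXn2l => //; first exact: ltW.
      exact: ltnW.
    rewrite -[leRHS]mul1r ler_pdivlMr ?subr_gt0// mulrC.
    by rewrite -[w in 1 - w]opprK opprK -opprB mulNr -subrX1 opprB gerBl exprn_ge0.
  apply: (@squeeze_cvgr _ _ _ _ (fun n => 1 - (1 - w)^-1 * w ^+ n) (fun=> 1)).
  + apply: nearW => n; apply/andP; split; last first.
      by apply: exprn_ile1; have := pn n; lra.
    have bern (x : R) m : 0 <= x <= 1 -> 1 - m%:R * x <= (1 - x) ^+ m.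
      move=> /andP[x0 x1]; elim: m => [|m IH]; first by rewrite mul0r subr0 expr0.
      rewrite exprS; apply: (@le_trans _ _ ((1 - x) * (1 - m%:R * x))).
        rewrite -natr1; have : 0 <= m%:R * x * x by rewrite !mulr_ge0.
        by rewrite mulrDr !mulrBl !mul1r; lra.
      by rewrite ler_wpM2l// subr_ge0.
    apply: le_trans (bern _ _ (yn n)); rewrite lerD2l lerN2.
    rewrite natrM natrX -mulrA -exprMn -/z -wz -exprM mulnC exprM expr2.
    by rewrite mulrA ler_wpM2r// exprn_ge0.
  + rewrite -[X in _ --> X]subr0; apply: cvgB; first exact: cvg_cst.
    rewrite -(mulr0 (1 - w)^-1); apply: cvgMr.
    by apply: cvg_expr; rewrite ger0_norm.
  + exact: cvg_cst.
- apply: (@squeeze_cvgr _ _ _ _ (fun=> 0) (@harmonic R)).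
  + apply: nearW => n; apply/andP; split.
      by apply: exprn_ge0; have := pn n; lra.
    have e1 : 1 - y ^+ n <= expR (- y ^+ n) by apply: expR_ge1Dx.
    apply: (@le_trans _ _ (expR (- y ^+ n) ^+ (n * 2 ^ n))).
      by apply: lerXn2r => //; rewrite ?nnegrE ?expR_ge0//; have := pn n; lra.
    rewrite -expRM_natl mulrN expRN /harmonic lef_pV2 ?posrE ?expR_gt0//.
    apply: le_trans (expR_ge1Dx _); rewrite -natr1 addrC lerD2l.
    rewrite natrM natrX -mulrA -exprMn ler_peMr//.
    by rewrite exprn_ege1//; lra.
  + exact: cvg_cst.
  + exact: cvg_harmonic.
Qed.

(** * Uniqueness of finite measures with given characteristic functions *)

Section Characteristic_functions_determine.
Context {d : measure_display} {T : measurableType d} {R : realType}.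
Variables (m1 m2 : {measure set T -> \bar R}) (L : set (T -> R)).
Hypothesis m1oo : (m1 setT < +oo)%E.
Hypothesis m2oo : (m2 setT < +oo)%E.
Hypothesis mL : forall f, L f -> measurable_fun setT f.
Hypothesis L0 : L (fun=> 0).
Hypothesis LD : forall f g, L f -> L g -> L (fun x => f x + g x).
Hypothesis LZ : forall k f, L f -> L (fun x => k * f x).
Hypothesis eqcos : forall f, L f ->
  Rintegral m1 setT (fun x => cos (f x)) = Rintegral m2 setT (fun x => cos (f x)).
Hypothesis eqsin : forall f, L f ->
  Rintegral m1 setT (fun x => sin (f x)) = Rintegral m2 setT (fun x => sin (f x)).

Let bdd (f : T -> R) :=
  measurable_fun setT f /\ exists M : R, forall x, `|f x| <= M.

Let bddM f g : bdd f -> bdd g -> bdd (fun x => f x * g x).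
Proof.
move=> [mf [M fM]] [mg [N gN]]; split; first exact: measurable_funM.
by exists (M * N) => x; rewrite normrM ler_pM.
Qed.

Let bddD f g : bdd f -> bdd g -> bdd (fun x => f x + g x).
Proof.
move=> [mf [M fM]] [mg [N gN]]; split; first exact: measurable_funD.
by exists (M + N) => x; rewrite (le_trans (ler_normD _ _))// lerD.
Qed.

Let bdd_cst c : bdd (fun=> c).
Proof. by split => //; exists `|c|. Qed.

Let bdd_cos f b : L f -> bdd (fun x => cos (f x + b)).
Proof.
move=> Lf; split; last by exists 1 => x; rewrite ler_norml cos_geN1 cos_le1.
apply: measurableT_comp; last by apply: measurable_funD => //; exact: mL.
by apply: continuous_measurable_fun; exact: continuous_cos.
Qed.

Let I1 (f : T -> R) := Rintegral m1 setT f.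
Let I2 (f : T -> R) := Rintegral m2 setT f.

Let ID (m : {measure set T -> \bar R}) (moo : (m setT < +oo)%E) f g : bdd f -> bdd g ->
  Rintegral m setT (fun x => f x + g x) =
  Rintegral m setT f + Rintegral m setT g.
Proof.
move=> [mf [M fM]] [mg [N gN]].
by rewrite RintegralD//; exact: bounded_integrable.
Qed.

Let IZ (m : {measure set T -> \bar R}) (moo : (m setT < +oo)%E) k f : bdd f ->
  Rintegral m setT (fun x => k * f x) = k * Rintegral m setT f.
Proof.
by move=> [mf [M fM]]; rewrite RintegralZl//; exact: bounded_integrable fM.
Qed.

(* The integrals of [A]-functions agree, and [A] is stable under products with
   cosines thanks to the phase [b]. *)
Let A f := bdd f /\ forall p b, L p ->
  I1 (fun x => f x * cos (p x + b)) = I2 (fun x => f x * cos (p x + b)).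

Let AD f g : A f -> A g -> A (fun x => f x + g x).
Proof.
move=> [bf Af] [bg Ag]; split=> [|p b Lp]; first exact: bddD.
have bp := bdd_cos b Lp.
under [fun x => _]eq_fun do rewrite mulrDl.
by rewrite /I1 /I2 !ID ?(Af _ _ Lp, Ag _ _ Lp)//; [|exact: bddM..];
  congr (_ + _); [exact: Af|exact: Ag].
Qed.

Let AZ k f : A f -> A (fun x => k * f x).
Proof.
move=> [bf Af]; split=> [|p b Lp]; first exact: bddM.
have bp := bdd_cos b Lp.
under [fun x => _]eq_fun do rewrite -mulrA.
rewrite /I1 /I2 !IZ//; [|exact: bddM..].
by congr (_ * _); exact: Af.
Qed.

Let A_cos f q c : L q -> A f -> A (fun x => f x * cos (q x + c)).
Proof.
move=> Lq [bf Af]; split=> [|p b Lp].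
  by apply: bddM => //; exact: bdd_cos.
(* The product-to-sum formula brings the integrand back to [f] times single cosines, whose arguments
   are again in [L] up to a phase. *)
have E x : f x * cos (q x + c) * cos (p x + b) =
    2^-1 * (f x * cos ((q x + p x) + (c + b)) +
            f x * cos ((q x + -1 * p x) + (c - b))).
  rewrite (_ : q x + p x + _ = (q x + c) + (p x + b)); last by ring.
  rewrite (_ : q x + -1 * p x + _ = (q x + c) - (p x + b)); last by ring.
  by rewrite (cosD (q x + c)) (cosB (q x + c)); field.
have L1 : L (fun x => q x + p x) by exact: LD.
have L2 : L (fun x => q x + -1 * p x) by apply: LD => //; exact: LZ.
have b1 := bddM bf (bdd_cos (c + b) L1).
have b2 := bddM bf (bdd_cos (c - b) L2).
under [fun x => _]eq_fun do rewrite E.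
rewrite /I1 /I2 !IZ ?ID//; [|exact: bddD..].
by congr (_ * (_ + _)); exact: Af.
Qed.

Let A_lim (f_ : nat -> T -> R) f M : (forall n, A (f_ n)) ->
  (forall n x, `|f_ n x| <= M) ->
  (forall x, f_ n x @[n --> \oo] --> f x) -> A f.
Proof.
move=> Af fM ff.
have [mf _] := Rintegral_bounded_cvg m1oo (fun n => (Af n).1.1) fM ff.
split.
  split=> //; exists M => x; move/cvg_norm : (ff x) => /cvg_lim <-//.
  apply: limr_le; last by apply: nearW => n; exact: fM.
  by apply/cvg_ex; exists `|f x|; apply: cvg_norm; exact: ff.
move=> p b Lp; have [mp [N pN]] := bdd_cos b Lp.
have Q (m : {measure set T -> \bar R}) (moo : (m setT < +oo)%E) :
  Rintegral m setT (fun x => f_ n x * cos (p x + b)) @[n --> \oo] -->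
  Rintegral m setT (fun x => f x * cos (p x + b)).
  apply: (Rintegral_bounded_cvg (M := M * N) moo _ _ _).2.
  - by move=> n; apply: measurable_funM => //; exact: (Af n).1.1.
  - by move=> n x; rewrite normrM ler_pM.
  - by move=> x; apply: cvgMl; exact: ff.
have E : (fun n => Rintegral m1 setT (fun x => f_ n x * cos (p x + b))) =
    (fun n => Rintegral m2 setT (fun x => f_ n x * cos (p x + b))).
  by apply/funext => n; exact: (Af n).2.
have := Q m1 m1oo; rewrite E => Q1.
by rewrite /I1 /I2 -(cvg_lim _ Q1)// (cvg_lim _ (Q m2 m2oo)).
Qed.

(* The multipliers of [A] form an algebra containing the cosines and closed under
   bounded pointwise limits, hence they contain the indicators of half-spaces. *)
Let Mul g := bdd g /\ forall f, A f -> A (fun x => f x * g x).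

Let Mul_cst c : Mul (fun=> c).
Proof.
split=> // f Af; under [fun x => _]eq_fun do rewrite mulrC.
exact: AZ.
Qed.

Let MulD f g : Mul f -> Mul g -> Mul (fun x => f x + g x).
Proof.
move=> [bf Mf] [bg Mg]; split=> [|h Ah]; first exact: bddD.
by under [fun x => _]eq_fun do rewrite mulrDr; apply: AD; [exact: Mf|exact: Mg].
Qed.

Let MulM f g : Mul f -> Mul g -> Mul (fun x => f x * g x).
Proof.
move=> [bf Mf] [bg Mg]; split=> [|h Ah]; first exact: bddM.
by under [fun x => _]eq_fun do rewrite mulrA; apply: Mg; exact: Mf.
Qed.

Let MulX f n : Mul f -> Mul (fun x => f x ^+ n).
Proof.
move=> Mf; elim: n => [|n IH]; first exact: Mul_cst.
by under [fun x => _]eq_fun do rewrite exprS; exact: MulM.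
Qed.

Let MulB1 f : Mul f -> Mul (fun x => 1 - f x).
Proof.
move=> Mf; under [fun x => _]eq_fun do rewrite -mulN1r.
by apply: MulD; [exact: Mul_cst|apply: MulM => //; exact: Mul_cst].
Qed.

Let Mul_cos q c : L q -> Mul (fun x => cos (q x + c)).
Proof. by move=> Lq; split=> [|f Af]; [exact: bdd_cos|exact: A_cos]. Qed.

Let Mul_lim (f_ : nat -> T -> R) f M : (forall n, Mul (f_ n)) ->
  (forall n x, `|f_ n x| <= M) ->
  (forall x, f_ n x @[n --> \oo] --> f x) -> Mul f.
Proof.
move=> Mf fM ff.
have [mf _] := Rintegral_bounded_cvg m1oo (fun n => (Mf n).1.1) fM ff.
split.
  split=> //; exists M => x; move/cvg_norm : (ff x) => /cvg_lim <-//.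
  apply: limr_le; last by apply: nearW => n; exact: fM.
  by apply/cvg_ex; exists `|f x|; apply: cvg_norm; exact: ff.
move=> g Ag; have [[_ [N gN]] _] := Ag.
apply: (@A_lim (fun n x => g x * f_ n x) _ (N * M)).
- by move=> n; exact: (Mf n).2.
- by move=> n x; rewrite normrM ler_pM.
- by move=> x; apply: cvgMr; exact: ff.
Qed.

Let Mul_step f : Mul f -> (forall x, 0 <= f x <= 1) ->
  Mul (fun x => (f x < 2^-1)%R%:R).
Proof.
move=> Mf f01.
apply: (@Mul_lim (fun n x => (1 - f x ^+ n) ^+ (n * 2 ^ n)) _ 1).
- by move=> n; apply: MulX; apply: MulB1; exact: MulX.
- move=> n x; have /andP[f0 f1] := f01 x.
  have h : 0 <= 1 - f x ^+ n <= 1.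
    by rewrite subr_ge0 exprn_ile1//= gerBl exprn_ge0.
  by rewrite normrX exprn_ile1//; have /andP[h0 h1] := h; rewrite ger0_norm.
- by move=> x; exact: cvg_step_polynomial.
Qed.

(** The phase turns a cosine into sin ((q - c) / (k + 1)). Once |q - c| < k + 1 the argument lies in
    ]-1, 1[, where the sine has the sign of q - c, so the indicators are eventually constant in k.
    The test sin < 0 is the test (1 + sin) / 2 < 1/2 of [Mul_step]. *)
Let Mul_halfspace q c : L q -> Mul (fun x => (q x < c)%R%:R).
Proof.
move=> Lq.
apply: (@Mul_lim (fun k x => (sin ((q x - c) / k.+1%:R) < 0)%R%:R) _ 1).
- move=> k.
  have Lk : L (fun x => k.+1%:R^-1 * q x) by exact: LZ.
  have Lc := Mul_cos (- (c / k.+1%:R) - pi / 2) Lk.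
  pose h x := cos (k.+1%:R^-1 * q x + (- (c / k.+1%:R) - pi / 2)).
  have hE x : h x = sin ((q x - c) / k.+1%:R).
    by rewrite /h addrA cosBpihalf mulrC -mulrBl.
  rewrite (_ : (fun x => _) = (fun x => (2^-1 * (1 + h x) < 2^-1)%R%:R)).
    apply: Mul_step; first by apply: MulM; [|apply: MulD].
    move=> x; have : -1 <= h x <= 1 by rewrite cos_geN1 cos_le1.
    by lra.
  apply/funext => x; rewrite -hE; congr (nat_of_bool _)%:R.
  by rewrite gtr_pMr ?invr_gt0// gtrDl.
- by move=> n x; case: ltP => _; rewrite ?normr1 ?normr0.
- move=> x; apply: cvg_near_cst.
  near=> k.
  have k1 : `|q x - c| / k.+1%:R < 1.
    rewrite ltr_pdivrMr// mul1r.
    near: k; exists (Num.truncn `|q x - c|) => // k /= tk.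
    rewrite (lt_le_trans (truncnS_gt _))// ler_nat.
    by rewrite ltnS.
  set y := q x - c in k1 *.
  congr (nat_of_bool _)%:R; rewrite -[in RHS]subr_lt0 -/y.
  have [y0|y0|->] := ltgtP y 0; last by rewrite mul0r sin0 ltxx.
  + rewrite -[y]opprK mulNr sinN oppr_lt0 sin2_gt0//.
    rewrite divr_gt0 ?oppr_gt0//=; apply: (@lt_trans _ _ 1); [by move: k1; rewrite ltr0_norm|lra].
  + apply/negbTE; rewrite -leNgt ltW// sin2_gt0// divr_gt0//=.
    by apply: (@lt_trans _ _ 1); [by move: k1; rewrite gtr0_norm|lra].
Unshelve. all: by end_near.
Qed.

(** The sets whose indicator is a multiplier form a sigma-algebra containing the half-spaces. The
    indicator of [S] is therefore a multiplier; applied to the constant 1 and tested against the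
    zero function of [L], it gives equal masses. *)
Lemma char_fun_determines (S : set T) :
  <<s [set [set x | q x < c] | q in L & c in setT] >> S -> m1 S = m2 S.
Proof.
move=> sS.
pose G := [set B : set T | Mul (\1_B)].
have sG : sigma_algebra setT G.
  have GC B : G B -> G (~` B).
    rewrite /G/= => GB; have -> : \1_(~` B) = (fun x => 1 - \1_B x :> R).
      apply/funext => x; rewrite !indicE in_setC.
      by case: (x \in B); rewrite /= ?subrr ?subr0.
    exact: MulB1.
  have G0 : G set0 by rewrite /G/= indic0; exact: Mul_cst.
  split => //; first by move=> B GB; rewrite setTD; exact: GC.
  move=> F GF; rewrite /G/=.
  (* Finite intersections correspond to products of indicators; their decreasing limit is the
     complement of the countable union. *)
  pose C n := \bigcap_(i < n) ~` F i.
  have GCn n : G (C n).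
    elim: n => [|n IH]; first by rewrite /C bigcap_mkord big_ord0 -setC0; exact: GC.
    have -> : C n.+1 = C n `&` ~` F n by rewrite /C !bigcap_mkord big_ord_recr.
    rewrite /G/= indicI.
    by apply: MulM => //; exact: GC.
  rewrite -[X in \1_X]setCK; apply: GC; rewrite setC_bigcup.
  apply: (@Mul_lim (fun n => \1_(C n)) _ 1) => //.
  - by move=> n x; rewrite indicE; case: (x \in _); rewrite ?normr1 ?normr0.
  - move=> x; apply: cvg_near_cst.
    have [xF|xF] := pselect ((\bigcap_i ~` F i) x).
      apply: nearW => n; rewrite !indicE !mem_set// => i _.
      exact: xF.
    have /existsNP[i /not_implyP[_ xi]] := xF.
    exists i.+1 => // n /= ni; rewrite !indicE !memNset//.
    by move=> /(_ i ni).
have : G S.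
  apply: (smallest_sub sG _ sS) => _ [q Lq [c _ <-]].
  rewrite /G/= (_ : \1_ _ = fun x => (q x < c)%R%:R); first exact: Mul_halfspace.
  by apply/funext => x; rewrite indicE; congr (nat_of_bool _)%:R; apply/idP/idP;
    rewrite inE.
rewrite /G/= => -[[m1S _] MS].
have mS : measurable S by apply/measurable_indicP; exact: m1S.
(* This is where the equality of the characteristic functions enters, through the addition
   formula. *)
have A1 : A (fun=> 1).
  split=> // p b Lp; under [fun x => _]eq_fun do rewrite mul1r cosD.
  have bc : bdd (fun x => cos (p x)).
    by under [fun x => _]eq_fun do rewrite -[p _]addr0; exact: bdd_cos.
  have bs : bdd (fun x => sin (p x)).
    by under [fun x => _]eq_fun do rewrite -cosBpihalf; exact: bdd_cos.
  have E (m : {measure set T -> \bar R}) (moo : (m setT < +oo)%E) :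
    Rintegral m setT (fun x => cos (p x) * cos b - sin (p x) * sin b) =
    cos b * Rintegral m setT (fun x => cos (p x)) +
    - sin b * Rintegral m setT (fun x => sin (p x)).
    rewrite -IZ// -IZ// -ID//; [|exact: bddM..].
    by congr (Rintegral _ _ _); apply/funext => x; ring.
  by rewrite /I1 /I2 !E// eqcos// eqsin.
have := (MS _ A1).2 _ 0 L0.
under [fun x => _]eq_fun do rewrite addr0 cos0 mul1r mulr1.
rewrite /I1 /I2 /Rintegral !integral_indic// !setIT => fE.
have fin (m : {measure set T -> \bar R}) : (m setT < +oo)%E -> (m S \is a fin_num)%E.
  move=> moo; rewrite ge0_fin_numE//.
  by apply: le_lt_trans moo; apply: le_measure => //; rewrite inE.
by rewrite -[LHS]fineK ?fin// fE fineK ?fin.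
Unshelve. all: by end_near.
Qed.

End Characteristic_functions_determine.

(** Stated for a bare sigma-algebra on a bare type, so as to apply to the members of a
    filtration. *)
Lemma measurable_rowP (R : realType) (T : Type) (G : set (set T)) n
    (f : 'I_n -> T -> R) :
  sigma_algebra setT G ->
  (forall i (D : set R), measurable D -> G (f i @^-1` D)) ->
  forall B : set (borel 'rV[R]_n), measurable B -> G [set w | B (\row_i f i w)].
Proof.
move=> sG Gf; pose G' := [set B : set 'rV[R]_n | G [set w | B (\row_i f i w)]].
apply: (@rV_borel_generated R n G').
- case: sG => G0 GC GU; split.
  + exact: G0.
  + by move=> A; exact: GC.
  + by move=> A GA; have := GU _ GA.
- move=> i c; rewrite /G' /=.
  have -> : [set w | (\row_j f j w) 0 i <= c] = f i @^-1` `]-oo, c]%classic.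
    by apply/seteqP; split => w; rewrite /preimage/= mxE in_itv.
  exact: Gf.
- move=> i c; rewrite /G' /=.
  have -> : [set w | - (\row_j f j w) 0 i <= c] = f i @^-1` `[- c, +oo[%classic.
    by apply/seteqP; split => w; rewrite /preimage/= mxE in_itv/= andbT lerNl.
  exact: Gf.
Qed.

Lemma measurable_row (R : realType) d (T : measurableType d) n
    (f : 'I_n -> T -> R) :
  (forall i, measurable_fun setT (f i)) ->
  @measurable_fun _ _ T (borel 'rV[R]_n) setT (fun w => \row_i f i w).
Proof.
move=> mf _ B mB; rewrite setTI.
apply: (measurable_rowP (f := f) (@sigma_algebra_measurable _ T)) => // i D mD.
by rewrite -[_ @^-1` _]setTI; exact: mf.
Qed.

Lemma continuous_borel_measurable (R : realType) (E : normedModType R)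
    (f : E -> R) :
  continuous f -> @measurable_fun _ _ (borel E) R setT f.
Proof.
move=> cf; apply: (measurability _ (RGenInftyO.measurableE R)).
move=> _ [_ [c ->] <-]; rewrite setTI; apply: sub_sigma_algebra.
by rewrite /=; apply: open_comp; [move=> x _; exact: cf|exact: interval_open].
Qed.

Lemma measurable_coord (R : realType) n (i : 'I_n) :
  @measurable_fun _ _ (borel 'rV[R]_n) R setT (fun x => x 0 i).
Proof.
by apply: (@continuous_borel_measurable R 'rV[R]_n) => x; exact: coord_continuous.
Qed.

Lemma Rintegral_pushforward d1 d2 (T1 : measurableType d1)
    (T2 : measurableType d2) (R : realType) (m : {measure set T1 -> \bar R})
    (m' : {measure set T2 -> \bar R}) (h : T1 -> T2) (f : T2 -> R) (M : R) :
  measurable_fun setT h -> (m setT < +oo)%E ->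
  (forall B, measurable B -> m' B = m (h @^-1` B)) ->
  measurable_fun setT f -> (forall x, `|f x| <= M) ->
  Rintegral m' setT f = Rintegral m setT (f \o h).
Proof.
move=> mh moo mm' mf fM; rewrite /Rintegral; congr fine.
rewrite (eq_measure_integral (pushforward m h)); last by move=> A /mm' ->.
rewrite integral_pushforward//; first exact/measurable_EFinP.
apply: (@bounded_integrable _ _ _ m (f \o h) M) => //.
  exact: measurableT_comp.
by move=> x; exact: fM.
Qed.

(** The Cramer-Wold device: both laws are pushed to row vectors, with the linear forms as the space
    [L] of the uniqueness theorem. The two families may live on different probability spaces. *)
Lemma charfun_law_eq d1 d2 (T1 : measurableType d1) (T2 : measurableType d2)
    (R : realType) (m1 : {measure set T1 -> \bar R})
    (m2 : {measure set T2 -> \bar R}) n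
    (f : 'I_n -> T1 -> R) (g : 'I_n -> T2 -> R) :
  (m1 setT < +oo)%E -> (m2 setT < +oo)%E ->
  (forall i, measurable_fun setT (f i)) ->
  (forall i, measurable_fun setT (g i)) ->
  (forall a : 'I_n -> R,
    Rintegral m1 setT (fun x => cos (\sum_i a i * f i x)) =
    Rintegral m2 setT (fun x => cos (\sum_i a i * g i x)) /\
    Rintegral m1 setT (fun x => sin (\sum_i a i * f i x)) =
    Rintegral m2 setT (fun x => sin (\sum_i a i * g i x))) ->
  forall B : set (borel 'rV[R]_n), measurable B ->
    m1 [set x | B (\row_i f i x)] = m2 [set x | B (\row_i g i x)].
Proof.
move=> m1oo m2oo mf mg fg.
have mrf := measurable_row mf; have mrg := measurable_row mg.
pose M1 : {measure set (borel 'rV[R]_n) -> \bar R} :=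
  measure_function_pushforward__canonical__measure_function_Measure m1 mrf.
pose M2 : {measure set (borel 'rV[R]_n) -> \bar R} :=
  measure_function_pushforward__canonical__measure_function_Measure m2 mrg.
pose lin (a : 'I_n -> R) (x : borel 'rV[R]_n) : R := \sum_i a i * x 0 i.
have mlin a : measurable_fun setT (lin a).
  rewrite /lin; under [fun x => _]eq_fun do under eq_bigr do rewrite mulrC.
  apply: measurable_sum => i; apply: measurable_funM => //.
  exact: measurable_coord.
have mcos a : measurable_fun setT (fun x => cos (lin a x)).
  by apply: measurableT_comp => //; apply: continuous_measurable_fun; exact: continuous_cos.
have msin a : measurable_fun setT (fun x => sin (lin a x)).
  by apply: measurableT_comp => //; apply: continuous_measurable_fun; exact: continuous_sin.
have cos1 (y : R) : `|cos y| <= 1 by rewrite ler_norml cos_geN1 cos_le1.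
have sin1 (y : R) : `|sin y| <= 1 by rewrite ler_norml sin_geN1 sin_le1.
move=> B mB.
apply: (@char_fun_determines _ _ _ M1 M2 (range lin)) => //.
- by move=> _ [a _ <-].
- by exists (fun=> 0) => //; apply/funext => x; rewrite /lin big1// => i; rewrite mul0r.
- move=> _ _ [a _ <-] [b _ <-]; exists (fun i => a i + b i) => //.
  apply/funext => x; rewrite /lin -big_split/=.
  by apply: eq_bigr => i _; rewrite mulrDl.
- move=> k _ [a _ <-]; exists (fun i => k * a i) => //.
  by apply/funext => x; rewrite /lin mulr_sumr; apply: eq_bigr => i _; rewrite mulrA.
- move=> _ [a _ <-]; rewrite (Rintegral_pushforward mrf m1oo _ _ (M:=1))//.
  rewrite (Rintegral_pushforward mrg m2oo _ _ (M:=1))//.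
  have [+ _] := fg a; congr (_ = _); apply: eq_Rintegral => x _ /=;
  by congr cos; apply: eq_bigr => i _; rewrite mxE.
- move=> _ [a _ <-]; rewrite (Rintegral_pushforward mrf m1oo _ _ (M:=1))//.
  rewrite (Rintegral_pushforward mrg m2oo _ _ (M:=1))//.
  have [_ +] := fg a; congr (_ = _); apply: eq_Rintegral => x _ /=;
  by congr sin; apply: eq_bigr => i _; rewrite mxE.
- pose H := <<s [set [set x | q x < c] | q in range lin & c in [set: R]] >>.
  have HC A : H A -> H (~` A).
    by rewrite -setTD; exact: sigma_algebraCD.
  apply: (@rV_borel_generated R n H) => //.
  + exact: smallest_sigma_algebra.
  + move=> i c; have E : [set x : 'rV[R]_n | x 0 i <= c] =
        ~` [set x | lin (fun j => - (j == i)%:R) x < - c].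
      apply/seteqP; split => x /=;
        rewrite /lin (bigD1 i)//= eqxx mulN1r big1 ?addr0 ?ltrN2 => [|j /negbTE->];
        rewrite ?oppr0 ?mul0r//.
        by move=> xc; apply/negP; rewrite -leNgt.
      by move=> /negP; rewrite -leNgt.
    apply: (eq_ind_r H _ E); apply: HC; apply: sub_sigma_algebra.
    by exists (lin (fun j => - (j == i)%:R)); [eexists|exists (- c)].
  + move=> i c; have E : [set x : 'rV[R]_n | - x 0 i <= c] =
        ~` [set x | lin (fun j => (j == i)%:R) x < - c].
      apply/seteqP; split => x /=;
        rewrite /lin (bigD1 i)//= eqxx mul1r big1 ?addr0 => [|j /negbTE->];
        rewrite ?mul0r//.
        by move=> xc; apply/negP; rewrite -leNgt lerNl.
      by move=> /negP; rewrite -leNgt lerNl.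
    apply: (eq_ind_r H _ E); apply: HC; apply: sub_sigma_algebra.
    by exists (lin (fun j => (j == i)%:R)); [eexists|exists (- c)].
Qed.

(** * Gaussian laws on the line *)

(** Integration by parts on the whole line: the fundamental theorem on [-n, n], then dominated
    convergence. *)
Lemma integral_derive_eq0 (R : realType) (F f : R -> R) :
  (forall x : R, is_derive x 1 F (f x)) -> continuous f ->
  lebesgue_measure.-integrable setT (EFin \o f) ->
  F n%:R @[n --> \oo] --> 0 -> F (- n%:R) @[n --> \oo] --> 0 ->
  Rintegral lebesgue_measure setT f = 0.
Proof.
move=> dF cf intf Fy FNy.
pose f_ n := f \_ `[- n%:R, n%:R]%classic.
have If n : (\int[lebesgue_measure]_x (f_ n x)%:E = (F n%:R - F (- n%:R))%:E)%E.
  rewrite /f_.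
  have -> : (fun x => (f \_ `[- n%:R, n%:R]%classic x)%:E) =
      (EFin \o f) \_ `[- n%:R, n%:R]%classic.
    by apply/funext => x; rewrite !patchE; case: ifP.
  (* The fundamental theorem needs a proper interval, so n = 0 is treated apart. *)
  rewrite -integral_mkcond; case: n => [|n].
    by rewrite oppr0 subrr set_itv1 integral_set1.
  have cF x : {for x, continuous F}.
    by apply: differentiable_continuous; apply/derivable1_diffP; case: (dF x).
  rewrite (@continuous_FTC2 _ f F)//.
  - by rewrite (@lt_trans _ _ 0)// ?oppr_lt0.
  - exact: continuous_subspaceT.
  - split.
    + by move=> x _; case: (dF x).
    + by apply: cvg_at_right_filter; exact: cF.
    + by apply: cvg_at_left_filter; exact: cF.
  - by move=> x _; rewrite derive1E; case: (dF x).
have [|||||_ _ C] := @dominated_convergence _ _ R lebesgue_measure setT measurableT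
  (fun n x => (f_ n x)%:E) (EFin \o f) (abse \o (EFin \o f)).
- move=> n; apply/measurable_EFinP; apply/measurable_restrict => //.
  by rewrite setTI; apply: measurable_funTS; exact: continuous_measurable_fun.
- by apply/measurable_EFinP; exact: continuous_measurable_fun.
- apply: aeW => x _; apply: cvg_near_cst.
  exists (Num.truncn `|x|).+1 => // n /= xn; rewrite /f_ patchE mem_set//=.
  rewrite in_itv/= -ler_norml ltW// (lt_le_trans (truncnS_gt _))//.
  by rewrite ler_nat.
- exact: integrable_abse.
- apply: aeW => x n _; rewrite /f_ patchE /=; case: ifP => // _.
  by rewrite normr0 lee_fin.
rewrite /Rintegral.
suff -> : (\int[lebesgue_measure]_x (f x)%:E = 0)%E by [].
move/cvg_lim : C => <-//; apply/cvg_lim => //.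
under [fun n => _]eq_fun do rewrite If.
apply: cvg_EFin; first exact: nearW.
by rewrite -[X in _ --> X](subr0 0); exact: cvgB.
Qed.

Section Gaussian_characteristic_function.
Context {R : realType}.
Implicit Types k t b x : R.
Let leb := @lebesgue_measure R.

Lemma integrable_expRNsqr k : 0 < k ->
  leb.-integrable setT (fun x => (expR (- k * x ^+ 2))%:E).
Proof.
move=> k0; pose s := Num.sqrt (2 * k)^-1.
have s2 : s ^+ 2 = (2 * k)^-1 by rewrite sqr_sqrtr// invr_ge0; lra.
have s0 : s != 0 by rewrite sqrtr_eq0 -ltNge invr_gt0; lra.
have p0 := normal_peak_gt0 s0.
have -> : (fun x => (expR (- k * x ^+ 2))%:E) =
    (fun x => ((normal_peak s)^-1)%:E * (normal_pdf 0 s x)%:E)%E.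
  apply/funext => x; rewrite -EFinM normal_pdfE// mulKf ?gt_eqF//.
  congr (expR _)%:E; rewrite subr0 s2; field; lra.
exact/integrableZl/integrable_normal_pdf.
Qed.

Let g k x := expR (- k * x ^+ 2).

Let derive_g k x : is_derive x 1 (g k) (- (2 * k * x) * g k x).
Proof.
rewrite /g; apply: is_derive_eq; rewrite /GRing.scale/=; ring.
Qed.

Let cont_g k : continuous (g k).
Proof.
move=> x; apply: differentiable_continuous; apply/derivable1_diffP.
by case: (derive_g k x).
Qed.

(** Half of the exponent is spent on absorbing |x|, by 1 + y <= exp y and |x| <= (1 + x^2) / 2. The
    other half remains as an integrable majorant. *)
Let norm_mul_g k x : 0 < k -> `|x| * g k x <= (1 + k^-1) * g (k / 2) x.
Proof.
move=> k0; have -> : g k x = g (k / 2) x * expR (- (k / 2 * x ^+ 2)).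
  by rewrite /g -expRD; congr expR; field.
have g0 : 0 <= g (k / 2) x := expR_ge0 _.
rewrite mulrCA (mulrC _ (g _ _)) ler_wpM2l// expRN ler_pdivrMr ?expR_gt0//.
apply: (@le_trans _ _ ((1 + k^-1) * (1 + k / 2 * x ^+ 2))).
  have -> : (1 + k^-1) * (1 + k / 2 * x ^+ 2) =
     1 + k / 2 * x ^+ 2 + k^-1 + x ^+ 2 / 2 by field; lra.
  have : 0 <= k / 2 * x ^+ 2 by rewrite mulr_ge0 ?sqr_ge0//; lra.
  have : 0 <= k^-1 by rewrite invr_ge0 ltW.
  have : 0 <= (`|x| - 1) ^+ 2 by exact: sqr_ge0.
  by rewrite sqrrB1 real_normK ?num_real//; lra.
by rewrite ler_wpM2l ?expR_ge1Dx// addr_ge0// invr_ge0 ltW.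
Qed.

Let mg k : measurable_fun setT (g k).
Proof. by apply: continuous_measurable_fun; exact: cont_g. Qed.

Let integrable_norm_mul_g k : 0 < k ->
  leb.-integrable setT (EFin \o (fun x => `|x| * g k x)).
Proof.
move=> k0; apply: (@le_integrable _ _ _ leb setT measurableT
  (fun x => (`|x| * g k x)%:E)
  (fun x => (1 + k^-1)%:E * (g (k / 2) x)%:E)%E).
- by apply/measurable_EFinP; apply: measurable_funM; [exact: normr_measurable|exact: mg].
- move=> x _ /=; rewrite lee_fin ger0_norm ?mulr_ge0 ?expR_ge0//.
  by rewrite (le_trans (norm_mul_g _ k0))// ler_norm.
- by apply: integrableZl => //; apply: integrable_expRNsqr; rewrite divr_gt0.
Qed.

Let mcosD t b : measurable_fun setT (fun x => cos (t * x + b)).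
Proof.
apply: measurableT_comp; last by apply: measurable_funD => //; exact: measurable_funM.
by apply: continuous_measurable_fun; exact: continuous_cos.
Qed.

Let msinD t b : measurable_fun setT (fun x => sin (t * x + b)).
Proof.
apply: measurableT_comp; last by apply: measurable_funD => //; exact: measurable_funM.
by apply: continuous_measurable_fun; exact: continuous_sin.
Qed.

Let cos1 x : `|cos x| <= 1. Proof. by rewrite ler_norml cos_geN1 cos_le1. Qed.
Let sin1 x : `|sin x| <= 1. Proof. by rewrite ler_norml sin_geN1 sin_le1. Qed.

Let integrable_cos_g k t b : 0 < k ->
  leb.-integrable setT (EFin \o (fun x => cos (t * x + b) * g k x)).
Proof.
move=> k0; apply: (le_integrable _ _ _ (integrable_expRNsqr k0)) => //.
  by apply/measurable_EFinP; apply: measurable_funM; [exact: mcosD|exact: mg].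
move=> x _ /=; rewrite lee_fin normrM (ger0_norm (expR_ge0 _)).
by rewrite ler_piMl// expR_ge0.
Qed.

Let integrable_sin_g k t b : 0 < k ->
  leb.-integrable setT (EFin \o (fun x => - (x * sin (t * x + b)) * g k x)).
Proof.
move=> k0; apply: (le_integrable _ _ _ (integrable_norm_mul_g k0)) => //.
  apply/measurable_EFinP; apply: measurable_funM; last exact: mg.
  apply: measurable_funN; apply: measurable_funM; last exact: msinD.
  exact: measurable_id.
move=> x _ /=; rewrite lee_fin !normrM normrN normrM (ger0_norm (expR_ge0 _)) normr_id.
by rewrite ler_wpM2r ?expR_ge0// ler_piMr.
Qed.

Let phi k b t := Rintegral leb setT (fun x => cos (t * x + b) * g k x).

Let g_cvg0 k : 0 < k -> g k n%:R @[n --> \oo] --> 0.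
Proof.
move=> k0; apply: (@squeeze_cvgr _ _ _ _ (fun=> 0) (fun n => k^-1 * @harmonic R n * 2)).
- near=> n; rewrite expR_ge0/= /g mulNr expRN.
  have n0 : 0 < n%:R :> R by rewrite ltr0n; near: n; exact: nbhs_infty_gt.
  have : k * n%:R ^+ 2 <= expR (k * n%:R ^+ 2).
    by apply: le_trans (expR_ge1Dx _); rewrite lerDr.
  rewrite -lef_pV2 ?posrE ?expR_gt0 ?mulr_gt0 ?exprn_gt0// => /le_trans; apply.
  rewrite invfM -mulrA ler_pM2l ?invr_gt0// /harmonic ler_pdivlMl//.
  rewrite ler_pdivrMr ?exprn_gt0//.
  have n1 : 1 <= n%:R :> R by rewrite ler1n -(ltr0n R).
  rewrite -natr1; nra.
- exact: cvg_cst.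
- rewrite -(mul0r 2) -(mulr0 k^-1); apply: cvgMl; apply: cvgMr; exact: cvg_harmonic.
Unshelve. all: by end_near.
Qed.

(** Differentiating under the integral gives the integral of - x sin (t x + b) g. The derivative in
    x of sin (t x + b) g has integral 0, which expresses that quantity through [phi] itself. *)
Let derive_phi k b t : 0 < k ->
  is_derive t 1 (phi k b) (- (t / (2 * k)) * phi k b t).
Proof.
move=> k0.
pose f t x := cos (t * x + b) * g k x.
have d1f (s x : R) : is_derive s 1 (f ^~ x : R -> R) (- (x * sin (s * x + b)) * g k x).
  rewrite /f; apply: is_derive_eq; rewrite /GRing.scale/=; ring.
have E : (fun x => partial1of2 f t x) = (fun x => - (x * sin (t * x + b)) * g k x).
  by apply/funext => x; rewrite partial1of2E; case: (d1f t x).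
have tI : (`]t - 1, t + 1[%classic : set R) t by rewrite /= in_itv/=; lra.
have A1 : forall s, (`]t - 1, t + 1[%classic : set R) s ->
  leb.-integrable setT (EFin \o f s) by move=> s _; exact: integrable_cos_g.
have A2 : forall s x, (`]t - 1, t + 1[%classic : set R) s -> setT x ->
  derivable (f ^~ x) s 1 by move=> s x _ _; case: (d1f s x).
have A3 x : 0 <= `|x| * g k x by rewrite mulr_ge0 ?expR_ge0.
have A4 : forall s x, (`]t - 1, t + 1[%classic : set R) s -> setT x ->
    `|partial1of2 f s x| <= `|x| * g k x.
  move=> s x _ _; rewrite partial1of2E; case: (d1f s x) => _ ->.
  rewrite normrM normrN normrM (ger0_norm (expR_ge0 _)).
  by rewrite ler_wpM2r ?expR_ge0// ler_piMr.
have D1 := differentiation_under_integral measurableT tI A1 A2 A3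
  (integrable_norm_mul_g k0) A4.
have D2 := derivable_under_integral measurableT tI A1 A2 A3
  (integrable_norm_mul_g k0) A4.
apply: DeriveDef => //; rewrite -derive1E D1 E.
have : Rintegral leb setT (fun x => t * (cos (t * x + b) * g k x) +
   2 * k * (- (x * sin (t * x + b)) * g k x)) = 0.
  apply: (@integral_derive_eq0 R (fun x => sin (t * x + b) * g k x)).
  - move=> x; have dg := derive_g k x; apply: is_derive_eq; rewrite /GRing.scale/=. ring.
  - move=> x; have dg := derive_g k x.
    apply: differentiable_continuous; apply/derivable1_diffP; exact: ex_derive.
  - have := integrableD measurableT
      (integrableZl measurableT t (integrable_cos_g t b k0))
      (integrableZl measurableT (2 * k) (integrable_sin_g t b k0)).
    by [].
  - apply/norm_cvg0P.
    apply: (@squeeze_cvgr _ _ _ _ (fun=> 0) (fun n => g k n%:R)).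
    + apply: nearW => n; rewrite normr_ge0/= normrM (ger0_norm (expR_ge0 _)).
      by rewrite ler_piMl// expR_ge0.
    + exact: cvg_cst.
    + exact: g_cvg0.
  - apply/norm_cvg0P.
    apply: (@squeeze_cvgr _ _ _ _ (fun=> 0) (fun n => g k n%:R)).
    + apply: nearW => n; rewrite normr_ge0/= normrM (ger0_norm (expR_ge0 _)).
      by rewrite /g sqrrN ler_piMl// expR_ge0.
    + exact: cvg_cst.
    + exact: g_cvg0.
rewrite RintegralD//; last 2 first.
- exact: (integrableZl measurableT t (integrable_cos_g t b k0)).
- exact: (integrableZl measurableT (2 * k) (integrable_sin_g t b k0)).
rewrite RintegralZl//; last exact: integrable_cos_g.
rewrite RintegralZl//; last exact: integrable_sin_g.
rewrite -/(phi k b t) /Rintegral => H.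
have k2 : 2 * k != 0 by rewrite mulf_neq0// gt_eqF.
apply: (mulfI k2); rewrite mulrA mulrN mulrCA mulfV// mulr1 mulNr.
by apply/eqP; rewrite -addr_eq0 addrC H.
Qed.

(** By the differential equation of [phi], the product of [phi] with exp (t^2 / (4k)) has derivative
    zero, so it keeps its value at t = 0. *)
Lemma Rintegral_cos_expRNsqr k b t : 0 < k ->
  Rintegral leb setT (fun x => cos (t * x + b) * expR (- k * x ^+ 2)) =
  cos b * expR (- (t ^+ 2 / (4 * k))) *
    Rintegral leb setT (fun x => expR (- k * x ^+ 2)).
Proof.
move=> k0; rewrite -/(phi k b t).
pose u t := phi k b t * expR (t ^+ 2 / (4 * k)).
have du (s : R) : is_derive s 1 u 0.
  have := derive_phi b s k0 => dphi; rewrite /u.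
  apply: is_derive_eq; rewrite /GRing.scale/=; field; lra.
have := is_derive_0_is_cst t 0 du; rewrite /u expr0n mul0r expR0 mulr1.
have -> : phi k b 0 = cos b * Rintegral leb setT (fun x => expR (- k * x ^+ 2)).
  rewrite -RintegralZl//; last exact: integrable_expRNsqr.
  by apply: eq_Rintegral => x _; rewrite mul0r add0r.
move=> H; rewrite mulrAC -H expRN; field.
by rewrite gt_eqF// expR_gt0.
Qed.

(** The derivative of x g is g - 2k x^2 g, and its integral vanishes. *)
Lemma Rintegral_sqr_expRNsqr k : 0 < k ->
  leb.-integrable setT (EFin \o (fun x => x ^+ 2 * expR (- k * x ^+ 2))) /\
  2 * k * Rintegral leb setT (fun x => x ^+ 2 * expR (- k * x ^+ 2)) =
  Rintegral leb setT (fun x => expR (- k * x ^+ 2)).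
Proof.
move=> k0; rewrite -/(g k).
have k20 : 0 < k / 2 by rewrite divr_gt0.
have intx2 : leb.-integrable setT (EFin \o (fun x => x ^+ 2 * g k x)).
  apply: (@le_integrable _ _ _ leb setT measurableT
    (fun x => (x ^+ 2 * g k x)%:E)
    (fun x => (2 / k)%:E * (g (k / 2) x)%:E)%E).
  - apply/measurable_EFinP; apply: measurable_funM; last exact: mg.
    exact: exprn_measurable.
  - have g0 k' y : 0 <= g k' y by exact: expR_ge0.
    have k2 : 0 <= 2 / k by rewrite ltW// divr_gt0.
    move=> x _ /=; rewrite lee_fin (ger0_norm (mulr_ge0 (sqr_ge0 _) (g0 _ _))) (ger0_norm (mulr_ge0 k2 (g0 _ _))).
    have -> : g k x = g (k / 2) x * expR (- (k / 2 * x ^+ 2)).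
      by rewrite /g -expRD; congr expR; field.
    rewrite (mulrC (g _ _)) mulrA ler_wpM2r ?expR_ge0// expRN ler_pdivrMr ?expR_gt0//.
    have := expR_ge1Dx (k / 2 * x ^+ 2) => e.
    rewrite -ler_pdivrMl ?divr_gt0// invf_div; apply: le_trans e.
    by rewrite lerDr.
  - by apply: integrableZl => //; apply: integrable_expRNsqr; rewrite divr_gt0.
split => //.
have int0 : Rintegral leb setT (fun x => g k x + - (2 * k) * (x ^+ 2 * g k x)) = 0.
  have bnd (y : R) : `|y * g k y| <= (1 + k^-1) * g (k / 2) y.
    by rewrite normrM (ger0_norm (expR_ge0 _)) norm_mul_g.
  have cvgb : (1 + k^-1) * g (k / 2) n%:R @[n --> \oo] --> 0.
    by rewrite -(mulr0 (1 + k^-1)); apply: cvgMr; exact: g_cvg0.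
  apply: (@integral_derive_eq0 R (fun x => x * g k x)).
  - by move=> x; have dg := derive_g k x; apply: is_derive_eq;
      rewrite /GRing.scale/=; ring.
  - move=> x; have dg := derive_g k x.
    apply: differentiable_continuous; apply/derivable1_diffP; exact: ex_derive.
  - have := integrableD measurableT (integrable_expRNsqr k0)
      (integrableZl measurableT (- (2 * k)) intx2).
    by [].
  - apply/norm_cvg0P; apply: (squeeze_cvgr _ (cvg_cst 0) cvgb).
    by apply: nearW => n; rewrite normr_ge0/= bnd.
  - apply/norm_cvg0P; apply: (squeeze_cvgr _ (cvg_cst 0) cvgb).
    apply: nearW => n; rewrite normr_ge0/= (le_trans (bnd _))//.
    by rewrite /g sqrrN.
move: int0; rewrite RintegralD//; [|exact: integrable_expRNsqr|exact: (integrableZl measurableT _ intx2)].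
rewrite RintegralZl// mulNr => /eqP; rewrite subr_eq0 => /eqP <-.
by [].
Qed.

End Gaussian_characteristic_function.

(** The Radon-Nikodym derivative agrees almost everywhere with the density, because both have the
    same integral over every measurable set. *)
Lemma integral_normal_prob (R : realType) (s : R) (f : R -> \bar R) :
  s != 0 -> (normal_prob 0 s).-integrable setT f ->
  (\int[normal_prob 0 s]_x f x =
   \int[lebesgue_measure]_x (f x * (normal_pdf 0 s x)%:E))%E.
Proof.
move=> s0 intf; have dom := normal_prob_dominates 0 s.
rewrite -(Radon_Nikodym_change_of_variables dom)//=.
have mf := measurable_int _ intf.
apply: ae_eq_integral => //.
- by apply: emeasurable_funM => //.
- by apply: emeasurable_funM => //; apply/measurable_EFinP; exact: measurable_normal_pdf.
- apply: ae_eqe_mul2l => /=.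
  apply: integral_ae_eq => //=.
  + by apply: Radon_Nikodym_integrable; exact: dom.
  + by apply/measurable_EFinP; exact: measurable_normal_pdf.
  + by move=> E _ mE; rewrite -Radon_Nikodym_integral.
Qed.

Lemma normal_law_cos d (T : measurableType d) (R : realType)
    (P : probability T R) (X : T -> R) (v t b : R) :
  measurable_fun setT X ->
  normal_law (fun D => P (X @^-1` D)) 0 v ->
  Rintegral P setT (fun w => cos (t * X w + b)) =
  cos b * expR (- (t ^+ 2 * v / 2)).
Proof.
move=> mX [v0 XE].
have Poo : (P setT < +oo)%E by rewrite probability_setT ltry.
have mcosD : measurable_fun setT (fun x : R => cos (t * x + b)).
  apply: measurableT_comp; last by apply: measurable_funD => //; exact: measurable_funM.
  by apply: continuous_measurable_fun; exact: continuous_cos.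
have cos1 (x : R) : `|cos x| <= 1 by rewrite ler_norml cos_geN1 cos_le1.
have [ve|vn0] := eqVneq v 0.
  rewrite -(@Rintegral_pushforward _ _ T _ R P (@dirac _ R 0 R) X
    (fun x => cos (t * x + b)) 1)//.
    rewrite /Rintegral integral_dirac//=; last exact/measurable_EFinP.
    by rewrite indicT mul1r mulr0 add0r ve mulr0 mul0r oppr0 expR0 mulr1.
  - by move=> B mB; apply/esym; have := XE B mB; rewrite /gauss ve eqxx; exact.
pose s := Num.sqrt v.
have s0 : s != 0 by rewrite sqrtr_eq0 -ltNge lt_neqAle eq_sym vn0.
have s2 : s ^+ 2 = v by rewrite sqr_sqrtr.
pose k := (2 * v)^-1.
have vgt0 : 0 < v by rewrite lt_neqAle eq_sym vn0.
have k0 : 0 < k by rewrite invr_gt0 mulr_gt0.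
rewrite -(@Rintegral_pushforward _ _ T _ R P (normal_prob 0 s) X
    (fun x => cos (t * x + b)) 1)//; last first.
  by move=> B mB; apply/esym; have := XE B mB; rewrite /gauss (negbTE vn0); exact.
rewrite /Rintegral integral_normal_prob//; last first.
  apply: (@bounded_integrable _ _ _ _ _ 1) => //.
  rewrite [ltLHS](_ : _ = 1%E) ?ltry//.
  exact: (@probability_setT _ _ _ (normal_prob 0 s)).
have pE x : normal_pdf 0 s x = normal_peak s * expR (- k * x ^+ 2).
  rewrite normal_pdfE//; congr (_ * expR _); rewrite subr0 s2 /k; field.
  exact: lt0r_neq0.
have ck := Rintegral_cos_expRNsqr b t k0.
(* The normalisation is read off the total mass of the density, so the Gaussian integral itself need
   not be evaluated. *)
have int1 : normal_peak s * Rintegral lebesgue_measure setT (fun x => expR (- k * x ^+ 2)) = 1.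
  rewrite -RintegralZl//; last exact: integrable_expRNsqr.
  rewrite /Rintegral; under eq_integral do rewrite -pE.
  by rewrite integral_normal_pdf.
transitivity (normal_peak s * Rintegral lebesgue_measure setT
    (fun x => cos (t * x + b) * expR (- k * x ^+ 2))).
  rewrite -RintegralZl//.
    by rewrite /Rintegral; congr fine; apply: eq_integral => x _;
      rewrite pE -EFinM mulrCA.
  apply: (le_integrable _ _ _ (integrable_expRNsqr k0)) => //.
    apply/measurable_EFinP; apply: measurable_funM.
      exact: mcosD.
    have /measurable_EFinP := measurable_int _ (integrable_expRNsqr k0).
    by [].
  move=> x _ /=; rewrite lee_fin normrM (ger0_norm (expR_ge0 _)).
  by rewrite ler_piMl// expR_ge0.
rewrite ck mulrCA int1 mulr1; congr (_ * expR (- _)).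
by rewrite /k; field; exact: lt0r_neq0.
Qed.

(** The Wiener property supplies some covariance matrix and the strong cylindrical property supplies
    [Q]; this lemma identifies the two. *)
Lemma normal_law_second_moment d (T : measurableType d) (R : realType)
    (P : probability T R) (X : T -> R) (v c : R) :
  measurable_fun setT X ->
  normal_law (fun D => P (X @^-1` D)) 0 v ->
  (\int[P]_w (X w ^+ 2)%:E = c%:E)%E -> c = v.
Proof.
move=> mX [v0 XE] Xc.
have msqr : measurable_fun setT (fun x : R => (x ^+ 2)%:E).
  by apply/measurable_EFinP; exact: exprn_measurable.
have push (m : {measure set (measurableTypeR R) -> \bar R}) :
    (forall B, measurable B -> m B = P (X @^-1` B)) ->
    (\int[m]_x (x ^+ 2)%:E = c%:E)%E.
  move=> mE; rewrite (eq_measure_integral (pushforward P (X : T -> measurableTypeR R))); last first.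
    by move=> A /mE ->.
  by rewrite ge0_integral_pushforward// => x _; rewrite lee_fin sqr_ge0.
have [ve|vn0] := eqVneq v 0.
  have : (\int[@dirac _ (measurableTypeR R) (0 : R)%R R]_x ((x : R) ^+ 2)%:E = c%:E)%E.
    by apply: push => B mB; apply/esym; have := XE B mB; rewrite /gauss ve eqxx; exact.
  by rewrite integral_dirac// diracT mul1e expr0n/= ve => -[].
pose s := Num.sqrt v.
have s0 : s != 0 by rewrite sqrtr_eq0 -ltNge lt_neqAle eq_sym vn0.
have s2 : s ^+ 2 = v by rewrite sqr_sqrtr.
pose k := (2 * v)^-1.
have vgt0 : 0 < v by rewrite lt_neqAle eq_sym vn0.
have k0 : 0 < k by rewrite invr_gt0 mulr_gt0.
have nE (B : set R) : measurable B -> normal_prob 0 s B = P (X @^-1` B).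
  by move=> mB; apply/esym; have := XE B mB; rewrite /gauss (negbTE vn0); exact.
have Ic := push (normal_prob 0 s) nE.
have pE x : normal_pdf 0 s x = normal_peak s * expR (- k * x ^+ 2).
  rewrite normal_pdfE//; congr (_ * expR _); rewrite subr0 s2 /k; field.
  exact: lt0r_neq0.
have [int2 sk] := Rintegral_sqr_expRNsqr k0.
have int1 : normal_peak s * Rintegral lebesgue_measure setT (fun x => expR (- k * x ^+ 2)) = 1.
  rewrite -RintegralZl//; last exact: integrable_expRNsqr.
  rewrite /Rintegral; under eq_integral do rewrite -pE.
  by rewrite integral_normal_pdf.
have := Ic; rewrite integral_normal_prob//; last first.
  apply/integrableP; split => //.
  under eq_integral do rewrite gee0_abs ?lee_fin ?sqr_ge0//.
  by rewrite Ic ltry.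
have -> : (\int[lebesgue_measure]_x ((x ^+ 2)%:E * (normal_pdf 0 s x)%:E) =
  (normal_peak s * Rintegral lebesgue_measure setT
     (fun x => x ^+ 2 * expR (- k * x ^+ 2)))%:E)%E.
  rewrite -RintegralZl// /Rintegral fineK; last first.
    exact: (integrable_fin_num measurableT (integrableZl measurableT _ int2)).
  by apply: eq_integral => x _; rewrite pE -EFinM mulrCA.
move=> [<-].
have : 2 * k * (normal_peak s * Rintegral lebesgue_measure setT
     (fun x => x ^+ 2 * expR (- k * x ^+ 2))) = 1 by rewrite mulrCA sk int1.
set Z := normal_peak s * _ => kZ.
have -> : Z = v * (2 * k * Z) by rewrite /k; field; exact: lt0r_neq0.
by rewrite kZ mulr1.
Qed.

(** * Duality and tightness in separable spaces *)

(* Linear functionals on subspaces are handled through their graphs [G]. *)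
Section Hahn_Banach.
Context {R : realType} {E : normedModType R}.
Implicit Types (G : set (E * R)) (x y : E).

Let subspace G := forall (a : R) p q, G p -> G q ->
  G (a *: p.1 + q.1, a * p.2 + q.2).

Let below_norm G := forall p, G p -> p.2 <= `|p.1|.

(** The value c at [y] must dominate every p.2 - |p.1 - y| and be dominated by every |q.1 + y| -
    q.2. The triangle inequality separates the two families, so the supremum of the first one works;
    scaling reduces an arbitrary t to t = 1 or t = -1. *)
Let subspace_extension G y : subspace G -> below_norm G -> G !=set0 ->
  exists c, below_norm
    [set (p.1 + t *: y, p.2 + t * c) | p in G & t in (setT : set R)].
Proof.
move=> sG bG [p0 Gp0].
have Gscale (a : R) p : G p -> G (a *: p.1, a * p.2).
  move=> Gp; have G0 : G (0, 0).
    have := sG (-1) p p Gp Gp.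
    by rewrite scaleN1r addNr mulN1r addNr.
  by have := sG a p (0, 0) Gp G0; rewrite /= !addr0.
pose A := [set p.2 - `|p.1 - y| | p in G].
have sep p q : G p -> G q -> p.2 - `|p.1 - y| <= `|q.1 + y| - q.2.
  move=> Gp Gq; rewrite lerBlDr addrAC lerBrDr.
  have /bG/= := sG 1 p q Gp Gq; rewrite scale1r mul1r => /le_trans; apply.
  have -> : p.1 + q.1 = (q.1 + y) + (p.1 - y) by rewrite [RHS]addrACA subrr addr0 addrC.
  exact: ler_normD.
have A0 : A !=set0 by exists (p0.2 - `|p0.1 - y|), p0.
have Aub q : G q -> ubound A (`|q.1 + y| - q.2) by move=> Gq _ [p Gp <-]; exact: sep.
have supA : has_sup A by split=> //; eexists; exact: Aub Gp0.
exists (sup A) => _ [p Gp [t _ <-]] /=.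
have c1 q : G q -> q.2 + sup A <= `|q.1 + y|.
  by move=> Gq; rewrite -lerBrDl; apply: ge_sup => //; exact: Aub.
have c2 q : G q -> q.2 - sup A <= `|q.1 - y|.
  move=> Gq; rewrite lerBlDr -lerBlDl; apply: ub_le_sup; first exact: supA.2.
  by exists q.
have [t0|t0|->] := ltgtP t 0; last by rewrite scale0r mul0r !addr0 bG.
- have nt0 : 0 < - t by rewrite oppr_gt0.
  have := c2 _ (Gscale (- t)^-1 _ Gp); rewrite /=.
  rewrite -(ler_pM2l nt0) mulrBr mulrA divff ?gt_eqF// mul1r mulNr opprK.
  move=> /le_trans; apply; rewrite -[X in X * _](gtr0_norm nt0) -normrZ.
  by rewrite scalerBr scalerA divff ?gt_eqF// scale1r scaleNr opprK.
- have := c1 _ (Gscale t^-1 _ Gp); rewrite /=.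
  rewrite -(ler_pM2l t0) mulrDr mulrA divff ?gt_eqF// mul1r.
  move=> /le_trans; apply; rewrite -[X in X * _](gtr0_norm t0) -normrZ.
  by rewrite scalerDr scalerA divff ?gt_eqF// scale1r.
Qed.

Lemma hahn_banach_norming x0 :
  exists f : dual E, f x0 = `|x0| /\ forall y, f y <= `|y|.
Proof.
(* The last condition leaves out the empty set, the union of the empty chain. *)
pose Pr G := [/\ subspace G, below_norm G & forall p, G p -> G (x0, `|x0|)].
have [|A [[sA bA A0] maxA]] := @Zorn_bigcup (E * R)%type Pr.
  move=> C CP tot; split.
  - move=> a p q [X CX Xp] [Y CY Yq].
    have [XY|YX] := tot _ _ CX CY.
      by exists Y => //; case: (CP _ CY) => sY _ _; apply: sY => //; exact: XY.
    by exists X => //; case: (CP _ CX) => sX _ _; apply: sX => //; exact: YX.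
  - by move=> p [X CX Xp]; have [_ bX _] := CP _ CX; exact: bX.
  - by move=> p [X CX Xp]; exists X => //; have [_ _ X0] := CP _ CX; exact: X0 Xp.
have An0 : A !=set0.
  (* An empty maximal graph would be strictly extended by the line through (x0, |x0|). *)
  apply/set0P/eqP => A_0.
  pose line : set (E * R) := [set (t *: x0, t * `|x0|) | t in setT].
  apply: (maxA line).
    rewrite A_0; split; first exact: sub0set.
    by move=> /(_ (1 *: x0, 1 * `|x0|)); apply; exists 1.
  split.
  - move=> a _ _ [t _ <-] [s _ <-] /=; exists (a * t + s) => //.
    by rewrite scalerDl scalerA mulrDl mulrA.
  - by move=> _ [t _ <-] /=; rewrite normrZ ler_wpM2r// ler_norm.
  - by move=> _ _; exists 1 => //; rewrite scale1r mul1r.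
have [p0 Ap0] := An0.
have full y : exists r, A (y, r).
  apply: contrapT => /forallNP ny.
  have [c bc] := subspace_extension y sA bA An0.
  set B := [set (p.1 + t *: y, p.2 + t * c) | p in A & t in (setT : set R)] in bc.
  have AB : A `<=` B.
    by move=> p Ap; exists p => //; exists 0 => //; case: p {Ap} => a b; rewrite scale0r mul0r !addr0.
  have A00 : A (0, 0).
    have := sA (-1) p0 p0 Ap0 Ap0.
    by rewrite scaleN1r addNr mulN1r addNr.
  apply: (maxA B).
    split=> //.
    move=> /(_ (y, c)) H; apply: (ny c); apply: H.
    by exists (0, 0) => //; exists 1 => //; rewrite /= scale1r mul1r !add0r.
  split=> //.
  - move=> a _ _ [p Ap [t _ <-]] [q Aq [s _ <-]] /=.
    exists (a *: p.1 + q.1, a * p.2 + q.2); first exact: sA.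
    exists (a * t + s) => //=; congr (_, _).
      by rewrite scalerDr scalerDl scalerA addrACA.
    by rewrite mulrDr mulrDl mulrA addrACA.
  - by move=> _ _; exact/AB/(A0 _ Ap0).
have {full} /choice[f Af] := full.
(* The domination alone makes the graph single-valued: it contains (0, r - s) and (0, s - r), so
   neither second entry exceeds 0. *)
have uniqA y r s : A (y, r) -> A (y, s) -> r = s.
  move=> Ar As; apply/eqP; rewrite eq_le; apply/andP; split.
    have := bA _ (sA (-1) _ _ As Ar).
    by rewrite /= scaleN1r addNr normr0 mulN1r addrC subr_le0.
  have := bA _ (sA (-1) _ _ Ar As).
  by rewrite /= scaleN1r addNr normr0 mulN1r addrC subr_le0.
have linf : linear (f : E -> R^o).
  by move=> a y z; apply: (uniqA (a *: y + z)) => //; exact: (sA a (y, _) (z, _)).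
have fle y : f y <= `|y| := bA _ (Af y).
have fN y : f (- y) = - f y.
  have f0 : f 0 = 0.
    by have := linf (-1) 0 0; rewrite scaler0 addr0 scaleN1r addNr.
  by have := linf (-1) y 0; rewrite scaleN1r addr0 scaleN1r f0 addr0.
have fB y z : f (y - z) = f y - f z.
  by have := linf 1 y (- z); rewrite !scale1r fN.
have cf : continuous (f : E -> R^o).
  move=> y; apply/cvgrPdist_lt => e e0; near=> z.
  rewrite -fB; apply: (@le_lt_trans _ _ `|y - z|).
    by rewrite ler_norml fle andbT lerNl -fN (le_trans (fle _))// normrN.
  by near: z; exact: cvgr_dist_lt.
have Df : f \in @dual_pred R E by apply/asboolP.
exists (Dual Df); split=> //=.
by apply: (uniqA x0) => //; exact: A0 Ap0.
Unshelve. all: by end_near.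
Qed.

End Hahn_Banach.

Lemma dual0 (R : realType) (E : normedModType R) (f : dual E) : f 0 = 0.
Proof.
by have := dual_linear f (-1) 0 0; rewrite scaler0 addr0 scaleN1r addNr.
Qed.

Lemma dualB (R : realType) (E : normedModType R) (f : dual E) (x y : E) :
  f (x - y) = f x - f y.
Proof.
have := dual_linear f (-1) y x; rewrite scaleN1r (addrC (- y)) => ->.
by rewrite scaleN1r addrC.
Qed.

Lemma sum_dualE (R : realType) (E : normedModType R) (I : Type) (r : seq I)
    (c : I -> R) (u : I -> dual E) x :
  (\sum_(i <- r) c i *: u i : dual E) x = \sum_(i <- r) c i * u i x.
Proof. by elim: r => [|i r IH]; rewrite ?big_nil// !big_cons -IH. Qed.

(** The functionals norming the points of a dense sequence suffice, as each of them is
    1-Lipschitz. *)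
Lemma norming_sequence (R : realType) (E : normedModType R) : separable E ->
  exists u : nat -> dual E, (forall n x, u n x <= `|x|) /\
    forall x r, 0 <= r -> (forall n, u n x <= r) -> `|x| <= r.
Proof.
move=> /separable_dense_seq[a Ha].
have /choice[u Hu] := fun n => hahn_banach_norming (a n).
exists u; split=> [n x|x r r0 H]; first exact: (Hu n).2.
apply/ler_addgt0Pr => e e0.
have e2 : 0 < e / 2 by rewrite divr_gt0.
have [n xn] := Ha x (e / 2) e2.
have := H n; have -> : u n x = u n (a n) - u n (a n - x) by rewrite dualB; ring.
rewrite (Hu n).1 => h.
have : `|x| <= `|a n| + `|x - a n| by rewrite -{1}(subrK (a n) x) addrC ler_normD.
by have := (Hu n).2 (a n - x); rewrite distrC; lra.
Qed.

(** * Compact sets and Ulam's theorem *)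

Lemma closed_borel_measurable (T : ptopologicalType) (A : set T) :
  closed A -> @measurable _ (borel T) A.
Proof.
move=> cA; rewrite -[A]setCK; apply: measurableC; apply: sub_sigma_algebra.
exact: closed_openC.
Qed.

(** An ultrafilter on this set contains one of the finitely many balls at each level k, hence is
    Cauchy and converges by completeness. The limit stays in the set because the balls are
    closed. *)
Lemma totally_bounded_closed_compact (R : realType)
    (U : completeNormedModType R) (a : nat -> U) (N : nat -> nat) :
  compact [set x | forall k, exists2 i, (i < N k)%N & `|x - a i| <= k.+1%:R^-1].
Proof.
rewrite compact_ultra => F FU FK; set K := (X in F X) in FK *.
have PF : ProperFilter F by apply: ultra_proper.
pose B k i := [set x : U | `|x - a i| <= k.+1%:R^-1].
have FB k : exists i, F (B k i).
  apply: contrapT => /forallNP nB.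
  have FC n : F [set x | forall i, (i < n)%N -> ~ B k i x].
    elim: n => [|n IH]; first by apply: filterS filterT => x _ i.
    have [/nB//|FnB] := in_ultra_setVsetC (B k n) FU.
    apply: filterS2 IH FnB => x H1 H2 i; rewrite ltnS leq_eqVlt => /orP[/eqP->//|].
    exact: H1.
  have [x [Kx Hx]] := @filter_ex _ F PF _ (filterI FK (FC (N k))).
  have [i iN xi] := Kx k; exact: (Hx i iN).
have cF : cvg F.
  apply: cauchy_cvg; apply: cauchy_exP => e e0.
  near \oo => k.
  have [i Fi] := FB k; exists (a i); apply: filterS Fi => x.
  rewrite /B/= -ball_normE/= distrC => /le_lt_trans; apply.
  near: k.
  have /cvgr_lt := @cvg_harmonic R; exact.
have FK' k : F [set x | exists2 i, (i < N k)%N & B k i x].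
  by apply: filterS FK => x /(_ k).
have cB k i : closed (B k i).
  have -> : B k i = (fun x => `|x - a i|) @^-1` [set r | r <= k.+1%:R^-1] by [].
  apply: preimage_closed; last exact: closed_le.
  by move=> x _; apply: cvg_norm; apply: cvgB; [exact: cvg_id|exact: cvg_cst].
exists (lim F); split; last exact: cF.
move=> k; apply: contrapT => nk.
have nB i : (i < N k)%N -> F (~` B k i).
  move=> iN; apply: cF; apply: open_nbhs_nbhs; split; first exact: closed_openC.
  by move=> Bi; apply: nk; exists i.
have FC n : (n <= N k)%N -> F [set x | forall i, (i < n)%N -> ~ B k i x].
  elim: n => [|n IH] nN; first by apply: filterS filterT => x _ i.
  apply: filterS2 (IH (ltnW nN)) (nB _ nN) => x H1 H2 i.
  by rewrite ltnS leq_eqVlt => /orP[/eqP->//|]; exact: H1.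
have [x [[i iN xi] Hx]] := @filter_ex _ F PF _ (filterI (FK' k) (FC _ (leqnn _))).
exact: (Hx i iN).
Unshelve. all: by end_near.
Qed.

(** For fixed k the points farther than 1 / (k + 1) from the first n centres decrease to the empty
    set as n grows. Choosing N k so that their measure is at most eps / 2^(k+1) leaves a complement
    of total measure at most eps. *)
Lemma ulam_tight (R : realType) (U : completeNormedModType R)
    (nu : {measure set (borel U) -> \bar R}) (eps : R) :
  separable U -> (nu setT < +oo)%E -> 0 < eps ->
  exists2 K : set U, compact K & (nu (~` K) <= eps%:E)%E.
Proof.
move=> /separable_dense_seq[a Ha] nuoo e0.
pose D k n := [set x : U | forall i, (i < n)%N -> k.+1%:R^-1 < `|x - a i|].
have oD k n : open (D k n).
  rewrite (_ : D k n = \bigcap_(i < n) [set x : U | k.+1%:R^-1 < `|x - a i|]).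
    rewrite bigcap_mkord; apply: big_ind => //.
    - exact: openT.
    - by move=> ? ?; exact: openI.
    - move=> i _; have -> : [set x | k.+1%:R^-1 < `|x - a i|] =
        (fun x => `|x - a i|) @^-1` [set r | k.+1%:R^-1 < r] by [].
      apply: open_comp; last exact: open_gt.
      by move=> x _; apply: cvg_norm; apply: cvgB; [exact: cvg_id|exact: cvg_cst].
  by apply/seteqP; split=> x H i; exact: H.
have mD k n : @measurable _ (borel U) (D k n).
  by apply: sub_sigma_algebra; exact: oD.
have D0 k : \bigcap_n D k n = set0.
  apply/seteqP; split=> // x H.
  have [i xi] : exists i, `|x - a i| < k.+1%:R^-1 by apply: Ha; rewrite invr_gt0.
  by have := H i.+1 I i (ltnSn i); rewrite ltNge (ltW xi).
have /choice[N HN] k : exists n, (nu (D k n) <= (eps / (2 ^ k.+1)%:R)%:E)%E.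
  have C : (nu \o D k) n @[n --> \oo] --> nu (\bigcap_n D k n).
    apply: (@nonincreasing_cvg_mu _ (borel U) _ nu (D k)).
    - by apply: le_lt_trans nuoo; apply: le_measure; rewrite ?inE.
    - by [].
    - by rewrite D0.
    - move=> n m nm; apply/subsetPset => x H i im; apply: H.
      exact: leq_trans im nm.
  move: C; rewrite D0 measure0 => /fine_cvgP[fD C].
  have ek : 0 < eps / (2 ^ k.+1)%:R by rewrite divr_gt0// ltr0n expn_gt0.
  have [n [fn nn]] := filter_ex (filterI fD (cvgr_lt _ C _ ek)).
  by exists n; rewrite -[leLHS](fineK fn) lee_fin ltW.
exists [set x | forall k, exists2 i, (i < N k)%N & `|x - a i| <= k.+1%:R^-1].
  exact: totally_bounded_closed_compact.
have -> : ~` [set x | forall k, exists2 i, (i < N k)%N & `|x - a i| <= k.+1%:R^-1] =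
  \bigcup_k D k (N k).
  apply/seteqP; split => x.
    move=> /existsNP[k xk]; exists k => // i iN.
    by rewrite ltNge; apply/negP => xi; apply: xk; exists i.
  move=> [k _ xk] H; have [i iN xi] := H k.
  by have := xk i iN; rewrite ltNge xi.
apply: (@le_trans _ _ (\sum_(0 <= k <oo) nu (D k (N k)))%E).
  by apply: generalized_Boole_inequality => //; exact: bigcup_measurable.
apply: (@le_trans _ _ (\sum_(0 <= k <oo) (eps / (2 ^ k.+1)%:R)%:E)%E).
  by apply: lee_nneseries => // k _; exact: HN.
exact: epsilon_trick0 (ltW e0).
Qed.

(** * Random elements from tight cylindrical random variables *)

Section Tight_cylindrical_random_variable.
Context {d : measure_display} {Omega : measurableType d} {R : realType}.
Variables (P : probability Omega R) (G : set (set Omega)).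
Context {U : completeNormedModType R}.
Variable X : dual U -> Omega -> R.
Hypothesis sU : separable U.
Hypothesis sG : sigma_algebra setT G.
Hypothesis Gm : G `<=` measurable.
Hypothesis GX : forall u (D : set R), measurable D -> G (X u @^-1` D).

(* By compactness of [K], the event [values K phi] that some point of [K]
   realises all the [X (phi n)] is the decreasing limit of its analogues for
   finitely many functionals, which tightness makes likely. *)
Let values (K : set U) (phi : nat -> dual U) : set Omega :=
  [set w | exists2 x, K x & forall n, phi n x = X (phi n) w].

Let finite_values (K : set U) (phi : nat -> dual U) n : set Omega :=
  [set w | exists2 x, K x & forall i, (i < n)%N -> phi i x = X (phi i) w].

Let valuesE K phi : compact K ->
  values K phi = \bigcap_n finite_values K phi n.
Proof.
move=> cK; apply/seteqP; split=> w.
  by move=> [x Kx xw] n _; exists x.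
move=> H.
have /choice[x Hx] n : exists x, K x /\ forall i, (i < n)%N -> phi i x = X (phi i) w.
  by have [x Kx xi] := H n I; exists x.
have FK : (x @ \oo) K by exists 0%N => // n _; exact: (Hx n).1.
(* Each equation defines a closed set that contains the sequence from some rank on, so a cluster
   point satisfies all the equations at once. *)
have [p [Kp clp]] : K `&` cluster (x @ \oo) !=set0 by exact: cK.
exists p => // n.
have cn : closed [set y : U | phi n y = X (phi n) w].
  have -> : [set y : U | phi n y = X (phi n) w] = phi n @^-1` [set X (phi n) w] by [].
  by apply: preimage_closed; [move=> y _; exact: dual_continuous|exact: closed_eq].
apply: cn => B pB; apply: clp pB.
by exists n.+1 => // k /= nk; exact: (Hx k).2.
Qed.

Let pr (phi : nat -> dual U) n (x : U) : 'rV[R]_n := \row_(i < n) phi i x.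

(** The event says that a row of variables lies in a compact, hence Borel, set of rows. This makes
    it an event of [G], and it exhibits a cylinder containing [K] to which tightness applies. *)
Let finite_valuesE K phi n :
  finite_values K phi n = [set w | (pr phi n @` K) (\row_(i < n) X (phi i) w)].
Proof.
apply/seteqP; split=> w.
  move=> [x Kx H]; exists x => //; apply/rowP => i; rewrite !mxE; exact: H.
move=> [x Kx /rowP H]; exists x => // i iN.
by have := H (Ordinal iN); rewrite !mxE.
Qed.

Let compact_pr K phi n : compact K -> compact (pr phi n @` K).
Proof.
move=> cK; apply: continuous_compact => //; apply: continuous_subspaceT => x.
apply/cvgrPdist_le => e e0; near=> y.
have H : forall j : 'I_n, `|phi j x - phi j y| <= e.
  near: y; apply: filter_forall => k.
  have := @dual_continuous _ _ (phi k) x.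
  by move=> /cvgrPdist_le/(_ e e0).
rewrite [leLHS]mx_normrE; apply: bigmax_le => [|[i j] _]; first exact: ltW.
by rewrite !mxE/=; exact: H.
Unshelve. all: by end_near.
Qed.

Let measurable_pr K phi n : compact K ->
  @measurable _ (borel 'rV[R]_n) (pr phi n @` K).
Proof.
move=> cK; apply: closed_borel_measurable; apply: compact_closed.
  exact: norm_hausdorff.
exact: compact_pr.
Qed.

Let Gfinite K phi n : compact K -> G (finite_values K phi n).
Proof.
move=> cK; rewrite finite_valuesE.
apply: (measurable_rowP (f := fun (i : 'I_n) => X (phi i)) sG).
  by move=> i D mD; exact: GX.
exact: measurable_pr.
Qed.

Let Gvalues K phi : compact K -> G (values K phi).
Proof.
move=> cK; rewrite valuesE//.
have GE : @measurable _ (g_sigma_algebraType G) = G.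
  by rewrite measurable_g_measurableTypeE.
by rewrite -GE; apply: bigcapT_measurable => n; rewrite GE; exact: Gfinite.
Qed.

(** Tightness is expressed by the laws of the rows of [X], so that it can be checked for [W t] at
    any time, whereas a cylindrical distribution is given only at time 1. *)
Hypothesis tX : forall eps : R, 0 < eps -> exists2 K : set U, compact K &
  forall n (u : 'I_n -> dual U) (B : set (borel 'rV[R]_n)), measurable B ->
    K `<=` cylinder u B -> ((1 - eps)%:E <= P [set w | B (\row_i X (u i) w)])%E.

Lemma tight_cylindrical_rv_induced : exists Y : Omega -> U,
  (forall B : set (borel U), measurable B -> G (Y @^-1` B)) /\
  forall u, \forall w \ae P, X u w = u (Y w).
Proof.
have [u [ux xu]] := norming_sequence sU.
have /choice[K HK] m : exists K : set U, compact K /\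
    forall n (u : 'I_n -> dual U) (B : set (borel 'rV[R]_n)), measurable B ->
    K `<=` cylinder u B ->
    ((1 - m.+1%:R^-1)%:E <= P [set w | B (\row_i X (u i) w)])%E.
  have [|K cK HK] := tX (eps := m.+1%:R^-1); first by rewrite invr_gt0.
  by exists K.
have Pvalues phi m : ((1 - m.+1%:R^-1)%:E <= P (values (K m) phi))%E.
  have cK := (HK m).1; rewrite valuesE//.
  have C : (P \o finite_values (K m) phi) n @[n --> \oo] -->
      P (\bigcap_n finite_values (K m) phi n).
    apply: nonincreasing_cvg_mu.
    - by apply: le_lt_trans (probability_le1 _ _) (ltry _); exact/Gm/Gfinite.
    - by move=> n; exact/Gm/Gfinite.
    - by rewrite -valuesE//; exact/Gm/Gvalues.
    - move=> n k nk; apply/subsetPset => w [x Kx xi]; exists x => // i /leq_trans.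
      by move=> /(_ _ nk); exact: xi.
  rewrite -(cvg_lim _ C)//; apply: lime_ge; first by apply/cvg_ex; eexists; exact: C.
  apply: nearW => n /=; rewrite finite_valuesE.
  apply: (HK m).2; first exact: measurable_pr.
  by move=> x Kx; exists x.
have sep x y : (forall n, u n x = u n y) -> x = y.
  move=> xy; apply/eqP; rewrite -subr_eq0 -normr_le0; apply: xu => // n.
  by rewrite dualB xy subrr.
pose E := \bigcup_m values (K m) u.
have GE : @measurable _ (g_sigma_algebraType G) = G.
  by rewrite measurable_g_measurableTypeE.
have GEv : G E.
  rewrite -GE; apply: bigcupT_measurable => m; rewrite GE.
  exact/Gvalues/(HK m).1.
(* Off [E] the value is fixed to 0; as [E] belongs to [G], this keeps [Y] measurable for [G]. *)
have /choice[Y HY] w : exists y, (E w -> forall n, u n y = X (u n) w) /\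
    (~ E w -> y = 0).
  have [[m _ [x Kx xw]]|nE] := pselect (E w); last by exists 0.
  by exists x; split => // nE; case: nE; exists m => //; exists x.
exists Y; split.
  apply: (@borel_generated R U nat u (fun B => G (Y @^-1` B))) => //.
  - by move=> n x y; exact: dualB.
  - case: sG => G0 GC GU; split=> //.
    + by move=> A; exact: GC.
    + by move=> A GA; exact: GU.
  - move=> n c.
    have -> : Y @^-1` [set x | u n x <= c] =
      (E `&` X (u n) @^-1` `]-oo, c]%classic) `|` (~` E `&` [set w | 0 <= c]).
      have un0 : u n 0 = 0 by exact: dual0.
      apply/seteqP; split => w /=.
        have [Ew|nE] := pselect (E w).
          by rewrite ((HY w).1 Ew n) => h; left; rewrite in_itv.
        by rewrite ((HY w).2 nE) un0 => h; right.
      move=> [[Ew]|[nE]]; first by rewrite ((HY w).1 Ew n) in_itv.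
      by rewrite ((HY w).2 nE) un0.
    rewrite -GE; apply: measurableU; apply: measurableI; rewrite ?GE//.
    + exact: GX.
    + by rewrite -GE; apply: measurableC; rewrite GE.
    + have [c0|c0] := pselect (0 <= c).
        rewrite (_ : [set w | _] = setT); first by rewrite -GE; exact: measurableT.
        by apply/seteqP; split.
      rewrite (_ : [set w | _] = set0); first by rewrite -GE; exact: measurable0.
      by apply/seteqP; split.
(* A point realising the values at [v] and at all [u n] must be [Y w], since the [u n] separate
   points; hence its value at [v] is that of [Y w]. *)
move=> v; pose phi n := if n is k.+1 then u k else v.
pose N := ~` \bigcup_m values (K m) phi.
have mN : measurable N.
  apply: measurableC; apply: bigcupT_measurable => m; apply: Gm.
  exact/Gvalues/(HK m).1.
exists N; split=> //.
  apply/eqP; rewrite -measure_le0; apply/lee_addgt0Pr => e e0; rewrite add0e.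
  have [m me] : exists m, m.+1%:R^-1 < e :> R.
    have /cvgr_lt/(_ e e0)/filter_ex[m] := @cvg_harmonic R.
    by exists m.
  apply: (@le_trans _ _ (m.+1%:R^-1)%:E); last by rewrite lee_fin ltW.
  have mV : measurable (values (K m) phi) by exact/Gm/Gvalues/(HK m).1.
  apply: (@le_trans _ _ (P (~` values (K m) phi))).
    apply: le_measure; rewrite ?inE//; first exact: measurableC.
    by apply: subsetC => w Vw; exists m.
  rewrite probability_setC// leeBlDr; last exact: fin_num_measure.
  by have := Pvalues phi m; rewrite EFinB leeBlDr// addeC.
move=> w /= nXY [m _ [x Kx xw]]; apply: nXY.
have Ew : E w by exists m => //; exists x => // n; exact: (xw n.+1).
have -> : Y w = x by apply: sep => n; rewrite ((HY w).1 Ew) (xw n.+1).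
by rewrite (xw 0%N).
Qed.

End Tight_cylindrical_random_variable.

(** * Cylindrical measures *)

Lemma measure_eq_ae d (T : measurableType d) (R : realType)
    (m : {measure set T -> \bar R}) (A B : set T) :
  measurable A -> measurable B -> (\forall x \ae m, A x <-> B x) -> m A = m B.
Proof.
move=> mA mB AB.
rewrite -[A]setIT -[B]setIT -!integral_indic//; apply: ae_eq_integral => //.
- by apply/measurable_EFinP; exact: measurable_indic.
- by apply/measurable_EFinP; exact: measurable_indic.
- apply: filterS AB => x ABx _; rewrite !indicE; congr ((nat_of_bool _)%:R%:E).
  by apply/idP/idP; rewrite !inE => /ABx.
Qed.

(** Take a matrix of maximal rank among those with rows in [S]: a vector of [S] outside its row
    space would raise the rank. The subspace is thereby cut out by finitely many linear
    equations. *)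
Lemma submodule_rowspace (R : fieldType) n (S : set 'rV[R]_n) :
  S 0 -> (forall (a : R) p q, S p -> S q -> S (a *: p + q)) ->
  exists M : 'M[R]_n, forall p, S p <-> (p <= M)%MS.
Proof.
move=> S0 Sl.
have Ssub k (M : 'M[R]_(k, n)) p : (forall i, S (row i M)) -> (p <= M)%MS -> S p.
  move=> SM /submxP[D ->]; rewrite mulmx_sum_row.
  elim/big_ind : _ => //.
  - by move=> x y Sx Sy; rewrite -[x]scale1r; exact: Sl.
  - by move=> i _; rewrite -[_ *: _]addr0; exact: Sl.
pose Q k := `[< exists M : 'M[R]_n, (forall i, S (row i M)) /\ \rank M = k >].
have Q0 : exists k, Q k.
  exists 0%N; apply/asboolP; exists 0; split; last by rewrite mxrank0.
  by move=> i; rewrite row0.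
have Qn k : Q k -> (k <= n)%N by move=> /asboolP[M [_ <-]]; exact: rank_leq_row.
case: (ex_maxnP Q0 Qn) => k /asboolP[M [SM rM]] maxk.
exists M => p; split; last exact: Ssub.
move=> Sp; apply/negP => pM.
have SMp i : S (row i (M + p)%MS).
  apply: (@Ssub _ (col_mx M p)); last first.
    by rewrite -addsmxE (submx_trans (row_sub _ _)).
  by move=> j; have [j' ->|j' ->] := split_ordP j;
    rewrite ?rowKu ?rowKd // (_ : row j' p = p)//; apply/rowP => l;
    rewrite mxE ord1.
have : Q (\rank (M + p)%MS) by apply/asboolP; exists (M + p)%MS.
move=> /maxk; rewrite -rM leqNgt => /negP; apply.
by apply: rank_ltmx; rewrite ltmxE addsmxSl /= addsmx_sub submx_refl /=; exact/negP.
Qed.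

(** Hence generating a sigma-algebra from these cylinders adds no new set. *)
Lemma cylinders_over_sigma_algebra (R : realType) (E : normedModType R) n
    (u : 'I_n -> dual E) : sigma_algebra setT (cylinders_over u).
Proof.
split.
- by exists set0; [exact: measurable0|].
- move=> _ [B mB <-]; exists (~` B); first exact: measurableC.
  by rewrite setTD.
- move=> A HA.
  have /choice[B HB] k : exists B : set (borel 'rV[R]_n), measurable B /\ cylinder u B = A k.
    by have [B mB <-] := HA k; exists B.
  exists (\bigcup_k B k).
    by apply: bigcupT_measurable => k; have [] := HB k.
  have -> : A = fun k => cylinder u (B k).
    by apply/funext => k; have [_ ->] := HB k.
  by [].
Qed.

Section Cylindrical_measure_of_random_variable.
Context {d : measure_display} {Omega : measurableType d} {R : realType}.
Variable P : probability Omega R.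
Context {E : normedModType R}.
Variable X : dual E -> Omega -> R.
Hypothesis mX : forall u, measurable_fun setT (X u).
Hypothesis linX : forall (a : R) (u v : dual E),
  \forall w \ae P, X (a *: u + v) w = a * X u w + X v w.

Lemma cylindrical_rv0 : \forall w \ae P, X 0 w = 0.
Proof.
apply: filterS (linX 1 0 0) => w; rewrite scaler0 addr0 mul1r => /esym/eqP.
by rewrite addrC -subr_eq0 addrK => /eqP.
Qed.

Lemma cylindrical_rv_sum n (c : 'I_n -> R) (u : 'I_n -> dual E) :
  \forall w \ae P, X (\sum_i c i *: u i) w = \sum_i c i * X (u i) w.
Proof.
elim: n c u => [|n IH] c u.
  by apply: filterS cylindrical_rv0 => w; rewrite !big_ord0.
rewrite big_ord_recl.
apply: filterS2 (linX (c ord0) (u ord0) (\sum_(i < n) c (lift ord0 i) *: u (lift ord0 i)))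
  (IH (fun i => c (lift ord0 i)) (fun i => u (lift ord0 i))) => w -> ->.
by rewrite big_ord_recl.
Qed.

Let range_row n (u : 'I_n -> dual E) := [set p : 'rV[R]_n | exists x, p = \row_i u i x].

(* Linear relations between the [u i] hold almost surely between the [X (u i)]. *)
Let measurable_range n (u : 'I_n -> dual E) :
  @measurable _ (borel 'rV[R]_n) (range_row u) /\
  \forall w \ae P, range_row u (\row_i X (u i) w).
Proof.
have [||M HM] := @submodule_rowspace R n (range_row u).
- by exists 0; apply/rowP => i; rewrite !mxE dual0.
- move=> a _ _ [x ->] [y ->]; exists (a *: x + y); apply/rowP => i.
  by rewrite !mxE dual_linear.
pose C := cokermx M.
have clin j : continuous (fun p : 'rV[R]_n => \sum_i C i j * p 0 i).
  elim: (index_enum _) => [|k r IH] p.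
    under eq_fun do rewrite big_nil; exact: cst_continuous.
  under eq_fun do rewrite big_cons.
  have h : {for p, continuous (fun x : 'rV[R]_n => C k j * x 0 k)}.
    by apply: continuousM; [exact: cst_continuous|exact: coord_continuous].
  exact: (continuousD h (IH p)).
have rowC (p : 'rV[R]_n) : range_row u p <-> forall j, \sum_i C i j * p 0 i = 0.
  rewrite HM submxE -/C; split.
    move=> /eqP/rowP H j; have := H j; rewrite mxE [RHS]mxE => Hj; rewrite -[RHS]Hj.
    by apply: eq_bigr => i _; rewrite mulrC.
  move=> H; apply/eqP/rowP => j; rewrite mxE [RHS]mxE -[RHS](H j).
  by apply: eq_bigr => i _; rewrite mulrC.
split.
  have -> : range_row u = \bigcap_(j in setT) [set p | \sum_i C i j * p 0 i = 0].
    by apply/seteqP; split=> p; rewrite rowC => H j; [move=> _|]; exact: H.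
  apply: fin_bigcap_measurable => [|j _]; first exact: finite_finset.
  apply: closed_borel_measurable.
  apply: (@preimage_closed 'rV[R]_n R (fun p => \sum_i C i j * p 0 i) [set 0]);
    last exact: closed_eq.
  by move=> p _; exact: clin.
have Z j : \sum_i C i j *: u i = 0.
  apply: val_inj; apply/funext => x /=.
  have [/(_ _) H _] := rowC (\row_i u i x).
  transitivity (\sum_i C i j * (\row_i u i x) 0 i); last by apply: H; exists x.
  by rewrite sum_dualE; apply: eq_bigr => i _; rewrite mxE.
have : \forall w \ae P, forall j, \sum_i C i j * X (u i) w = 0.
  apply: filter_forall => j.
  apply: filterS2 cylindrical_rv0 (cylindrical_rv_sum (C ^~ j) u) => w.
  by rewrite Z => -> <-.
apply: filterS => w H; apply/rowC => j; rewrite -[RHS](H j).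
by apply: eq_bigr => i _; rewrite mxE.
Qed.

Let mrow n (u : 'I_n -> dual E) (B : set (borel 'rV[R]_n)) : measurable B ->
  measurable [set w | B (\row_i X (u i) w)].
Proof.
by move=> mB; rewrite -[X in measurable X]setTI; apply: measurable_row.
Qed.

(** Finitely many functionals can always be realised by a random point: pick a preimage of the row
    whenever it lies in the range. The choice of preimages is arbitrary, but on cylinders over [u]
    the point matters only through the row, which gives measurability. *)
Let sample n (u : 'I_n -> dual E) : exists S : Omega -> E,
  (forall (B : set (borel 'rV[R]_n)), measurable B -> measurable (S @^-1` (cylinder u B))) /\
  \forall w \ae P, forall i, u i (S w) = X (u i) w.
Proof.
have [mL aeL] := measurable_range u.
pose L := range_row u.
have /choice[s Hs] (p : 'rV[R]_n) : exists x, (L p -> p = \row_i u i x) /\ (~ L p -> x = 0).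
  have [[x px]|nL] := pselect (L p); last by exists 0.
  by exists x; split=> // nL; case: nL; exists x.
exists (fun w => s (\row_i X (u i) w)); split.
  move=> B mB.
  have -> : (fun w => s (\row_i X (u i) w)) @^-1` (cylinder u B) =
     [set w | (L `&` B) (\row_i X (u i) w)] `|`
     ([set w | (~` L) (\row_i X (u i) w)] `&` [set w | B 0]).
    apply/seteqP; split=> w; rewrite /cylinder/=; set p := \row_i X (u i) w.
      have [Lp|nLp] := pselect (L p); first by rewrite -((Hs p).1 Lp); left.
      rewrite ((Hs p).2 nLp) (_ : \row_i u i 0 = 0); first by right.
      by apply/rowP => i; rewrite !mxE dual0.
    move=> [[Lp Bp]|[nLp B0]]; first by rewrite -((Hs p).1 Lp).
    rewrite ((Hs p).2 nLp) (_ : \row_i u i 0 = 0)//.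
    by apply/rowP => i; rewrite !mxE dual0.
  apply: measurableU; first by apply: mrow; exact: measurableI.
  apply: measurableI; first by apply: mrow; exact: measurableC.
  have [B0|nB0] := pselect (B 0).
    by rewrite (_ : [set w | _] = setT)//; apply/seteqP; split.
  by rewrite (_ : [set w | _] = set0)//; apply/seteqP; split.
apply: filterS aeL => w /(Hs _).1 /rowP H i.
by have := H i; rewrite !mxE.
Qed.

(** One set may be a cylinder in two ways. A random point that realises both families at once lies
    in it or not, whichever description is used. *)
Let consistent n m (u : 'I_n -> dual E) (v : 'I_m -> dual E)
    (B : set (borel 'rV[R]_n)) (C : set (borel 'rV[R]_m)) :
  measurable B -> measurable C -> cylinder u B = cylinder v C ->
  P [set w | B (\row_i X (u i) w)] = P [set w | C (\row_i X (v i) w)].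
Proof.
move=> mB mC uv; apply: measure_eq_ae; [exact: mrow|exact: mrow|].
pose q (k : 'I_(n + m)) := match fintype.split k with inl i => u i | inr j => v j end.
have [S [_ aeS]] := sample q.
apply: filterS aeS => w H /=.
have -> : \row_i X (u i) w = \row_i u i (S w).
  apply/rowP => i; rewrite !mxE; have := H (lshift m i).
  by rewrite /q; case: split_ordP => [j /lshift_inj ->//|j /eqP]; rewrite eq_lrshift.
have -> : \row_i X (v i) w = \row_i v i (S w).
  apply/rowP => i; rewrite !mxE; have := H (rshift n i).
  by rewrite /q; case: split_ordP => [j /eqP|j /rshift_inj ->//]; rewrite eq_rlshift.
rewrite -[B _]/(cylinder u B (S w)) uv; exact: iff_refl.
Qed.

Lemma cylindrical_measure_of_rv : exists gamma : set E -> \bar R,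
  cylindrical_measure gamma /\
  forall n (u : 'I_n -> dual E) (B : set (borel 'rV[R]_n)), measurable B ->
    gamma (cylinder u B) = P [set w | B (\row_i X (u i) w)].
Proof.
(* The value on a set that is not cylindrical is 0 by convention. *)
have /choice[gamma Hg] (Z : set E) : exists r : \bar R,
    forall n (u : 'I_n -> dual E) (B : set (borel 'rV[R]_n)), measurable B ->
    Z = cylinder u B -> r = P [set w | B (\row_i X (u i) w)].
  have [[n [u [B [mB ZE]]]]|nZ] := pselect (exists n (u : 'I_n -> dual E)
     (B : set (borel 'rV[R]_n)), measurable B /\ Z = cylinder u B).
    exists (P [set w | B (\row_i X (u i) w)]) => m v C mC ZE'.
    by apply: consistent => //; rewrite -ZE.
  by exists 0%E => n u B mB ZE; case: nZ; exists n, u, B.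
have gE n (u : 'I_n -> dual E) (B : set (borel 'rV[R]_n)) : measurable B ->
    gamma (cylinder u B) = P [set w | B (\row_i X (u i) w)].
  by move=> mB; exact: Hg.
exists gamma; split => // n u.
have [S [mS aeS]] := sample u.
have sC := sigma_algebra_id (cylinders_over_sigma_algebra u).
have mS' : @measurable_fun _ _ Omega (g_sigma_algebraType (cylinders_over u)) setT S.
  move=> _ Z; rewrite /measurable/= sC => -[B mB <-]; rewrite setTI; exact: mS.
exists (measure_function_pushforward__canonical__measure_function_Measure P mS').
move=> Z; rewrite sC => -[B mB <-]; rewrite gE//.
apply: measure_eq_ae; [exact: mrow|exact: mS|].
apply: filterS aeS => w H.
by rewrite /= /cylinder/= (_ : \row_i u i (S w) = \row_i X (u i) w)//;
  apply/rowP => i; rewrite !mxE H.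
Qed.

End Cylindrical_measure_of_random_variable.

Section Raw_integral.
Local Open Scope ereal_scope.
Import HBNNSimple.

(** [char_fun] integrates against a bare set function. Such an integral sees only the values on
    measurable sets, so the set function can be exchanged for a measure that agrees with it
    there. *)
Lemma eq_integral_measurable_sets d (T : measurableType d) (R : realType)
    (m1 m2 : set T -> \bar R) (f : T -> \bar R) :
  (forall A, measurable A -> m1 A = m2 A) ->
  \int[m1]_x f x = \int[m2]_x f x.
Proof.
move=> m12.
have E (h : {nnsfun T >-> R}) : sintegral m1 h = sintegral m2 h.
  by apply: eq_fsbigr => r _; rewrite m12.
rewrite /integral; congr (ereal_sup _ - ereal_sup _);
  by apply/seteqP; split=> _ [h hf <-]; exists h => //; rewrite E.
Qed.

End Raw_integral.

Section Characteristic_function_of_cylindrical_measure.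
Context {R : realType} {E : normedModType R}.
Implicit Types (mu : set E -> \bar R) (f : dual E).

Let cyl1 f := cylinders_over (fun _ : 'I_1 => f).

Let measurable_dual1 f :
  @measurable_fun _ _ (g_sigma_algebraType (cyl1 f)) R setT f.
Proof.
move=> _ D mD; rewrite setTI; apply: sub_sigma_algebra.
exists [set r : 'rV[R]_1 | D (r 0 0)].
  have := @measurable_coord R 1 0 measurableT D mD.
  by rewrite setTI.
by apply/seteqP; split=> x; rewrite /cylinder/= mxE.
Qed.

Lemma cylinder_preimage n (u : 'I_n -> dual E) (c : 'I_n -> R) (D : set R) :
  measurable D ->
  cylinders_over u ((\sum_i c i *: u i : dual E) @^-1` D).
Proof.
move=> mD; exists [set r : 'rV[R]_n | D (\sum_i c i * r 0 i)].
  have mc : @measurable_fun _ _ (borel 'rV[R]_n) R setT (fun r => \sum_i c i * r 0 i).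
    by apply: measurable_sum => i; apply: measurable_funM => //; exact: measurable_coord.
  by have := mc measurableT D mD; rewrite setTI.
apply/seteqP; split=> x; rewrite /cylinder/= sum_dualE;
  by under eq_bigr do rewrite mxE.
Qed.

(** Only the law of [f] is involved, so both integrals are moved to the law of [X] on the line. *)
Lemma char_fun_law mu f d (T : measurableType d) (m : {measure set T -> \bar R})
    (X : T -> R) :
  cylindrical_measure mu -> (m setT < +oo)%E -> measurable_fun setT X ->
  (forall D : set R, measurable D -> mu (f @^-1` D) = m (X @^-1` D)) ->
  char_fun mu f = Complex (Rintegral m setT (fun w => cos (X w)))
                          (Rintegral m setT (fun w => sin (X w))).
Proof.
move=> cmu moo mX muE; have [m1 Hm1] := cmu 1%N (fun=> f).
rewrite /char_fun.
have key (g : R -> R) : continuous g -> (forall x, `|g x| <= 1) ->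
  fine (integral (mu : set (g_sigma_algebraType (cyl1 f)) -> \bar R) setT
    (fun x => (g (f x))%:E)) = Rintegral m setT (g \o X).
  move=> cg g1; have mg := continuous_measurable_fun cg.
  rewrite (eq_integral_measurable_sets (m2 := m1)); last by move=> A mA; rewrite Hm1.
  have mf := @measurable_dual1 f.
  have m1E (D : set R) : measurable D -> m1 (f @^-1` D) = m (X @^-1` D).
    move=> mD; rewrite -muE// Hm1//.
    by have := mf measurableT D mD; rewrite setTI.
  pose m' : {measure set R -> \bar R} :=
    measure_function_pushforward__canonical__measure_function_Measure m mX.
  have m1oo : (m1 setT < +oo)%E by have := m1E setT measurableT; rewrite !preimage_setT => ->.
  transitivity (Rintegral m1 setT (g \o f)); first by [].
  rewrite -(Rintegral_pushforward (m' := m') mf m1oo _ mg g1)//; last first.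
    by move=> B mB; rewrite m1E.
  exact: (Rintegral_pushforward (m' := m') mX moo).
by congr Complex; apply: key; do ?[exact: continuous_cos|exact: continuous_sin];
  move=> x; rewrite ler_norml ?cos_geN1 ?cos_le1 ?sin_geN1 ?sin_le1.
Qed.

End Characteristic_function_of_cylindrical_measure.

Lemma expectation_integral d (T : measurableType d) (R : realType)
    (P : probability T R) (X : T -> R) : 'E_P[X]%E = (\int[P]_w (X w)%:E)%E.
Proof. by rewrite unlock. Qed.

Section Cylindrical_distribution.
Context {d : measure_display} {Omega : measurableType d} {R : realType}.
Variable P : probability Omega R.
Context {U : normedModType R}.
Implicit Types (X : dual U -> {RV P >-> R}) (mu : set U -> \bar R) (u : dual U).

(** Characteristic functions are turned into probabilities of cylinders: over a fixed finite family
    [mu] is a measure, and almost sure linearity of [X] matches the linear combinations required by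
    [charfun_law_eq]. *)
Lemma cylindrical_distribution_law X mu : cylindrical_rv X ->
  cylindrical_distribution X mu ->
  forall n (u : 'I_n -> dual U) (B : set (borel 'rV[R]_n)), measurable B ->
    mu (cylinder u B) = P [set w | B (\row_i X (u i) w)].
Proof.
move=> lX [cmu Xmu] n u B mB.
have Poo : (P setT < +oo)%E by rewrite probability_setT ltry.
have [m Hm] := cmu n u.
have mcyl Z : cylinders_over u Z -> mu Z = m Z.
  by move=> uZ; apply: Hm; exact: sub_sigma_algebra.
rewrite mcyl; last by exists B.
(* The characteristic function at the zero functional is the total mass; an infinite mass is
   excluded because [fine] would send it to 0. *)
have m1 : m setT = 1%E.
  have := Xmu 0 => -[]; rewrite !expectation_integral.
  have [m0 Hm0] := cmu 1%N (fun=> 0).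
  rewrite (eq_integral_measurable_sets (m2 := m0)); last by move=> A mA; rewrite Hm0.
  have cz (x : U) : cos ((0 : dual U) x) = 1 by rewrite (_ : (0 : dual U) x = 0)// cos0.
  have -> : (\int[m0]_x (cos ((0 : dual U) x))%:E = m0 setT)%E.
    transitivity (\int[m0]_x (cst 1%E x))%E; last by rewrite integral_cst// mul1e.
    by apply: eq_integral => x _; rewrite cz.
  have -> : (\int[P]_w (cos (X 0 w))%:E = 1)%E.
    transitivity (\int[P]_w (cst 1%E w))%E; last first.
      by rewrite integral_cst// mul1e; exact: probability_setT.
    apply: ae_eq_integral => //.
      apply/measurable_EFinP; apply: measurableT_comp => //.
      by apply: continuous_measurable_fun; exact: continuous_cos.
    by apply: filterS (cylindrical_rv0 lX) => w -> _; rewrite cos0.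
  have -> : m0 setT = m setT.
    by rewrite -Hm0 ?Hm//; exact: (@measurableT _ (g_sigma_algebraType _)).
  case: (m setT) => [r /= ->//|/esym/eqP|/esym/eqP]; by rewrite oner_eq0.
have mu_i i : @measurable_fun _ _ (g_sigma_algebraType (cylinders_over u)) R setT (u i).
  move=> _ D mD; rewrite setTI; apply: sub_sigma_algebra.
  have := cylinder_preimage u (fun j => (j == i)%:R) mD.
  rewrite (bigD1 i)//= eqxx scale1r big1 ?addr0// => j /negbTE ->.
  by rewrite scale0r.
have moo : (m setT < +oo)%E by rewrite m1 ltry.
apply: charfun_law_eq => //.
move=> a; pose v : dual U := \sum_i a i *: u i.
have vE x : v x = \sum_i a i * u i x by exact: sum_dualE.
have mv : @measurable_fun _ _ (g_sigma_algebraType (cylinders_over u)) R setT v.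
  by move=> _ D mD; rewrite setTI; apply: sub_sigma_algebra; exact: cylinder_preimage.
have := Xmu v; rewrite (char_fun_law (m := m) (X := v) cmu moo mv); last first.
  by move=> D mD; apply: mcyl; exact: cylinder_preimage.
rewrite !expectation_integral => -[cE sE].
have key (g : R -> R) : continuous g ->
  fine (\int[P]_w (g (X v w))%:E)%E = Rintegral P setT (fun w => g (\sum_i a i * X (u i) w)).
  move=> cg; have mg := continuous_measurable_fun cg.
  rewrite /Rintegral; congr fine; apply: ae_eq_integral => //.
  - by apply/measurable_EFinP; exact: measurableT_comp.
  - apply/measurable_EFinP; apply: measurableT_comp => //.
    by apply: measurable_sum => i; exact: measurable_funM.
  - by apply: filterS (cylindrical_rv_sum lX a u) => w -> _.
split.
  rewrite -key; last exact: continuous_cos.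
  by rewrite -cE; congr (Rintegral _ _ _); apply/funext => x; rewrite vE.
rewrite -key; last exact: continuous_sin.
by rewrite -sE; congr (Rintegral _ _ _); apply/funext => x; rewrite vE.
Qed.

End Cylindrical_distribution.

(** * Isonormal processes on a Hilbert space *)

Lemma cvg_sqr (R : realType) (T : Type) (F : set_system T) (f : T -> R) (l : R) :
  Filter F -> f x @[x --> F] --> l -> f x ^+ 2 @[x --> F] --> l ^+ 2.
Proof. by move=> FF fl; rewrite expr2; under eq_fun do rewrite expr2; apply: cvgM. Qed.

Section Inner_product.
Context {R : realType} {H : completeNormedModType R}.
Variable ip : H -> H -> R.
Hypothesis ipP : is_inner_product ip.

Lemma ipC x y : ip x y = ip y x. Proof. by case: ipP. Qed.
Lemma ipDl x y z : ip (x + y) z = ip x z + ip y z.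
Proof. by case: ipP => _ + _ => /(_ 1 x y z); rewrite scale1r mul1r. Qed.
Lemma ip0l z : ip 0 z = 0.
Proof. by have := ipDl 0 0 z; rewrite addr0 => /esym/eqP; rewrite -subr_eq0 addrK => /eqP. Qed.
Lemma ipZl a x z : ip (a *: x) z = a * ip x z.
Proof. by case: ipP => _ + _ => /(_ a x 0 z); rewrite addr0 ip0l addr0. Qed.
Lemma ipDr x y z : ip z (x + y) = ip z x + ip z y.
Proof. by rewrite ipC ipDl !(ipC z). Qed.
Lemma ipZr a x z : ip z (a *: x) = a * ip z x.
Proof. by rewrite ipC ipZl (ipC z). Qed.
Lemma ipxx x : ip x x = `|x| ^+ 2. Proof. by case: ipP. Qed.

Lemma normDsqr x y : `|x + y| ^+ 2 = `|x| ^+ 2 + 2 * ip x y + `|y| ^+ 2.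
Proof. by rewrite -!ipxx ipDl !ipDr (ipC y x); ring. Qed.

Lemma ip_continuous h : continuous (ip ^~ h).
Proof.
have -> : ip ^~ h = fun x => (`|x + h| ^+ 2 - `|x - h| ^+ 2) / 4.
  by apply/funext => x; rewrite !normDsqr normrN -(scaleN1r h) ipZr; field.
move=> x; apply: cvgMl; apply: cvgB.
- by apply: cvg_sqr; apply: cvg_norm; apply: cvgD; [exact: cvg_id|exact: cvg_cst].
- by apply: cvg_sqr; apply: cvg_norm; apply: cvgB; [exact: cvg_id|exact: cvg_cst].
Qed.

Lemma riesz_representation (f : dual H) : exists h, forall x, f x = ip x h.
Proof.
have fD x y : f (x + y) = f x + f y.
  by have := dual_linear f 1 x y; rewrite !scale1r.
have fZ a x : f (a *: x) = a * f x.
  by have := dual_linear f a x 0; rewrite !addr0 dual0 addr0.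
(* The representing vector minimises [phi]. *)
pose phi x := `|x| ^+ 2 - 2 * f x.
have [C C0 fC] : exists2 C : R, 0 < C & forall x, f x <= C * `|x|.
  have := @dual_continuous _ _ f 0 => /cvgrPdist_lt/(_ 1 ltr01).
  move=> /nbhs_ballP[e /= e0 He].
  exists (2 / e); first by rewrite divr_gt0.
  move=> x; have [->|x0] := eqVneq x 0; first by rewrite dual0 normr0 mulr0.
  have nx : 0 < `|x| by rewrite normr_gt0.
  have := He ((e / 2 / `|x|) *: x).
  rewrite -ball_normE/= sub0r normrN normrZ gtr0_norm ?divr_gt0//.
  rewrite divfK ?gt_eqF// gtr_pMr// invf_lt1// ltr1n => /(_ isT).
  rewrite dual0 sub0r normrN fZ => /(le_lt_trans (ler_norm _)).
  rewrite mulrAC ltr_pdivrMr// mul1r => h.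
  have -> : f x = 2 / e * (e / 2 * f x) by field; rewrite gt_eqF.
  by rewrite ler_wpM2l ?ltW// divr_gt0.
have lb x : - C ^+ 2 <= phi x.
  rewrite /phi; have := fC x; have : 0 <= (`|x| - C) ^+ 2 by exact: sqr_ge0.
  by rewrite sqrrB; lra.
have hi : has_inf (range phi).
  by split; [exists (phi 0), 0|exists (- C ^+ 2) => _ [x _ <-]].
pose m := inf (range phi).
have mphi x : m <= phi x by apply: ge_inf; [exact: hi.2|exists x].
have /choice[x xm] k : exists x, phi x < m + k.+1%:R^-1.
  have k0 : 0 < k.+1%:R^-1 :> R by rewrite invr_gt0.
  have [_ [x _ <-] h] := inf_adherent k0 hi.
  by exists x.
(* The parallelogram identity for [phi]: the midpoint has value at least m, which makes a minimising
   sequence Cauchy. *)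
have par y z : `|y - z| ^+ 2 = 2 * phi y + 2 * phi z - 4 * phi (2^-1 *: (y + z)).
  rewrite /phi fZ fD normrZ exprMn !normDsqr normrN -(scaleN1r z) ipZr.
  by rewrite gtr0_norm ?invr_gt0//; field.
have cx : cvg (x @ \oo).
  apply: cauchy_cvg; apply: cauchy_exP => e e0.
  (* By [par] the squared distance is at most 2 / (k + 1) + 2 / (N + 1) <= 4 / (N + 1), whence e^2 /
     4. *)
  have /cvgr_lt/(_ (e ^+ 2 / 4))/(_ _)[|N _ HN] := @cvg_harmonic R.
    by rewrite divr_gt0// exprn_gt0.
  exists (x N), N => // k /= Nk; rewrite -ball_normE/=.
  rewrite -(ltr_pXn2r (n := 2))// ?nnegrE ?(ltW e0)// par.
  have kN : k.+1%:R^-1 <= N.+1%:R^-1 :> R by rewrite lef_pV2 ?posrE// ler_nat.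
  have := HN N (leqnn N); rewrite /harmonic/=.
  have := xm N; have := xm k; have := mphi (2^-1 *: (x N + x k)).
  move: kN; move: (phi _) (phi (x k)) (phi (x N)) => a b c.
  move: (k.+1%:R^-1) (N.+1%:R^-1) => r q; lra.
pose h := lim (x @ \oo).
have phih : phi h <= m.
  have cphi : phi (x k) @[k --> \oo] --> phi h.
    apply: cvgB; first by apply: cvg_sqr; apply: cvg_norm; exact: cx.
    by apply: cvgMr; apply: continuous_cvg; [exact: dual_continuous|exact: cx].
  have cm : m + harmonic k @[k --> \oo] --> m.
    by rewrite -[X in _ --> X]addr0; apply: cvgD; [exact: cvg_cst|exact: cvg_harmonic].
  apply: (ler_cvg_to cphi cm).
  by apply: nearW => k; apply: ltW; exact: xm.
exists h => y.
have var t : 0 <= t ^+ 2 * `|y| ^+ 2 + 2 * t * (ip h y - f y).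
  have := le_trans phih (mphi (h + t *: y)).
  rewrite /phi normDsqr ipZr normrZ exprMn fD fZ.
  by rewrite real_normK ?num_real//; lra.
have D0 : 0 < `|y| ^+ 2 + 1 by rewrite ltr_wpDl// sqr_ge0.
(* The first variation at the minimiser is tested at t = - z. Adding 1 to the denominator avoids a
   case distinction on [y], and the inequality becomes - z^2 (|y|^2 + 2) >= 0. *)
pose z := (ip h y - f y) / (`|y| ^+ 2 + 1).
have zE : ip h y - f y = z * (`|y| ^+ 2 + 1) by rewrite divfK// gt_eqF.
have := var (- z); rewrite zE.
have -> : (- z) ^+ 2 * `|y| ^+ 2 + 2 * - z * (z * (`|y| ^+ 2 + 1)) =
  - (z ^+ 2 * (`|y| ^+ 2 + 2)) by ring.
rewrite oppr_ge0 => zle.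
have : z ^+ 2 = 0.
  apply/eqP; rewrite eq_le sqr_ge0 andbT.
  have y2 : 0 < `|y| ^+ 2 + 2 by rewrite ltr_wpDl// sqr_ge0.
  by rewrite -(pmulr_lle0 _ y2).
move=> /eqP; rewrite sqrf_eq0 => /eqP z0.
by move: zE; rewrite z0 mul0r ipC => /eqP; rewrite subr_eq0 => /eqP.
Qed.

End Inner_product.

Section Isonormal_extension.
Context {d : measure_display} {Omega : measurableType d} {R : realType}.
Variable P : probability Omega R.
Context {V : lmodType R} {H : completeNormedModType R}.
Variables (X : V -> {RV P >-> R}) (J : V -> H).
Hypothesis linX : forall (a : R) (u v : V),
  \forall w \ae P, X (a *: u + v) w = a * X u w + X v w.
Hypothesis linJ : forall (a : R) (u v : V), J (a *: u + v) = a *: J u + J v.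
Hypothesis dJ : dense (range J).
Hypothesis EX : forall u, (\int[P]_w (X u w ^+ 2)%:E = (`|J u| ^+ 2)%:E)%E.
Hypothesis lawX : forall u, normal_law (fun D => P (X u @^-1` D)) 0 (`|J u| ^+ 2).

(** Almost sure limits along one sequence take the place of limits in L^2. By [Lim_linear], another
    choice of the sequence changes [Z] only on a null set. *)
Let Lim (h : H) (Z : Omega -> R) := measurable_fun setT Z /\
  exists u : nat -> V, J (u k) @[k --> \oo] --> h /\
    \forall w \ae P, X (u k) w @[k --> \oo] --> Z w.

Let mX2 u : measurable_fun setT (fun w => (X u w ^+ 2)%:E).
Proof. by apply/measurable_EFinP; exact: measurable_funX. Qed.

(* Fatou. *)
Let ae_lim0 (v : nat -> V) (D : Omega -> R) : measurable_fun setT D ->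
  J (v k) @[k --> \oo] --> 0 ->
  (\forall w \ae P, X (v k) w @[k --> \oo] --> D w) ->
  \forall w \ae P, D w = 0.
Proof.
move=> mD Jv vD.
have mD2 : measurable_fun setT (fun w => (D w ^+ 2)%:E).
  by apply/measurable_EFinP; exact: measurable_funX.
have i0 : (\int[P]_w (D w ^+ 2)%:E <= 0)%E.
  have -> : (\int[P]_w (D w ^+ 2)%:E =
      \int[P]_w limn_einf (fun k => (X (v k) w ^+ 2)%:E))%E.
    apply: ae_eq_integral => //.
      rewrite (_ : (fun w => _) = (fun w => - limn_esup (-%E \o
          (fun k => (X (v k) w ^+ 2)%:E)))%E); last first.
        by apply/funext => w; rewrite limn_esupN oppeK.
      apply: measurableT_comp => //; apply: measurable_fun_limn_esup => k.
      by apply: measurableT_comp => //; exact: mX2.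
    apply: filterS vD => w Xw _.
    have C : (X (v k) w ^+ 2)%:E @[k --> \oo] --> (D w ^+ 2)%:E.
      by apply: cvg_EFin; [exact: nearW|exact: cvg_sqr].
    by rewrite (cvg_limn_einf_sup C).1.
  apply: (le_trans (fatou P measurableT _ _)) => //.
    by move=> k w _; rewrite lee_fin sqr_ge0.
  have C : (\int[P]_w (X (v k) w ^+ 2)%:E)%E @[k --> \oo] --> (`|0 : H| ^+ 2)%:E.
    under eq_fun do rewrite EX.
    apply: cvg_EFin; first exact: nearW.
    by apply: cvg_sqr; exact: cvg_norm.
  by rewrite (cvg_limn_einf_sup C).1 normr0 expr0n.
have : (\int[P]_w `|(D w ^+ 2)%:E| = 0)%E.
  apply/eqP; rewrite eq_le; apply/andP; split; last exact: integral_ge0.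
  by under eq_integral do rewrite gee0_abs ?lee_fin ?sqr_ge0//.
move=> /(ae_eq_integral_abs P measurableT mD2).1.
by apply: filterS => w /(_ I)[] /eqP; rewrite sqrf_eq0 => /eqP.
Qed.

Let aeX (a : R) (u v : nat -> V) :
  \forall w \ae P, forall k, X (a *: u k + v k) w = a * X (u k) w + X (v k) w.
Proof. by apply: ae_foralln => k; exact: linX. Qed.

Let Lim_linear (a : R) h h' Z Z' Z'' :
  Lim h Z -> Lim h' Z' -> Lim (a *: h + h') Z'' ->
  \forall w \ae P, Z'' w = a * Z w + Z' w.
Proof.
move=> [mZ [u [Ju uZ]]] [mZ' [u' [Ju' uZ']]] [mZ'' [u'' [Ju'' uZ'']]].
(* The images of [v] tend to 0, while its variables tend almost surely to the defect of linearity,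
   which [ae_lim0] then kills. *)
pose v k := -1 *: (a *: u k + u' k) + u'' k.
have mD : measurable_fun setT (fun w => Z'' w - (a * Z w + Z' w)).
  apply: measurable_funB => //; apply: measurable_funD => //.
  exact: measurable_funM.
have := ae_lim0 (v := v) mD; case.
- rewrite -(subrr (a *: h + h')).
  under eq_fun do rewrite /v linJ scaleN1r linJ addrC.
  have A1 : a *: J (u k) @[k --> \oo] --> a *: h by exact: cvgZl_tmp.
  exact: (cvgB Ju'' (cvgD A1 Ju')).
- have e1 := aeX (-1) (fun k => a *: u k + u' k) u''.
  have e2 := aeX a u u'.
  near=> w.
  have w1 : forall k, X (v k) w = X (u'' k) w - (a * X (u k) w + X (u' k) w).
    move=> k; have -> : X (v k) w = -1 * X (a *: u k + u' k) w + X (u'' k) w.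
      by move: k; near: w.
    have -> : X (a *: u k + u' k) w = a * X (u k) w + X (u' k) w.
      by move: k; near: w.
    by rewrite mulN1r addrC.
  under eq_fun do rewrite w1.
  apply: cvgB; first by near: w.
  by apply: cvgD; [apply: cvgMr; near: w|near: w].
- move=> N [mN N0 sN]; exists N; split => // w nw; apply: sN => /= e; apply: nw.
  by apply/eqP; rewrite -subr_eq0 e.
Unshelve. all: by end_near.
Qed.

Let Lim_cos h Z b : Lim h Z ->
  Rintegral P setT (fun w => cos (Z w + b)) = cos b * expR (- (`|h| ^+ 2 / 2)).
Proof.
move=> [mZ [u [Ju uZ]]].
have Poo : (P setT < +oo)%E by rewrite probability_setT ltry.
have mcos : measurable_fun setT (fun x : R => cos (x + b)).
  apply: measurableT_comp; last exact: measurable_funD.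
  by apply: continuous_measurable_fun; exact: continuous_cos.
have mc k : measurable_fun setT (fun w => cos (X (u k) w + b)).
  exact: (measurableT_comp mcos (@measurable_funPT _ _ _ _ (X (u k)))).
have intc k : (\int[P]_w (cos (X (u k) w + b))%:E =
    (cos b * expR (- (`|J (u k)| ^+ 2 / 2)))%:E)%E.
  have := normal_law_cos 1 b (@measurable_funPT _ _ _ _ (X (u k))) (lawX (u k)).
  rewrite expr1n mul1r => <- //; rewrite /Rintegral fineK.
    by apply: eq_integral => w _; rewrite mul1r.
  apply: (integrable_fin_num measurableT).
  apply: (@bounded_integrable _ _ _ _ _ 1).
  - exact: Poo.
  - rewrite (_ : (fun w => _) = (fun w => cos (X (u k) w + b))); first exact: mc.
    by apply/funext => w; rewrite mul1r.
  - by move=> w; rewrite ler_norml cos_geN1 cos_le1.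
have [|||||_ _ C] := @dominated_convergence _ _ R P setT measurableT
  (fun k w => (cos (X (u k) w + b))%:E) (fun w => (cos (Z w + b))%:E) (cst 1%E).
- by move=> k; apply/measurable_EFinP; exact: mc.
- by apply/measurable_EFinP; exact: (measurableT_comp mcos mZ).
- apply: filterS uZ => w uw _; apply: cvg_EFin; first exact: nearW.
  apply: continuous_cvg; first exact: continuous_cos.
  by apply: cvgD => //; exact: cvg_cst.
- by apply: (@bounded_integrable _ _ _ P (cst 1) 1) => // w; rewrite normr1.
- by apply: aeW => w k _; rewrite /= lee_fin ler_norml cos_geN1 cos_le1.
have C' : (\int[P]_w (cos (X (u k) w + b))%:E)%E @[k --> \oo] -->
    (cos b * expR (- (`|h| ^+ 2 / 2)))%:E.
  under eq_fun do rewrite intc.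
  apply: cvg_EFin; first exact: nearW.
  apply: cvgMr; apply: continuous_cvg; first exact: continuous_expR.
  by apply: cvgN; apply: cvgMl; apply: cvg_sqr; exact: cvg_norm.
by rewrite /Rintegral -(cvg_lim _ C)// (cvg_lim _ C').
Qed.

(* [|x| <= e + x^2/e] with [e = 2^-k] turns the summable variances of the
   increments into almost surely summable increments. *)
Let Lim_exists h : exists Z, Lim h Z.
Proof.
(* With the rate 4^-k the variances of the increments are at most 4 * 16^-k; even after
   multiplication by 2^k they are at most 4 * 8^-k, which is summable. *)
have /choice[u Hu] k : exists u, `|h - J u| < 4^-1 ^+ k.
  have e0 : (0 : R) < 4^-1 ^+ k by rewrite exprn_gt0.
  have [||y [By [u _ uy]]] := dJ (O := ball h (4^-1 ^+ k)).
  - by exists h; exact: ballxx.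
  - exact: ball_open.
  by exists u; move: By; rewrite -ball_normE/= -uy.
have cJ : J (u k) @[k --> \oo] --> h.
  apply/cvgrPdist_lt => e e0; near=> k.
  apply: (lt_trans (Hu k)).
  near: k; have : 4^-1 ^+ n @[n --> \oo] --> (0 : R).
    by apply: cvg_expr; rewrite ger0_norm// invf_lt1// ltr1n.
  by move=> /cvgr_lt; exact.
pose D k w := X (u k.+1) w - X (u k) w.
have mD k : measurable_fun setT (D k) by exact: measurable_funB.
pose g k w := (2 ^+ k * D k w ^+ 2)%:E.
have mg k : measurable_fun setT (g k).
  by apply/measurable_EFinP; apply: measurable_funM => //; exact: measurable_funX.
have g0 k w : (0 <= g k w)%E by rewrite lee_fin; apply: mulr_ge0; [exact: exprn_ge0|exact: sqr_ge0].
have intD k : (\int[P]_w (D k w ^+ 2)%:E = (`|J (u k.+1) - J (u k)| ^+ 2)%:E)%E.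
  have -> : J (u k.+1) - J (u k) = J (-1 *: u k + u k.+1).
    by rewrite linJ scaleN1r addrC.
  rewrite -EX; apply: ae_eq_integral => //.
    by apply/measurable_EFinP; exact: measurable_funX.
  by apply: filterS (linX (-1) (u k) (u k.+1)) => w -> _; rewrite mulN1r addrC.
have intg k : (\int[P]_w g k w <= (8 / (2 ^ k.+1)%:R)%:E)%E.
  rewrite /g; under eq_integral do rewrite EFinM.
  have mD2 : measurable_fun setT (fun w => (D k w ^+ 2)%:E).
    by apply/measurable_EFinP; exact: measurable_funX.
  rewrite ge0_integralZl_EFin//; last by move=> w _; rewrite lee_fin sqr_ge0.
  rewrite intD -EFinM lee_fin.
  have n2 : `|J (u k.+1) - J (u k)| <= 2 * 4^-1 ^+ k.
    have := Hu k; have := Hu k.+1; rewrite exprS.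
    have : `|J (u k.+1) - J (u k)| <= `|h - J (u k.+1)| + `|h - J (u k)|.
      have -> : J (u k.+1) - J (u k) = (h - J (u k)) - (h - J (u k.+1)).
        by rewrite opprB [RHS]addrC addrA subrK.
      by rewrite [leRHS]addrC ler_normB.
    have : (0 : R) < 4^-1 ^+ k by rewrite exprn_gt0.
    by lra.
  apply: (@le_trans _ _ (2 ^+ k * (2 * 4^-1 ^+ k) ^+ 2)).
    by rewrite ler_wpM2l ?exprn_ge0// lerXn2r ?nnegrE// mulr_ge0 ?exprn_ge0 ?invr_ge0.
  have -> : (8 : R) / (2 ^ k.+1)%:R = 4 * 2^-1 ^+ k.
    by rewrite natrX exprS exprVn; field; rewrite expf_neq0.
  have -> : 2 ^+ k * (2 * 4^-1 ^+ k) ^+ 2 = 4 * 8^-1 ^+ k :> R.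
    rewrite exprMn mulrCA -exprM mulnC exprM -exprMn; congr (_ * _ ^+ _); first by ring.
    by field.
  by rewrite ler_wpM2l// lerXn2r ?nnegrE ?invr_ge0// lef_pV2 ?posrE// ler_nat.
pose S w := (\sum_(0 <= k <oo) g k w)%E.
have mS : measurable_fun setT S by exact: ge0_emeasurable_sum.
have S0 w : (0 <= S w)%E by apply: nneseries_ge0 => k _ _; exact: g0.
have intS : P.-integrable setT S.
  apply/integrableP; split=> //.
  under eq_integral do rewrite gee0_abs//.
  rewrite /S integral_nneseries//.
  apply: (@le_lt_trans _ _ (\sum_(0 <= k <oo) (8 / (2 ^ k.+1)%:R)%:E)%E).
    apply: lee_nneseries; last by move=> *; exact: intg.
    by move=> *; apply: integral_ge0 => w _; exact: g0.
  by apply: le_lt_trans (epsilon_trick0 xpredT _) (ltry _).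
(* An upper limit is defined and measurable everywhere, and it is the limit wherever the sequence
   converges. *)
pose Z w := fine (limn_esup (fun k => (X (u k) w)%:E)).
exists Z; split.
  apply: measurableT_comp => //; apply: measurable_fun_limn_esup => k.
  exact/measurable_EFinP.
exists u; split=> //.
apply: filterS (integrable_ae measurableT intS) => w /(_ I) Sfin.
have sE (W : zmodType) (f : nat -> W) n : series f n = \sum_(0 <= k < n) f k by [].
have cD : cvgn (series (fun k => D k w : R^o)).
  apply: normed_cvg; apply: nondecreasing_is_cvgn.
    apply/nondecreasing_seqP => n.
    change (\sum_(0 <= k < n) `|D k w| <= \sum_(0 <= k < n.+1) `|D k w|).
    by rewrite big_nat_recr//= lerDl.
  exists (2 + fine (S w)) => _ [n _ <-].
  change (\sum_(0 <= k < n) `|D k w| <= 2 + fine (S w)).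
  apply: (@le_trans _ _ (\sum_(0 <= k < n) (2^-1 ^+ k + 2 ^+ k * D k w ^+ 2))).
    apply: ler_sum => k _; have : 0 < (2 : R) ^+ k by rewrite exprn_gt0.
    rewrite exprVn; set a := 2 ^+ k => a0.
    have : 0 <= (a * `|D k w| - 2^-1) ^+ 2 / a by rewrite divr_ge0 ?sqr_ge0// ltW.
    have -> : (a * `|D k w| - 2^-1) ^+ 2 / a =
        a * `|D k w| ^+ 2 - `|D k w| + a^-1 / 4 by field; rewrite gt_eqF.
    rewrite real_normK ?num_real//.
    have : 0 < a^-1 by rewrite invr_gt0.
    by lra.
  rewrite big_split/=; apply: lerD.
    elim: n => [|n IH]; first by rewrite big_nil.
    have E : forall n, \sum_(0 <= k < n) 2^-1 ^+ k = 2 - 2 * 2^-1 ^+ n :> R.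
      elim=> [|m IHm]; first by rewrite big_nil expr0; ring.
      by rewrite big_nat_recr//= IHm exprS; field.
    by rewrite E gerBl mulr_ge0// exprn_ge0// invr_ge0.
  rewrite -lee_fin fineK// -sumEFin.
  by apply: nneseries_lim_ge => k _ _; exact: g0.
have Xw n : X (u n) w = X (u 0%N) w + series (fun k => D k w : R^o) n.
  elim: n => [|n IH]; first by rewrite sE big_nil addr0.
  by rewrite sE big_nat_recr//= addrA -[X in _ = X + _]IH /D addrCA subrr addr0.
have cX : X (u n) w @[n --> \oo] -->
    X (u 0%N) w + limn (series (fun k => D k w : R^o)).
  under eq_fun do rewrite Xw.
  by apply: cvgD; [exact: cvg_cst|exact: cD].
have C : (X (u n) w)%:E @[n --> \oo] -->
    (X (u 0%N) w + limn (series (fun k => D k w : R^o)))%:E.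
  by apply: cvg_EFin; [exact: nearW|exact: cX].
by rewrite /Z (cvg_limn_einf_sup C).2.
Unshelve. all: by end_near.
Qed.

Variable ip : H -> H -> R.
Hypothesis ipP : is_inner_product ip.

(** The process is indexed by the dual through the Riesz vector, because a cylindrical random
    variable in [H] acts on functionals. The constant sequence shows that [X u] is a limit at [J u],
    so [Z] extends [X]. *)
Lemma isonormal_extension : exists Z : dual H -> Omega -> R,
  [/\ forall f, measurable_fun setT (Z f),
     forall (a : R) f g, \forall w \ae P, Z (a *: f + g) w = a * Z f w + Z g w,
     forall (f : dual H) u, (forall x, f x = ip x (J u)) -> \forall w \ae P, Z f w = X u w &
     forall (f : dual H) h b, (forall x, f x = ip x h) ->
       Rintegral P setT (fun w => cos (Z f w + b)) =
       cos b * expR (- (`|h| ^+ 2 / 2))].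
Proof.
have /choice[r Hr] := riesz_representation ipP.
have rU (f : dual H) h : (forall x, f x = ip x h) -> r f = h.
  move=> fh; apply/eqP; rewrite -subr_eq0 -normr_eq0 -sqrf_eq0 -(ipxx ipP).
  rewrite -scaleN1r ipDr// ipZr// mulN1r subr_eq0.
  by rewrite -Hr -fh.
have rl a f g : r (a *: f + g) = a *: r f + r g.
  apply: rU => x; rewrite ipDr// ipZr// -!Hr.
  by rewrite /=.
have /choice[Z HZ] := fun f => Lim_exists (r f).
exists Z; split.
- by move=> f; case: (HZ f).
- by move=> a f g; apply: Lim_linear (HZ f) (HZ g) _; rewrite -rl.
- move=> f u /rU rf; have := HZ f; rewrite rf => LZ.
  have LX : Lim (J u) (X u).
    by split=> //; exists (fun=> u); split; [exact: cvg_cst|apply: aeW => w; exact: cvg_cst].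
  have LX0 : Lim (0 *: J u + J u) (Z f) by rewrite scale0r add0r.
  by apply: filterS (Lim_linear LX LX LX0) => w ->; rewrite mul0r add0r.
- by move=> f h b /rU rf; have := HZ f; rewrite rf; exact: Lim_cos.
Qed.

End Isonormal_extension.

(** * Cylindrical Wiener processes *)

Lemma eq_normal_law (R : realType) (mu mu' : set R -> \bar R) (m v : R) :
  (forall D : set R, measurable D -> mu' D = mu D) ->
  normal_law mu m v -> normal_law mu' m v.
Proof. by move=> E [v0 H]; split => // D mD; rewrite E// H. Qed.

Section Cylinders.
Context {R : realType} {U : normedModType R}.

Lemma measurable_cylinder n (u : 'I_n -> dual U) (B : set (borel 'rV[R]_n)) :
  measurable B -> @measurable _ (borel U) (cylinder u B).
Proof.
move=> mB.
have mu i : @measurable_fun _ _ (borel U) R setT (u i).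
  by apply: continuous_borel_measurable; exact: dual_continuous.
have := @measurable_row R _ (borel U) n (fun i => u i : borel U -> R) mu measurableT B mB.
by rewrite setTI.
Qed.

Lemma dual_preimage_cylinder (f : dual U) (D : set R) : measurable D ->
  exists2 B : set (borel 'rV[R]_1), measurable B &
    cylinder (fun=> f) B = f @^-1` D /\ forall x : R, B (\row__ x) = D x.
Proof.
move=> mD; exists [set r : 'rV[R]_1 | D (r 0 0)].
  by have := @measurable_coord R 1 0 measurableT D mD; rewrite setTI.
split=> [|x]; last by rewrite /= mxE.
by apply/seteqP; split=> x; rewrite /cylinder/= mxE.
Qed.

(** Restricting to initial segments of one sequence puts any two such cylinders over a common
    segment. *)
Definition initial_cylinder (u : nat -> dual U) : set (set U) :=
  [set Z | exists n, cylinders_over (fun i : 'I_n => u i) Z].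

Lemma initial_cylinder_widen (u : nat -> dual U) n m Z : (n <= m)%N ->
  cylinders_over (fun i : 'I_n => u i) Z -> cylinders_over (fun i : 'I_m => u i) Z.
Proof.
move=> nm [B mB <-].
exists [set r : 'rV[R]_m | B (\row_(i < n) r 0 (widen_ord nm i))].
  have mc (i : 'I_n) : @measurable_fun _ _ (borel 'rV[R]_m) R setT
      (fun r => r 0 (widen_ord nm i)) by exact: measurable_coord.
  by have := @measurable_row R _ (borel 'rV[R]_m) n _ mc measurableT B mB; rewrite setTI.
rewrite /cylinder; apply/seteqP; split=> x /=;
  by congr (B _); apply/rowP => i; rewrite !mxE.
Qed.

Lemma initial_cylinder_setI (u : nat -> dual U) : setI_closed (initial_cylinder u).
Proof.
move=> A B [n nA] [m mB]; exists (maxn n m).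
have [C mC <-] := initial_cylinder_widen (leq_maxl n m) nA.
have [D mD <-] := initial_cylinder_widen (leq_maxr n m) mB.
by exists (C `&` D); [exact: measurableI|].
Qed.

Lemma initial_cylinder_generates (u : nat -> dual U) : separable U ->
  (forall n x, u n x <= `|x|) ->
  (forall x r, 0 <= r -> (forall n, u n x <= r) -> `|x| <= r) ->
  forall A : set (borel U), measurable A -> <<s initial_cylinder u >> A.
Proof.
move=> sU ux xu.
apply: (@borel_generated R U nat (fun n => u n)) => //.
- by move=> n x y; exact: dualB.
- move=> n c; apply: sub_sigma_algebra; exists n.+1.
  exists [set r : 'rV[R]_n.+1 | r 0 ord_max <= c].
    have := @measurable_coord R n.+1 ord_max measurableT `]-oo, c]%classic.
    rewrite setTI => /(_ (measurable_itv _)).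
    by rewrite (_ : _ @^-1` _ = [set r : 'rV[R]_n.+1 | r 0 ord_max <= c])//;
      apply/seteqP; split=> r /=; rewrite in_itv.
  by apply/seteqP; split=> x; rewrite /cylinder/= mxE.
Qed.

Lemma initial_cylinder_measurable (u : nat -> dual U) A :
  initial_cylinder u A -> @measurable _ (borel U) A.
Proof. by move=> [n [B mB <-]]; exact: measurable_cylinder. Qed.

Lemma initial_cylinderT (u : nat -> dual U) : initial_cylinder u setT.
Proof. by exists 0%N; exists setT; [exact: measurableT|]. Qed.

End Cylinders.

Section Random_elements.
Context {d : measure_display} {Omega : measurableType d} {R : realType}.
Variable P : probability Omega R.
Context {U : normedModType R}.
Hypothesis sU : separable U.

Lemma measurable_random_element (Y : Omega -> U) :
  (forall u : dual U, measurable_fun setT (fun w => u (Y w))) ->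
  @measurable_fun _ _ Omega (borel U) setT Y.
Proof.
move=> mY _ B mB; rewrite setTI.
have [u [ux xu]] := norming_sequence sU.
apply: (@borel_generated R U nat (fun n => u n) (fun B => measurable (Y @^-1` B))) => //.
- by move=> n x y; exact: dualB.
- split=> [|A mA|A mA].
  + by rewrite preimage_set0.
  + rewrite setTD preimage_setC; exact: measurableC.
  + rewrite preimage_bigcup; exact: bigcupT_measurable.
- move=> n c; have := mY (u n) measurableT `]-oo, c]%classic (measurable_itv _).
  rewrite setTI (_ : _ @^-1` _ = Y @^-1` [set x | u n x <= c])//.
Qed.

Lemma measurable_dual_random_element (Y : Omega -> U) (u : dual U) :
  @measurable_fun _ _ Omega (borel U) setT Y -> measurable_fun setT (fun w => u (Y w)).
Proof.
move=> mY; apply: (@measurableT_comp _ _ _ _ (borel U) R u setT Y) => //.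
by apply: continuous_borel_measurable; exact: dual_continuous.
Qed.

(* One factor at a time, from cylinders to Borel sets. *)
Lemma independence_from_cylinders (u : nat -> dual U) n (D : nat -> Omega -> U) :
  (forall m x, u m x <= `|x|) ->
  (forall x r, 0 <= r -> (forall n, u n x <= r) -> `|x| <= r) ->
  (forall i, @measurable_fun _ _ Omega (borel U) setT (D i)) ->
  (forall A : nat -> set U, (forall i, initial_cylinder u (A i)) ->
    P (\bigcap_(i < n) D i @^-1` A i) = (\prod_(i < n) P (D i @^-1` A i))%E) ->
  forall A : nat -> set (borel U), (forall i, measurable (A i)) ->
    P (\bigcap_(i < n) D i @^-1` A i) = (\prod_(i < n) P (D i @^-1` A i))%E.
Proof.
move=> ux xu mD cylA.
have mE i (B : set (borel U)) : measurable B -> measurable (D i @^-1` B).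
  by move=> mB; rewrite -[_ @^-1` _]setTI; exact: mD.
(* The first k factors are already Borel, the remaining ones are still cylinders. *)
suff claim k : (k <= n)%N -> forall A : nat -> set (borel U),
    (forall i, measurable (A i)) ->
    (forall i, (k <= i < n)%N -> initial_cylinder u (A i)) ->
    P (\bigcap_(i < n) D i @^-1` A i) = (\prod_(i < n) P (D i @^-1` A i))%E.
  by move=> A mA; apply: (claim n) => // i /andP[ni /(leq_ltn_trans ni)]; rewrite ltnn.
elim: k => [_ A mA cA|k IH kn A mA cA].
  pose A' i := if (i < n)%N then A i else setT.
  have := cylA A' _; rewrite (_ : \bigcap_(i < n) _ = \bigcap_(i < n) D i @^-1` A i).
    move=> ->; last first.
      move=> i; rewrite /A'; case: ifPn => [ni|_]; first exact: cA.
      exact: initial_cylinderT.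
    by apply: eq_bigr => i _; rewrite /A' ltn_ord.
  by apply: eq_bigcapr => i /= ni; rewrite /A' ni.
pose k' : 'I_n := Ordinal kn.
have nk (i : 'I_n) : i != k' -> (nat_of_ord i == k) = false by move=> /negbTE <-.
pose M := \big[setI/setT]_(i < n | i != k') (D i @^-1` A i).
have mM : measurable M.
  by apply: big_ind => //; [exact: measurableI|move=> i _; exact: mE].
pose c := (\prod_(i < n | i != k') fine (P (D i @^-1` A i))).
have c0 : 0 <= c by apply: prodr_ge0 => i _; exact: fine_ge0.
have split1 (B : set (borel U)) : measurable B ->
   let A' i := if i == k then B else A i in
   P (\bigcap_(i < n) D i @^-1` A' i) = P ((D k @^-1` B) `&` M) /\
   (\prod_(i < n) P (D i @^-1` A' i) = c%:E * P (D k @^-1` B))%E.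
  move=> mB A'; split.
    rewrite bigcap_mkord (bigD1 k')//= {1}/A' eqxx; congr (P (_ `&` _)).
    by apply: eq_bigr => i ik; rewrite /A' (nk _ ik).
  rewrite (bigD1 k')//= {1}/A' eqxx muleC; congr (_ * _)%E.
  rewrite /c -prodEFin; apply: eq_bigr => i ik.
  by rewrite /A' (nk _ ik) fineK// fin_num_measure//; exact: mE.
(* As functions of the k-th set alone, both sides are finite measures: the law of [D k] restricted
   to the event [M], and its law times the product c of the other probabilities. They agree on a
   pi-system by induction. *)
pose m1 : {measure set (borel U) -> \bar R} :=
  measure_function_pushforward__canonical__measure_function_Measure (mrestr P mM) (mD k).
pose m2 : {measure set (borel U) -> \bar R} :=
  mscale (NngNum c0) (measure_function_pushforward__canonical__measure_function_Measure P (mD k)).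
have m12 (B : set (borel U)) : initial_cylinder u B -> m1 B = m2 B.
  move=> cB; have mB := initial_cylinder_measurable cB.
  have [s1 s2] := split1 B mB.
  have := IH (ltnW kn) (fun i => if i == k then B else A i).
  rewrite s1 s2 => H; apply: H.
    by move=> i; case: ifP.
  move=> i /andP[ki iN]; case: ifPn => // ik.
  by apply: cA; rewrite iN andbT ltn_neqAle eq_sym ik.
have : m1 (A k) = m2 (A k).
  apply: (@g_sigma_algebra_measure_unique _ R (borel U) (initial_cylinder u) _ (fun=> setT) _ _ m1 m2) => //.
  - by move=> B; exact: initial_cylinder_measurable.
  - by move=> _; exact: initial_cylinderT.
  - by rewrite bigcup_const//; exists 0%N.
  - exact: initial_cylinder_setI.
  - move=> _; rewrite /= /pushforward/= /mrestr/= preimage_setT setTI.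
    by apply: le_lt_trans (probability_le1 P mM) (ltry _).
  - exact: initial_cylinder_generates.
move=> m12k; rewrite bigcap_mkord [in LHS](bigD1 k')//= [in RHS](bigD1 k')//= [RHS]muleC.
have -> : (\prod_(i < n | i != k') P (D i @^-1` A i) = c%:E)%E.
  rewrite /c -prodEFin; apply: eq_bigr => i ik.
  by rewrite fineK// fin_num_measure//; exact: mE.
exact: m12k.
Qed.

Lemma law_from_cylinders (u : nat -> dual U) (D D' : Omega -> U) :
  (forall m x, u m x <= `|x|) ->
  (forall x r, 0 <= r -> (forall n, u n x <= r) -> `|x| <= r) ->
  @measurable_fun _ _ Omega (borel U) setT D ->
  @measurable_fun _ _ Omega (borel U) setT D' ->
  (forall A, initial_cylinder u A -> P (D @^-1` A) = P (D' @^-1` A)) ->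
  forall A : set (borel U), measurable A -> P (D @^-1` A) = P (D' @^-1` A).
Proof.
move=> ux xu mD mD' DD' A mA.
pose m1 : {measure set (borel U) -> \bar R} :=
  measure_function_pushforward__canonical__measure_function_Measure P mD.
pose m2 : {measure set (borel U) -> \bar R} :=
  measure_function_pushforward__canonical__measure_function_Measure P mD'.
apply: (@g_sigma_algebra_measure_unique _ R (borel U) (initial_cylinder u) _ (fun=> setT) _ _ m1 m2) => //.
- by move=> B; exact: initial_cylinder_measurable.
- by move=> _; exact: initial_cylinderT.
- by rewrite bigcup_const//; exists 0%N.
- exact: initial_cylinder_setI.
- move=> _; rewrite /= /pushforward preimage_setT.
  by rewrite probability_setT ltry.
- exact: initial_cylinder_generates.
Qed.

End Random_elements.

Section Strongly_cylindrical_wiener_process.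
Context {d : measure_display} {Omega : measurableType d} {R : realType}.
Variables (P : probability Omega R) (F : R -> set (set Omega)).
Hypothesis hF : is_filtration F.
Context {U : completeNormedModType R}.
Hypothesis sU : separable U.
Variables (W : R -> dual U -> {RV P >-> R}) (Q : dual U -> U).
Hypothesis hW : strongly_cylindrical_wiener F W Q.

Let linW t : 0 <= t -> cylindrical_rv (W t).
Proof. by case: hW => -[+ _ _] _; exact. Qed.

Let Wrow n (u : 'I_n -> dual U) t w : 'rV[R]_n := \row_i W t (u i) w.

Let mW t u : measurable_fun setT (W t u) := @measurable_funPT _ _ _ _ (W t u).

Lemma wiener_second_moment (u : dual U) : (\int[P]_w (W 1 u w ^+ 2)%:E = (u (Q u))%:E)%E.
Proof.
by case: hW => _ /(_ u u) ->; rewrite expectation_integral.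
Qed.

Lemma wiener_covariance_sym (u v : dual U) : v (Q u) = u (Q v).
Proof.
apply: EFin_inj; case: hW => _ h; rewrite !h; congr expectation.
by apply/funext => w; rewrite mulrC.
Qed.

Lemma wiener_start u : \forall w \ae P, W 0 u w = 0.
Proof.
case: hW => -[_ _ /(_ 1%N (fun=> u))[_ z _ _ _]] _.
by apply: filterS z => w /rowP/(_ 0); rewrite !mxE.
Qed.

(** For a single functional the covariance matrix has one entry, and comparing second moments at
    time 1 shows that it is u (Q u). *)
Lemma wiener_increment_law s t u : 0 <= s -> s <= t ->
  normal_law (fun D => P [set w | D (W t u w - W s u w)]) 0 ((t - s) * u (Q u)).
Proof.
case: hW => -[_ _ /(_ 1%N (fun=> u))[_ _ _ _ [C [_ _ law]]]] _.
pose a : 'rV[R]_1 := const_mx 1.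
pose c := (a *m C *m a^T) 0 0.
have E t' s' w : ((Wrow (fun=> u) t' w - Wrow (fun=> u) s' w) *m a^T) 0 0 =
    W t' u w - W s' u w.
  by rewrite mxE big_ord1 !mxE mulr1.
have law' s' t' : 0 <= s' -> s' <= t' ->
  normal_law (fun D => P [set w | D (W t' u w - W s' u w)]) 0 ((t' - s') * c).
  move=> s0 st; apply: eq_normal_law (law s' t' a s0 st) => D mD.
  by congr (P _); apply/seteqP; split=> w /=; rewrite -E.
suff -> : u (Q u) = c by exact: law'.
apply: (@normal_law_second_moment _ _ _ P (W 1 u)) => //; last first.
  exact: wiener_second_moment.
have := law' 0 1 (lexx _) ler01; rewrite subr0 mul1r; apply: eq_normal_law => D mD.
apply: measure_eq_ae.
- by rewrite -[X in measurable X]setTI; exact: mW.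
- rewrite -[X in measurable X]setTI.
  by apply: (measurable_funB (mW 1 u) (mW 0 u)).
- by apply: filterS (wiener_start u) => w /= ->; rewrite subr0.
Qed.

Lemma wiener_law t u : 0 <= t ->
  normal_law (fun D => P (W t u @^-1` D)) 0 (t * u (Q u)).
Proof.
move=> t0; have := wiener_increment_law u (lexx 0) t0; rewrite subr0.
apply: eq_normal_law => D mD; apply: measure_eq_ae.
- by rewrite -[X in measurable X]setTI; exact: mW.
- rewrite -[X in measurable X]setTI.
  by apply: (measurable_funB (mW t u) (mW 0 u)).
- by apply: filterS (wiener_start u) => w /= ->; rewrite subr0.
Qed.

Lemma wiener_cos t u c b : 0 <= t ->
  Rintegral P setT (fun w => cos (c * W t u w + b)) =
  cos b * expR (- (c ^+ 2 * (t * u (Q u)) / 2)).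
Proof. by move=> t0; rewrite (normal_law_cos c b (mW t u) (wiener_law u t0)). Qed.

Lemma Rintegral_ae_eq (f g : Omega -> R) : measurable_fun setT f ->
  measurable_fun setT g -> (\forall w \ae P, f w = g w) ->
  Rintegral P setT f = Rintegral P setT g.
Proof.
move=> mf mg fg; rewrite /Rintegral; congr fine; apply: ae_eq_integral => //.
- exact/measurable_EFinP.
- exact/measurable_EFinP.
- by apply: filterS fg => w -> _.
Qed.

Let measurable_cosD (f : Omega -> R) b : measurable_fun setT f ->
  measurable_fun setT (fun w => cos (f w + b)).
Proof.
move=> mf; apply: (@measurableT_comp _ _ _ _ _ _ cos) => //; last exact: measurable_funD.
by apply: continuous_measurable_fun; exact: continuous_cos.
Qed.

(** For every linear combination v of the functionals both sides give a centred Gaussian of variance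
    t v (Q v). *)
Lemma wiener_scaling t n (u : 'I_n -> dual U) (B : set (borel 'rV[R]_n)) :
  0 <= t -> measurable B ->
  P [set w | B (\row_i W t (u i) w)] =
  P [set w | B (\row_i (Num.sqrt t * W 1 (u i) w))].
Proof.
move=> t0 mB.
have Poo : (P setT < +oo)%E by rewrite probability_setT ltry.
have mf i : measurable_fun setT (W t (u i)) by exact: mW.
have mg i : measurable_fun setT (fun w => Num.sqrt t * W 1 (u i) w).
  by apply: measurable_funM => //; exact: mW.
apply: (charfun_law_eq Poo Poo mf mg) => // a.
have key b : Rintegral P setT (fun w => cos ((\sum_i a i * W t (u i) w) + b)) =
    Rintegral P setT (fun w => cos ((\sum_i a i * (Num.sqrt t * W 1 (u i) w)) + b)).
  pose v : dual U := \sum_i a i *: u i.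
  transitivity (Rintegral P setT (fun w => cos (1 * W t v w + b))).
    apply: Rintegral_ae_eq.
    - by apply: measurable_cosD; apply: measurable_sum => i; exact: measurable_funM.
    - by apply: measurable_cosD; apply: measurable_funM.
    - apply: filterS (cylindrical_rv_sum (linW t0) a u) => w.
      by rewrite -/v => ->; rewrite mul1r.
  rewrite wiener_cos// expr1n mul1r.
  transitivity (Rintegral P setT (fun w => cos (Num.sqrt t * W 1 v w + b))).
    by rewrite wiener_cos// sqr_sqrtr// mul1r.
  apply: Rintegral_ae_eq.
  - by apply: measurable_cosD; apply: measurable_funM.
  - by apply: measurable_cosD; apply: measurable_sum => i; exact: measurable_funM.
  - apply: filterS (cylindrical_rv_sum (linW ler01) a u) => w.
    rewrite -/v => ->; rewrite mulr_sumr; congr (cos (_ + _)).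
    by apply: eq_bigr => i _; rewrite mulrCA.
split; last first.
  have := key (- (pi / 2)).
  by congr (_ = _); apply: eq_Rintegral => w _; rewrite cosBpihalf.
by have := key 0; congr (_ = _); apply: eq_Rintegral => w _; rewrite addr0.
Qed.

End Strongly_cylindrical_wiener_process.

(** * The Gaussian law of a random element inducing the process at time one *)

Section Induced_process.
Context {d : measure_display} {Omega : measurableType d} {R : realType}.
Variables (P : probability Omega R) (F : R -> set (set Omega)).
Hypothesis hF : is_filtration F.
Context {U : completeNormedModType R}.
Hypothesis sU : separable U.
Variables (W : R -> dual U -> {RV P >-> R}) (Q : dual U -> U).
Hypothesis hW : strongly_cylindrical_wiener F W Q.

Let linW t : 0 <= t -> cylindrical_rv (W t).
Proof. by case: hW => -[+ _ _] _; exact. Qed.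

Let mW t u : measurable_fun setT (W t u) := @measurable_funPT _ _ _ _ (W t u).

Let Poo : (P setT < +oo)%E. Proof. by rewrite probability_setT ltry. Qed.

Section Time_one.
Variable Y : Omega -> U.
Hypothesis mY : @measurable_fun _ _ Omega (borel U) setT Y.
Hypothesis YW : forall u, \forall w \ae P, W 1 u w = u (Y w).

Let muY (u : dual U) : measurable_fun setT (fun w => u (Y w)).
Proof. exact: measurable_dual_random_element. Qed.

Lemma induced_cylinder n (u : 'I_n -> dual U) (B : set (borel 'rV[R]_n)) :
  measurable B ->
  P (Y @^-1` cylinder u B) = P [set w | B (\row_i W 1 (u i) w)].
Proof.
move=> mB; apply: measure_eq_ae.
- by rewrite -[X in measurable X]setTI; apply: mY => //; exact: measurable_cylinder.
- rewrite -[X in measurable X]setTI.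
  exact: (@measurable_row R _ _ n (fun i => W 1 (u i)) (fun i => mW 1 (u i))).
- have : \forall w \ae P, forall i, W 1 (u i) w = u i (Y w).
    by apply: filter_forall => i; exact: YW.
  apply: filterS => w H; rewrite /cylinder/=.
  by rewrite (_ : \row_i W 1 (u i) w = \row_i u i (Y w))//;
    apply/rowP => i; rewrite !mxE H.
Qed.

Let integrableW u v : P.-integrable setT (EFin \o (fun w => W 1 u w * W 1 v w)).
Proof.
have i2 z : P.-integrable setT (EFin \o (fun w => W 1 z w ^+ 2)).
  apply/integrableP; split.
    by apply/measurable_EFinP; exact: measurable_funX.
  under eq_integral do rewrite /= ger0_norm ?sqr_ge0//.
  by rewrite (wiener_second_moment hW) ltry.
apply: (@le_integrable _ _ _ P setT measurableT _
  (fun w => (W 1 u w ^+ 2)%:E + (W 1 v w ^+ 2)%:E)%E) (integrableD measurableT (i2 u) (i2 v)).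
- by apply/measurable_EFinP; exact: measurable_funM.
- move=> w _ /=; rewrite lee_fin; set a := W 1 u w; set b := W 1 v w.
  rewrite [leRHS]ger0_norm ?addr_ge0 ?sqr_ge0// normrM.
  rewrite -[a ^+ 2](real_normK (num_real a)) -[b ^+ 2](real_normK (num_real b)).
  by have := sqr_ge0 (`|a| - `|b|); have := sqr_ge0 `|a|; have := sqr_ge0 `|b|;
    rewrite sqrrB; lra.
Qed.

Let integrableW1 u : P.-integrable setT (EFin \o W 1 u).
Proof.
have i2 := integrableW u u.
have i1 : P.-integrable setT (EFin \o cst (1 : R)).
  by apply: (@bounded_integrable _ _ _ P (cst 1) 1) => // w; rewrite normr1.
apply: (@le_integrable _ _ _ P setT measurableT _
  (fun w => 1%:E + (W 1 u w * W 1 u w)%:E)%E) (integrableD measurableT i1 i2).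
- exact/measurable_EFinP.
- move=> w _ /=; rewrite lee_fin; set a := W 1 u w; rewrite -expr2.
  rewrite [leRHS]ger0_norm ?addr_ge0 ?sqr_ge0//.
  rewrite -[a ^+ 2](real_normK (num_real a)).
  by have := sqr_ge0 (`|a| - 1); rewrite sqrrB1; have := sqr_ge0 `|a|; lra.
Qed.

(** The variable at [- u] is almost surely the opposite of the one at [u], and it has the same law
    because the variances coincide; so the mean equals its own opposite. [covariance] subtracts
    means, hence the need. *)
Let meanW u : (\int[P]_w (W 1 u w)%:E = 0)%E.
Proof.
have Q_N : (- u : dual U) (Q (- u)) = u (Q u).
  have H (z : U) : (- u : dual U) z = - u z by [].
  have QN (v : dual U) : v (Q (- u)) = - v (Q u).
    by rewrite (wiener_covariance_sym hW) H (wiener_covariance_sym hW).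
  by rewrite H QN opprK.
have E1 : (\int[P]_w (W 1 u w)%:E = \int[P]_w (W 1 (- u) w)%:E)%E.
  have pf z : (\int[P]_w (W 1 z w)%:E = \int[pushforward P (W 1 z)]_x x%:E)%E.
    by rewrite (@integral_pushforward _ _ Omega R R (W 1 z) (mW 1 z))//;
      exact: integrableW1.
  rewrite !pf; apply: eq_measure_integral => A mA _.
  have [_ Hu] := wiener_law hW u ler01.
  have [_ HNu] := wiener_law hW (- u) ler01.
  transitivity (gauss 0 (1 * u (Q u)) A); first exact: Hu.
  by rewrite -Q_N; apply/esym; exact: HNu.
have E2 : (\int[P]_w (W 1 (- u) w)%:E = - \int[P]_w (W 1 u w)%:E)%E.
  rewrite -integralN; last by apply: integrable_add_def => //; exact: integrableW1.
  apply: ae_eq_integral => //.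
  - by apply/measurable_EFinP.
  - by apply: measurableT_comp => //; apply/measurable_EFinP.
  - have := linW ler01 (-1) u 0; apply: filterS2 (cylindrical_rv0 (linW ler01)).
    move=> w h; rewrite scaleN1r addr0 h => -> _.
    by rewrite addr0 mulN1r EFinN.
have fi := integrable_fin_num measurableT (integrableW1 u).
move: E1 fi; rewrite E2.
by case: (\int[P]_w (W 1 u w)%:E)%E => [r|//|//] [H] _; congr EFin; lra.
Qed.

Lemma induced_gaussian_law : exists nu : probability (borel U) R,
  [/\ forall A : set (borel U), nu A = P (Y @^-1` A), gaussian_measure nu &
      covariance_operator_of nu Q].
Proof.
pose Ym : {mfun Omega >-> borel U} := HB.pack Y
  (@isMeasurableFun.Build _ _ Omega (borel U) Y mY).
pose nu : probability (borel U) R := distribution P Ym.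
have nuE (A : set (borel U)) : nu A = P (Y @^-1` A) by [].
exists nu; split => //.
  move=> u; exists 0, (u (Q u)).
  have := wiener_law hW u ler01; rewrite mul1r; apply: eq_normal_law => D mD.
  rewrite nuE; apply: measure_eq_ae.
  - by have := muY u measurableT mD; rewrite setTI.
  - by have := mW 1 u measurableT mD; rewrite setTI.
  - by apply: filterS (YW u) => w /=; rewrite /preimage/= => ->.
have integral_nu (f : U -> R) (g : Omega -> R) :
    @measurable_fun _ _ (borel U) R setT f ->
    P.-integrable setT (EFin \o g) -> (\forall w \ae P, g w = f (Y w)) ->
    (\int[nu]_x (f x)%:E = \int[P]_w (g w)%:E)%E.
  move=> mf ig fg; have mg := measurable_int _ ig.
  have mfY : measurable_fun setT (fun w => (f (Y w))%:E).
    apply/measurable_EFinP.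
    exact: (@measurableT_comp _ _ _ _ (borel U) R f setT Y mf mY).
  have ae : ae_eq P setT (fun w => (g w)%:E) (fun w => (f (Y w))%:E).
    by apply: filterS fg => w -> _.
  have ifY : P.-integrable setT (fun w => (f (Y w))%:E).
    apply/integrableP; split=> //; have /integrableP[_] := ig.
    congr (_ < _)%E; apply: ae_eq_integral => //; try exact: measurableT_comp.
    by apply: filterS fg => w /= ->.
  rewrite (@integral_distribution _ _ _ _ _ P Ym (EFin \o f))//.
  - exact/esym/ae_eq_integral.
  - exact/measurable_EFinP.
have mu_ (u : dual U) : @measurable_fun _ _ (borel U) R setT u.
  by apply: continuous_borel_measurable; exact: dual_continuous.
have mean0 (u : dual U) : ('E_nu[u] = 0)%E.
  by rewrite expectation_integral (integral_nu u (W 1 u)) ?meanW.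
move=> u v; rewrite /covariance_operator_of unlock !mean0/= expectation_integral.
rewrite (integral_nu _ (fun w => W 1 u w * W 1 v w))//.
- by case: hW => _ ->; rewrite expectation_integral.
- by apply: measurable_funM; apply: measurable_funB.
- by apply: filterS2 (YW u) (YW v) => w -> ->; rewrite /= !fctE /= !subr0.
Qed.

End Time_one.

End Induced_process.

Lemma ge_measure_compl d (T : measurableType d) (R : realType)
    (m : {measure set T -> \bar R}) (A B : set T) (e : R) :
  m setT = 1%E -> measurable A -> measurable B -> A `<=` B ->
  (m (~` A) <= e%:E)%E -> ((1 - e)%:E <= m B)%E.
Proof.
move=> mT mA mB AB mAe.
apply: (@le_trans _ _ (m A)); last by apply: le_measure; rewrite ?inE.
have mE : (m A + m (~` A) = 1)%E.
  by rewrite -mT -measureU ?setUv ?setICr//; exact: measurableC.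
by rewrite EFinB leeBlDr// -mE leeD2l.
Qed.

(** * From tightness to an extension, and from an extension to a Wiener process *)

Section Equivalences.
Context {d : measure_display} {Omega : measurableType d} {R : realType}.
Variables (P : probability Omega R) (F : R -> set (set Omega)).
Hypothesis hF : is_filtration F.
Context {U : completeNormedModType R}.
Hypothesis sU : separable U.
Variables (W : R -> dual U -> {RV P >-> R}) (Q : dual U -> U).
Hypothesis hW : strongly_cylindrical_wiener F W Q.

Let linW t : 0 <= t -> cylindrical_rv (W t).
Proof. by case: hW => -[+ _ _] _; exact. Qed.

Let mW t u : measurable_fun setT (W t u) := @measurable_funPT _ _ _ _ (W t u).

Let Poo : (P setT < +oo)%E. Proof. by rewrite probability_setT ltry. Qed.

Lemma tight_distribution_extends mu :
  cylindrical_distribution (W 1) mu -> tight mu ->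
  exists nu : {measure set (borel U) -> \bar R}, extends_to mu nu.
Proof.
move=> Wmu tmu; have law := cylindrical_distribution_law (linW ler01) Wmu.
have [||||Y [mY YW]] := @tight_cylindrical_rv_induced _ _ _ P measurable U (W 1) sU.
- exact: sigma_algebra_measurable.
- by [].
- by move=> u D mD; rewrite -[X in measurable X]setTI; exact: mW.
- move=> eps e0; have [K cK HK] := tmu _ e0; exists K => // n u B mB KB.
  rewrite -law//; apply: HK => //.
  by exists n, u, B.
have mY' : @measurable_fun _ _ Omega (borel U) setT Y.
  by move=> _ B mB; rewrite setTI; exact: mY.
exists (measure_function_pushforward__canonical__measure_function_Measure P mY').
move=> Z [n [u [B mB <-]]]; rewrite law//=.
exact: induced_cylinder.
Qed.

Lemma radon_distribution_induces mu (nu : {measure set (borel U) -> \bar R}) t :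
  cylindrical_distribution (W 1) mu -> extends_to mu nu -> 0 <= t ->
  exists Y : Omega -> U,
    (forall B : set (borel U), measurable B -> F t (Y @^-1` B)) /\
    forall u, \forall w \ae P, W t u w = u (Y w).
Proof.
move=> Wmu nuE t0; have law := cylindrical_distribution_law (linW ler01) Wmu.
have nulaw n (u : 'I_n -> dual U) (B : set (borel 'rV[R]_n)) : measurable B ->
    nu (cylinder u B) = P [set w | B (\row_i W 1 (u i) w)].
  by move=> mB; rewrite nuE ?law//; exists n, u, B.
(* The whole space is the cylinder over the empty family of functionals. *)
have nuT : nu setT = 1%E.
  have := @nulaw 0%N (fun=> 0) setT measurableT.
  by rewrite [X in P X](_ : _ = setT) ?probability_setT//.
have nuoo : (nu setT < +oo)%E by rewrite nuT ltry.
have [sF Fm] := hF.1 t t0.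
apply: (@tight_cylindrical_rv_induced _ _ _ P (F t) U (W t)) => //.
  by move=> u D mD; case: hW => -[_ + _] _; exact.
move=> eps e0; have [K cK HK] := ulam_tight sU nuoo e0.
have cK' : compact ((fun x => Num.sqrt t *: x) @` K).
  by apply: continuous_compact => //; apply: continuous_subspaceT => x; exact: scaler_continuous.
exists ((fun x => Num.sqrt t *: x) @` K) => // n u B mB KB.
rewrite (wiener_scaling hW)//.
(* Scaling is moved from the process to the test set: if the scaled compact set lies in the cylinder
   over [B], then [K] lies in the cylinder over [B']. *)
pose B' : set (borel 'rV[R]_n) := [set r | B (\row_i (Num.sqrt t * r 0 i))].
have mB' : measurable B'.
  have mc (i : 'I_n) : @measurable_fun _ _ (borel 'rV[R]_n) R setT
      (fun r => Num.sqrt t * r 0 i).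
    by apply: measurable_funM => //; exact: measurable_coord.
  by have := measurable_row mc measurableT mB; rewrite setTI.
have -> : [set w | B (\row_i (Num.sqrt t * W 1 (u i) w))] =
    [set w | B' (\row_i W 1 (u i) w)].
  by apply/seteqP; split=> w /=; rewrite /B'/=; congr (B _); apply/rowP => i;
    rewrite !mxE.
rewrite -nulaw//.
have KB' : K `<=` cylinder u B'.
  move=> x Kx; have := KB (Num.sqrt t *: x); rewrite /cylinder/= /B'/=.
  rewrite (_ : \row_i u i (Num.sqrt t *: x) = \row_i (Num.sqrt t * (\row_j u j x) 0 i)).
    by apply; exists x.
  apply/rowP => i; rewrite !mxE.
  by have := dual_linear (u i) (Num.sqrt t) x 0; rewrite !addr0 dual0 addr0.
have mK : @measurable _ (borel U) K.
  by apply: closed_borel_measurable; apply: compact_closed cK; exact: norm_hausdorff.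
have mC := measurable_cylinder u mB'.
exact: ge_measure_compl nuT mK mC KB' HK.
Qed.

Lemma induced_wiener_process (Y : R -> Omega -> U) :
  (forall t, 0 <= t -> forall B : set (borel U), measurable B -> F t (Y t @^-1` B)) ->
  induced_by W Y -> wiener_process P F Y.
Proof.
move=> aY YW.
have [u [ux xu]] := norming_sequence sU.
have mY t : 0 <= t -> @measurable_fun _ _ Omega (borel U) setT (Y t).
  by move=> t0 _ B mB; rewrite setTI; apply: (hF.1 t t0).2; exact: aY.
have mincr s t : 0 <= s -> 0 <= t ->
    @measurable_fun _ _ Omega (borel U) setT (fun w => Y t w - Y s w).
  move=> s0 t0; apply: measurable_random_element => // v.
  under eq_fun do rewrite dualB.
  by apply: measurable_funB; apply: measurable_dual_random_element; exact: mY.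
pose row n t w : 'rV[R]_n := \row_(i < n) W t (u i) w.
have mrow n t : @measurable_fun _ _ Omega (borel 'rV[R]_n) setT (row n t).
  by apply: measurable_row => i; exact: mW.
have mincrow n s t (B : set (borel 'rV[R]_n)) : measurable B ->
    measurable (increment_in (row n) s t B).
  move=> mB; have mr (i : 'I_n) : measurable_fun setT (fun w => W t (u i) w - W s (u i) w).
    by apply: measurable_funB; exact: mW.
  have := measurable_row mr measurableT mB; rewrite setTI /increment_in.
  congr (measurable _); apply/seteqP; split=> w /=; congr (B _);
  by apply/rowP => i; rewrite !mxE.
have incE n s t (B : set (borel 'rV[R]_n)) : 0 <= s -> 0 <= t -> 
    \forall w \ae P, increment_in Y s t (cylinder (fun i : 'I_n => u i) B) w <->
      increment_in (row n) s t B w.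
  move=> s0 t0.
  have : \forall w \ae P, forall i : 'I_n, W t (u i) w - W s (u i) w = u i (Y t w - Y s w).
    apply: filter_forall => i.
    by apply: filterS2 (YW t (u i) t0) (YW s (u i) s0) => w -> ->; rewrite dualB.
  apply: filterS => w H; rewrite /increment_in/= /cylinder/=.
  rewrite (_ : row n t w - row n s w = \row_(i < n) u i (Y t w - Y s w))//.
  by apply/rowP => i; rewrite !mxE H.
have PincE n s t (B : set (borel 'rV[R]_n)) : 0 <= s -> 0 <= t -> measurable B ->
    P (increment_in Y s t (cylinder (fun i : 'I_n => u i) B)) =
    P (increment_in (row n) s t B).
  move=> s0 t0 mB; apply: measure_eq_ae; [|exact: mincrow|exact: incE].
  have := mincr s t s0 t0 measurableT _ (measurable_cylinder (fun i : 'I_n => u i) mB).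
  by rewrite setTI.
split.
- exact: aY.
- have : \forall w \ae P, forall n, u n (Y 0 w) = 0.
    apply: ae_foralln => n.
    by apply: filterS2 (YW 0 (u n) (lexx _)) (wiener_start hW (u n)) => w <-.
  apply: filterS => w H; apply/eqP; rewrite -normr_le0; apply: xu => // n.
  by rewrite H.
- move=> n t A t00 tmono mA.
  have t0 i : 0 <= t i.
    by elim: i => [|i IH]; [exact: t00|exact: le_trans IH (tmono i)].
  have := @independence_from_cylinders _ _ _ P U sU u n
    (fun i w => Y (t i.+1) w - Y (t i) w) ux xu _ _ A mA.
  apply; first by move=> i; exact: mincr.
  move=> {mA}A cA.
  have /choice[N HN] i : exists N, cylinders_over (fun i : 'I_N => u i) (A i) by exact: cA.
  (* The cylinders lie over segments of different lengths, but the independence of increments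
     concerns one process with values in rows of a fixed length. All of them are widened to the
     longest segment; indices from n on get the full set. *)
  pose M := (\max_(i < n) N i)%N.
  have /choice[B HB] (i : nat) : exists B : set (borel 'rV[R]_M), measurable B /\
      ((i < n)%N -> A i = cylinder (fun i : 'I_M => u i) B).
    have [ni|ni] := ltnP i n; last by exists setT; split => //; exact: measurableT.
    have NM : (N i <= M)%N by exact: (leq_bigmax (F := fun i : 'I_n => N i) (Ordinal ni)).
    by have [B mB BE] := initial_cylinder_widen NM (HN i); exists B; split => // _; rewrite BE.
  have mB i : measurable (B i) := (HB i).1.
  have Wind : P (\bigcap_(i < n) increment_in (row M) (t i) (t i.+1) (B i)) =
      (\prod_(i < n) P (increment_in (row M) (t i) (t i.+1) (B i)))%E.
    by case: hW => -[_ _ /(_ M (fun i => u i))[_ _ ind _ _]] _; exact: ind.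
  transitivity (P (\bigcap_(i < n) increment_in (row M) (t i) (t i.+1) (B i))).
    apply: measure_eq_ae.
    - rewrite bigcap_mkord; apply: big_ind => //; first exact: measurableI.
      move=> i _; have := mincr (t i) (t i.+1) (t0 i) (t0 i.+1) measurableT (A i).
      rewrite setTI; apply; apply: (@initial_cylinder_measurable _ _ u); exact: cA.
    - rewrite bigcap_mkord; apply: big_ind => //; first exact: measurableI.
      by move=> i _; exact: mincrow.
    - have : \forall w \ae P, forall i, increment_in Y (t i) (t i.+1)
          (cylinder (fun i : 'I_M => u i) (B i)) w <->
          increment_in (row M) (t i) (t i.+1) (B i) w.
        by apply: ae_foralln => i; exact: incE.
      apply: filterS => w H; split=> Hw i /= ni.
        by apply/H; rewrite -((HB i).2 ni); exact: Hw.
      by have := (H i).2 (Hw i ni); rewrite -((HB i).2 ni).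
  rewrite Wind; apply: eq_bigr => i _.
  by rewrite -PincE// -((HB i).2 (ltn_ord i)).
- move=> s h A s0 h0 mA.
  have sh0 : 0 <= s + h by exact: addr_ge0.
  apply: (@law_from_cylinders _ _ _ P U sU u (fun w => Y (s + h) w - Y s w)
    (fun w => Y h w - Y 0 w) ux xu) => //; [exact: mincr|exact: mincr|].
  move=> B [n [C mC <-]].
  transitivity (P (increment_in (row n) s (s + h) C)); first exact: PincE.
  transitivity (P (increment_in (row n) 0 h C)); last by apply/esym; exact: PincE.
  by case: hW => -[_ _ /(_ n (fun i => u i))[_ _ _ st _]] _; exact: st.
- exists Q; split.
    have [nu [_ gnu cnu]] := induced_gaussian_law hW (mY 1 ler01) (fun u => YW 1 u ler01).
    by exists nu.
  move=> s t v s0 st; have t0 := le_trans s0 st.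
  apply: eq_normal_law (wiener_increment_law hW v s0 st) => D mD.
  apply: measure_eq_ae.
  - have mv := measurable_dual_random_element v (mincr s t s0 t0).
    by have := mv measurableT D mD; rewrite setTI.
  - rewrite -[X in measurable X]setTI.
    by apply: (measurable_funB (mW t v) (mW s v)).
  - by apply: filterS2 (YW t v t0) (YW s v s0) => w /= -> ->; rewrite dualB.
Qed.

End Equivalences.

(** * The reproducing kernel space and radonification *)

Section Reproducing_kernel.
Context {d : measure_display} {Omega : measurableType d} {R : realType}.
Variables (P : probability Omega R) (F : R -> set (set Omega)).
Context {U : completeNormedModType R}.
Hypothesis sU : separable U.
Variables (W : R -> dual U -> {RV P >-> R}) (Q : dual U -> U).
Hypothesis hW : strongly_cylindrical_wiener F W Q.
Context {HQ : completeNormedModType R}.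
Variables (ip : HQ -> HQ -> R) (iQ : {linear HQ -> U}).
Hypothesis hQ : is_rkhs Q ip iQ.

Let linW t : 0 <= t -> cylindrical_rv (W t).
Proof. by case: hW => -[+ _ _] _; exact. Qed.

Let mW t u : measurable_fun setT (W t u) := @measurable_funPT _ _ _ _ (W t u).

Let Poo : (P setT < +oo)%E. Proof. by rewrite probability_setT ltry. Qed.

(** Symmetry moves the linear combination to the side of the functional, and a norming sequence
    separates points. *)
Lemma covariance_operator_linear a u v : Q (a *: u + v) = a *: Q u + Q v.
Proof.
have [f [_ fU]] := norming_sequence sU.
apply/eqP; rewrite -subr_eq0 -normr_le0; apply: fU => // n.
rewrite dualB dual_linear !(wiener_covariance_sym hW _ (f n)).
by rewrite /= subrr.
Qed.

Lemma pullback_subproof (u : dual U) : (u \o iQ : HQ -> R^o) \in @dual_pred R HQ.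
Proof.
apply/asboolP; split=> [a x y|x]; first by rewrite /= linearP dual_linear.
by case: hQ => _ ciQ _; apply: continuous_comp; [exact: ciQ|exact: dual_continuous].
Qed.

Definition pullback u : dual HQ := Dual (pullback_subproof u).

Lemma rkhs_adjoint : exists J : dual U -> HQ,
  [/\ forall (a : R) u v, J (a *: u + v) = a *: J u + J v, dense (range J),
      forall u : dual U, u (Q u) = `|J u| ^+ 2 & forall u x, pullback u x = ip x (J u)].
Proof.
case: hQ => ipP ciQ [j [linj ipj dj iQj]]; exists (fun u => j (Q u)); split.
- by move=> a u v; rewrite covariance_operator_linear linj.
- by move: dj; rewrite image_comp.
- by move=> u; rewrite -(ipxx ipP) ipj.
move=> u x; apply/eqP; rewrite -subr_eq0; apply/negPn/negP => neq.
have cg : continuous (fun y => pullback u y - ip y (j (Q u))).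
  by move=> y; apply: cvgB; [exact: dual_continuous|exact: ip_continuous].
have [||y [/= ny [z [v _ vz] zy]]] :=
    dj [set y | pullback u y - ip y (j (Q u)) != 0].
- by exists x.
- by apply: (open_comp (f := fun y => pullback u y - ip y (j (Q u))) (D := [set z | z != 0]));
    [move=> y _; exact: cg|exact: open_neq].
- by move: ny; rewrite -zy -vz iQj ipj subrr eqxx.
Qed.

Lemma induced_radonifying (Y : Omega -> U) :
  @measurable_fun _ _ Omega (borel U) setT Y ->
  (forall u, \forall w \ae P, W 1 u w = u (Y w)) -> gamma_radonifying ip iQ.
Proof.
move=> mY YW; have [J [linJ dJ QJ iQJ]] := rkhs_adjoint.
have ipP : is_inner_product ip by case: hQ.
have [nu [nuE gnu _]] := induced_gaussian_law hW mY YW.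
have EX u : (\int[P]_w (W 1 u w ^+ 2)%:E = (`|J u| ^+ 2)%:E)%E.
  by rewrite (wiener_second_moment hW) QJ.
have lawX u : normal_law (fun D => P (W 1 u @^-1` D)) 0 (`|J u| ^+ 2).
  by rewrite -QJ -[u (Q u)]mul1r; exact: wiener_law hW _ _ _.
have [Z [mZ linZ ZX Zcos]] := isonormal_extension (linW ler01) linJ dJ EX lawX ipP.
have [gamma [cgamma gammaE]] := cylindrical_measure_of_rv mZ linZ.
exists gamma; last first.
  exists nu => // _ [n [u [B mB <-]]].
  transitivity (P (Y @^-1` cylinder u B)); first exact: nuE.
  rewrite (induced_cylinder mY YW)//.
  transitivity (gamma (cylinder (fun i => pullback (u i)) B)); last by [].
  rewrite gammaE//; apply: measure_eq_ae.
  - rewrite -[X in measurable X]setTI.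
    exact: (@measurable_row R _ _ n (fun i => W 1 (u i)) (fun i => mW 1 (u i))).
  - by rewrite -[X in measurable X]setTI; apply: measurable_row.
  (* [pullback (u i)] is represented by [J (u i)], so the isonormal process extends the given
     variables there. *)
  - have : \forall w \ae P, forall i, Z (pullback (u i)) w = W 1 (u i) w.
      by apply: filter_forall => i; apply: ZX => x; exact: iQJ.
    apply: filterS => w H; rewrite /=.
    by rewrite (_ : \row_i W 1 (u i) w = \row_i Z (pullback (u i)) w)//;
      apply/rowP => i; rewrite !mxE H.
split => // h f fh.
rewrite (char_fun_law (m := P) (X := Z f) cgamma Poo (mZ f)).
  congr Complex.
    by have := Zcos f h 0 fh; rewrite cos0 mul1r => <-;
      apply: eq_Rintegral => w _; rewrite addr0.
  have := Zcos f h (- (pi / 2)) fh; rewrite cosN cos_pihalf mul0r => <-.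
  by apply: eq_Rintegral => w _; rewrite cosBpihalf.
move=> D /(dual_preimage_cylinder f)[B mB [<- BD]].
rewrite gammaE//; congr (P _).
by apply/seteqP; split=> w /=; rewrite BD.
Qed.

Lemma radonifying_tight : gamma_radonifying ip iQ ->
  exists2 mu : set U -> \bar R, cylindrical_distribution (W 1) mu & tight mu.
Proof.
move=> [gamma [cgamma gammaE] [nu gnu nuE]].
have [J [linJ dJ QJ iQJ]] := rkhs_adjoint.
have mcyl n (u : 'I_n -> dual U) Z : cylinders_over u Z -> @measurable _ (borel U) Z.
  by move=> [B mB <-]; exact: measurable_cylinder.
have nuoo : (nu setT < +oo)%E by rewrite probability_setT ltry.
have cnu : cylindrical_measure (nu : set U -> \bar R).
  move=> n u.
  have mid : @measurable_fun _ _ (borel U) (g_sigma_algebraType (cylinders_over u)) setT id.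
    move=> _ Z; rewrite /measurable/= (sigma_algebra_id (cylinders_over_sigma_algebra u)).
    by rewrite setTI; exact: mcyl.
  by exists (measure_function_pushforward__canonical__measure_function_Measure nu mid).
(* The radonified measure itself serves as the cylindrical distribution: at u its characteristic
   function is that of [gamma] at [pullback u], namely exp (- |J u|^2 / 2), where |J u|^2 is the
   variance of [W 1 u]. *)
exists nu.
  split => // u.
  have mu : @measurable_fun _ _ (borel U) R setT u.
    by apply: continuous_borel_measurable; exact: dual_continuous.
  rewrite (char_fun_law (m := nu) (X := u : borel U -> R) cnu nuoo mu)//.
  have -> : Complex (Rintegral nu setT (fun w => cos (u w)))
      (Rintegral nu setT (fun w => sin (u w))) = char_fun gamma (pullback u).
    apply/esym; apply: (char_fun_law (m := nu) (X := u : borel U -> R)) => // D mD.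
    have [B mB [BE _]] := dual_preimage_cylinder u mD.
    by rewrite -BE nuE ?BE//; exists 1%N, (fun=> u), B.
  rewrite (gammaE (J u))// -QJ !expectation_integral.
  have wc := @wiener_cos _ _ _ _ _ _ _ _ hW 1 u 1.
  congr Complex.
    have := wc 0 ler01; rewrite cos0 expr1n !mul1r => <-.
    by apply: eq_Rintegral => w _; rewrite mul1r addr0.
  have := wc (- (pi / 2)) ler01; rewrite cosN cos_pihalf mul0r => <-.
  by apply: eq_Rintegral => w _; rewrite mul1r cosBpihalf.
move=> eps e0; have [K cK HK] := ulam_tight sU nuoo e0.
have mK : @measurable _ (borel U) K.
  by apply: closed_borel_measurable; apply: compact_closed cK; exact: norm_hausdorff.
exists K => // Z [n [u uZ]] KZ.
exact: ge_measure_compl (probability_setT nu) mK (mcyl _ _ _ uZ) KZ HK.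
Qed.

End Reproducing_kernel.

Theorem theorem8p1 (R : realType) (d : measure_display)
    (Omega : measurableType d) (P : probability Omega R)
    (F : R -> set (set Omega)) (hF : is_filtration F)
    (U : completeNormedModType R) (hU : separable U)
    (W : R -> dual U -> {RV P >-> R}) (Q : dual U -> U)
    (hW : strongly_cylindrical_wiener F W Q)
    (HQ : completeNormedModType R) (ip : HQ -> HQ -> R) (iQ : {linear HQ -> U})
    (hQ : is_rkhs Q ip iQ) :
  [<-> (exists2 Y : R -> Omega -> U, wiener_process P F Y & induced_by W Y);
       gamma_radonifying ip iQ;
       (exists2 mu : set U -> \bar R,
          cylindrical_distribution (W 1) mu & tight mu);
       (exists2 mu : set U -> \bar R,
          cylindrical_distribution (W 1) mu &
          exists nu : {measure set (borel U) -> \bar R}, extends_to mu nu)].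
Proof.
tfae.
- move=> [Y [aY _ _ _ _] YW]; apply: (induced_radonifying hU hW hQ (Y := Y 1)).
    by move=> _ B mB; rewrite setTI; apply: (hF.1 1 ler01).2; exact: aY.
  by move=> u; exact: YW.
- exact: (radonifying_tight hU hW hQ).
- move=> [mu Wmu tmu]; exists mu => //; exact: (tight_distribution_extends hU hW Wmu tmu).
move=> [mu Wmu [nu munu]].
(* Time is indexed by all reals, so the choice carries the premise t >= 0 and takes an arbitrary
   constant before 0. *)
have /choice[Y HY] (t : R) : exists Y : Omega -> U, 0 <= t ->
    (forall B : set (borel U), measurable B -> F t (Y @^-1` B)) /\
    forall u, \forall w \ae P, W t u w = u (Y w).
  have [t0|] := leP 0 t; last by exists (cst 0).
  by have [Y HY] := radon_distribution_induces hF hU hW Wmu munu t0; exists Y.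
have YW : induced_by W Y by move=> t u t0; exact: (HY t t0).2.
exists Y => //; apply: (induced_wiener_process hF hU hW) => // t t0.
exact: (HY t t0).1.
Qed.
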